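(* Let $\mathbb K$ be a field of characteristic $0$, let $s_\bullet$ be a gauge, and let $\mathfrak g$ be a nilpotent differential graded Lie algebra over $\mathbb K$ concentrated in degrees $[0,\infty)$. Then $\gamma_\bullet(\mathfrak g)$ is isomorphic to the nerve of the Deligne groupoid $\mathcal C(\mathfrak g)$.
   Context: Let $\mathfrak g$ be a differential graded (dg) Lie algebra with differential $\delta$ of degree $+1$; nilpotent means that its lower central series terminates. $\mathrm{MC}(\mathfrak g)=\{\alpha\in\mathfrak g^1\mid\delta\alpha+\frac12[\alpha,\alpha]=0\}$. Deligne groupoid. Let $G$ be the nilpotent group associated to the nilpotent Lie algebra $\mathfrak g^0$ (elements $e^X$, $X\in\mathfrak g^0$, with product given by the Campbell–Hausdorff formula). It acts on $\mathrm{MC}(\mathfrak g)$ by $$e^X\cdot\alpha=\alpha-\sum_{n=0}^\infty\frac{\mathrm{ad}(X)^n(\delta_\alpha X)}{(n+1)!},\qquad\delta_\alpha X=\delta X+[\alpha,X].$$ $\mathcal C(\mathfrak g)$ is the groupoid associated to this action (objects $\mathrm{MC}(\mathfrak g)$, morphisms the pairs of an element of $G$ and an object on which it acts). Forms. $\Omega_n=\mathbb K[t_0,\dots,t_n,dt_0,\dots,dt_n]/(t_0+\dots+t_n-1,\,dt_0+\dots+dt_n)$ is the dg commutative algebra of polynomial forms on the $n$-simplex ($|t_i|=0$, $|dt_i|=1$); these form a simplicial dg algebra $\Omega_\bullet$, where $f:[k]\to[n]$ acts by $f^*t_i=\sum_{f(j)=i}t_j$. $\mathfrak g\otimes\Omega_n$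 is a dg Lie algebra with differential $x\otimes a\mapsto\delta x\otimes a+(-1)^{|x|}x\otimes da$ and bracket $[x\otimes a,y\otimes b]=(-1)^{|a||y|}[x,y]\otimes ab$. Set $\mathrm{MC}_\bullet(\mathfrak g)=\mathrm{MC}(\mathfrak g\otimes\Omega_\bullet)$. Gauges. For $i_0,\dots,i_k\in\{0,\dots,n\}$, $I_{i_0\dots i_k}:\Omega_n\to\mathbb K$ is integration over the $k$-chain spanned by the vertices $(e_{i_0},\dots,e_{i_k})$: pull back to $\Omega_k$ along the affine map sending the $p$-th vertex to $e_{i_p}$, then apply $t_1^{a_1}\cdots t_k^{a_k}dt_1\cdots dt_k\mapsto a_1!\cdots a_k!/(a_1+\dots+a_k+k)!$ (zero on forms of degree $\ne k$). Put $\omega_{i_0\dots i_k}=k!\sum_{j=0}^k(-1)^jt_{i_j}dt_{i_0}\cdots\widehat{dt_{i_j}}\cdots dt_{i_k}$ and $P_n\omega=\sum_{k=0}^n\sum_{i_0<\dots<i_k}\omega_{i_0\dots i_k}I_{i_0\dots i_k}(\omega)$. A contraction is a family of $\mathbb K$-linear maps $s_n:\Omega_n^*\to\Omega_n^{*-1}$, compatible with all simplicial operators, with $\mathrm{id}-P_n=ds_n+s_nd$. A gauge is a contraction with $s_n^2=0$ for all $n$. The maps $s_n$ are extended to $\mathfrak g\otimes\Omega_n$ by acting on the second factor, and $\gamma_n(\mathfrak g)=\{\alpha\in\mathrm{MC}_n(\mathfrak g)\mid s_n\alpha=0\}$, a simplicial subset of $\mathrm{MC}_\bullet(\mathfrak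 g)$. *)

(* Defs.v *)
(* The sums \sum_(i \in A) F i below usually have an infinite index set A; they
   are the sums of the finitely many nonzero terms (fsbigop). *)
From HB Require Import structures.
From mathcomp Require Import all_boot all_order all_algebra.
From mathcomp Require Import generic_quotient ring_quotient.
From mathcomp Require Import boolp classical_sets functions cardinality fsbigop.
From mathcomp Require Import freeg mpoly.

Set Implicit Arguments.
Unset Strict Implicit.
Unset Printing Implicit Defensive.

Import GRing.Theory Num.Theory.
Local Open Scope ring_scope.
Local Open Scope quotient_scope.
Local Open Scope classical_set_scope.

Section LinearAlgebra.
Variable K : fieldType.

Inductive lin_span (V : lmodType K) (A : set V) : set V :=
| lin_span0 : lin_span A 0
| lin_spanZD (c : K) x y : A x -> lin_span A y -> lin_span A (c *: x + y).

Lemma lin_span_lin (V : lmodType K) (A : set V) c x y :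
  lin_span A x -> lin_span A y -> lin_span A (c *: x + y).
Proof.
move=> + Ay; elim=> [|b {}x z Ax _ IH]; first by rewrite scaler0 add0r.
by rewrite scalerDr scalerA -addrA; apply: lin_spanZD.
Qed.

Section QuotientModule.
Variables (V : lmodType K) (A : set V).

Definition span_pred : V -> bool := fun x => `[< lin_span A x >].

Lemma span_zmod_closed : zmod_closed span_pred.
Proof.
split; first by apply/asboolP/lin_span0.
move=> x y /asboolP Ax /asboolP Ay; apply/asboolP.
by rewrite addrC -scaleN1r; apply: lin_span_lin.
Qed.

Definition span_closed : zmodClosed V :=
  HB.pack span_pred (GRing.isZmodClosed.Build V span_pred span_zmod_closed).

Definition quotmod := Quotient.quot span_closed.

HB.instance Definition _ := GRing.Zmodule.on quotmod.
HB.instance Definition _ := EqQuotient.on quotmod.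

Definition qproj (x : V) : quotmod := \pi_quotmod x.
Definition qrepr (z : quotmod) : V := repr z.

Lemma qreprK : cancel qrepr qproj.
Proof. exact: reprK. Qed.

Lemma qproj_eq x y : qproj x = qproj y <-> lin_span A (x - y).
Proof.
split=> [/eqP|Axy]; first by rewrite /qproj piE Quotient.equivE => /asboolP.
by apply/eqP; rewrite /qproj piE Quotient.equivE; apply/asboolP.
Qed.

Lemma qprojD : {morph qproj : x y / x + y}.
Proof. by move=> x y; rewrite /qproj !piE. Qed.

Definition qscale (c : K) (z : quotmod) : quotmod := qproj (c *: qrepr z).

Lemma qscaleE c x : qscale c (qproj x) = qproj (c *: x).
Proof.
apply/qproj_eq; rewrite -scalerBr -[_ *: _]addr0.
by apply: lin_span_lin (lin_span0 A); apply/qproj_eq; rewrite qreprK.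
Qed.

Lemma qscaleA a b z : qscale a (qscale b z) = qscale (a * b) z.
Proof. by rewrite -(qreprK z) !qscaleE scalerA. Qed.

Lemma qscale1 : left_id 1 qscale.
Proof. by move=> z; rewrite -(qreprK z) qscaleE scale1r. Qed.

Lemma qscaleDr : right_distributive qscale +%R.
Proof.
move=> c z t; rewrite -(qreprK z) -(qreprK t) -qprojD !qscaleE.
by rewrite scalerDr qprojD.
Qed.

Lemma qscaleDl z : {morph qscale^~ z : a b / a + b}.
Proof. by move=> a b; rewrite -(qreprK z) !qscaleE scalerDl qprojD. Qed.

HB.instance Definition _ := GRing.Zmodule_isLmodule.Build K quotmod
  qscaleA qscale1 qscaleDr qscaleDl.

End QuotientModule.

Section TensorProduct.
Variables V W : lmodType K.
Local Notation free := {freeg (V * W) / K}.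

Definition tensor_rel : set free := [set r |
  (exists c x x' y, r = << (c *: x + x', y) >> - c *: << (x, y) >> - << (x', y) >>)
  \/
  (exists c x y y', r = << (x, c *: y + y') >> - c *: << (x, y) >> - << (x, y') >>)].

Definition tensor := quotmod tensor_rel.
HB.instance Definition _ := GRing.Lmodule.on tensor.

Definition tens (x : V) (y : W) : tensor := qproj tensor_rel << (x, y) >>.

(* The linear map induced by a bilinear one; it is computed on a representative,
   and tlift_linear, tlift_tens below say that this is legitimate. *)
Definition tlift (U : lmodType K) (f : V -> W -> U) (z : tensor) : U :=
  fglift (fun p => f p.1 p.2) (qrepr z).

Lemma tlift_qproj (U : lmodType K) (f : V -> W -> U) (D : free) :
  (forall y, linear (f^~ y)) -> (forall x, linear (f x)) ->
  tlift f (qproj tensor_rel D) = fglift (fun p => f p.1 p.2) D.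
Proof.
move=> fl fr; set F := fglift _.
have FB : {morph F : x y / x - y} by move=> x y; apply: lift_is_additive.
have F0 : F 0 = 0 by rewrite -(subrr 0) FB subrr.
have FD : {morph F : x y / x + y}.
  by move=> x y; rewrite -[y in LHS]opprK FB -[- y]sub0r FB F0 sub0r opprK.
have FU c p : F << c *g p >> = c *: f p.1 p.2 by rewrite /F liftU.
have FZ c x : F (c *: x) = c *: F x.
  elim/freeg_ind_dom0: x => [|k p x _ _ IH]; first by rewrite scaler0 F0 scaler0.
  rewrite scalerDr !FD IH FU scalerDr; congr (_ + _).
  suff -> : c *: << k *g p >> = << c * k *g p >> :> free by rewrite FU scalerA.
  by apply/eqP/freeg_eqP=> q; rewrite coeffZ !coeffU mulrA.
apply/eqP; rewrite -subr_eq0 -FB; apply/eqP.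
have : lin_span tensor_rel (qrepr (qproj tensor_rel D) - D).
  by apply/qproj_eq; rewrite qreprK.
elim=> // c r y rel_r _ IH; rewrite FD FZ IH addr0.
suff -> : F r = 0 by rewrite scaler0.
case: rel_r => -[a [x [x' [z ->]]]]; rewrite !FB FZ !FU !scale1r /=.
  by rewrite fl addrAC addrK subrr.
by rewrite fr addrAC addrK subrr.
Qed.

Lemma tlift_tens (U : lmodType K) (f : V -> W -> U) x y :
  (forall y, linear (f^~ y)) -> (forall x, linear (f x)) ->
  tlift f (tens x y) = f x y.
Proof. by move=> fl fr; rewrite tlift_qproj// liftU scale1r. Qed.

End TensorProduct.

End LinearAlgebra.

(* A graded vector space is a space with the projections onto its homogeneous
   components.  The records ending in Data hold the operations alone, so that
   the Maurer-Cartan set of g (x) A is defined by the same formula as that of g. *)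

Record dgLieData (K : fieldType) := DgLieData {
  lie_mod :> lmodType K;
  lie_comp : int -> lie_mod -> lie_mod;
  lie_diff : lie_mod -> lie_mod;
  lie_br : lie_mod -> lie_mod -> lie_mod }.

Record dgaData (K : fieldType) := DgaData {
  dga_mod :> lmodType K;
  dga_comp : nat -> dga_mod -> dga_mod;
  dga_diff : dga_mod -> dga_mod;
  dga_mul : dga_mod -> dga_mod -> dga_mod }.

Arguments lie_comp {K d} i x : rename.
Arguments lie_diff {K d} x : rename.
Arguments lie_br {K d} x y : rename.
Arguments dga_comp {K d} i x : rename.
Arguments dga_diff {K d} x : rename.
Arguments dga_mul {K d} x y : rename.

Section DgLie.
Variable K : fieldType.

Definition lie_homog (L : dgLieData K) (i : int) : set L :=
  [set x | lie_comp i x = x].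

Record isDgLie (L : dgLieData K) : Prop := IsDgLie {
  lie_comp_lin : forall i, linear (lie_comp i : L -> L);
  lie_comp_comp : forall i j (x : L),
    lie_comp i (lie_comp j x) = if i == j then lie_comp j x else 0;
  lie_comp_fin : forall x : L, finite_set [set i | lie_comp i x != 0];
  lie_comp_sum : forall x : L, \sum_(i \in [set: int]) lie_comp i x = x;
  lie_diff_lin : linear (lie_diff : L -> L);
  lie_diff_deg : forall i (x : L),
    lie_homog i x -> lie_homog (i + 1) (lie_diff x);
  lie_diff2 : forall x : L, lie_diff (lie_diff x) = 0;
  lie_br_linl : forall y : L, linear (lie_br^~ y : L -> L);
  lie_br_linr : forall x : L, linear (lie_br x : L -> L);
  lie_br_deg : forall i j (x y : L),
    lie_homog i x -> lie_homog j y -> lie_homog (i + j) (lie_br x y);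
  lie_br_antisym : forall i j (x y : L), lie_homog i x -> lie_homog j y ->
    lie_br x y = - ((-1 : K) ^ (i * j) *: lie_br y x);
  lie_jacobi : forall i j (x y z : L), lie_homog i x -> lie_homog j y ->
    lie_br x (lie_br y z) =
      lie_br (lie_br x y) z + (-1 : K) ^ (i * j) *: lie_br y (lie_br x z);
  lie_leibniz : forall i (x y : L), lie_homog i x ->
    lie_diff (lie_br x y) =
      lie_br (lie_diff x) y + (-1 : K) ^ i *: lie_br x (lie_diff y) }.

Record dgLie := DgLie {
  dgLie_data :> dgLieData K;
  dgLieP : isDgLie dgLie_data }.

Fixpoint lower_central (L : dgLieData K) (k : nat) : set L :=
  if k is k'.+1 then
    lin_span [set z | exists x y : L, lower_central k' y /\ z = lie_br x y]
  else setT.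

Arguments lower_central : clear implicits.

Definition nilpotent_dgLie (L : dgLieData K) :=
  exists k, lower_central L k `<=` [set 0].

Definition nonneg_graded (L : dgLieData K) :=
  forall (i : int) (x : L), i < 0 -> lie_comp i x = 0.

Definition MC (L : dgLieData K) : set L :=
  [set a | lie_homog 1 a /\ lie_diff a + 2^-1 *: lie_br a a = 0].

Section TensorDgLie.
Variables (L : dgLieData K) (A : dgaData K).
Local Notation "x ⊗ a" := (@tens K L A x a) (at level 40).

Definition tens_comp (p : int) : tensor L A -> tensor L A :=
  tlift (fun x a => \sum_(i \in [set: nat])
    lie_comp (p - i%:Z) x ⊗ dga_comp i a).

Definition tens_diff : tensor L A -> tensor L A :=
  tlift (fun x a => lie_diff x ⊗ a +
    \sum_(i \in [set: int]) (-1 : K) ^ i *: (lie_comp i x ⊗ dga_diff a)).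

(* [x (x) a, y (x) b] = (-1)^(|a| |y|) [x, y] (x) ab, summed over the components of
   a and y *)
Definition tens_br (u v : tensor L A) : tensor L A :=
  tlift (fun x a => tlift (fun y b =>
    \sum_(i \in [set: nat]) \sum_(j \in [set: int])
      (-1 : K) ^ (i%:Z * j) *:
        (lie_br x (lie_comp j y) ⊗ dga_mul (dga_comp i a) b)) v) u.

Definition tensLie : dgLieData K := DgLieData tens_comp tens_diff tens_br.

End TensorDgLie.

Definition tens_map (L : dgLieData K) (A B : dgaData K) (f : A -> B) :
    tensLie L A -> tensLie L B :=
  tlift (fun (x : L) (a : A) => tens x (f a)).

End DgLie.

Record monotone_map (k n : nat) := MonotoneMap {
  mono_fun :> 'I_k.+1 -> 'I_n.+1;
  mono_funP : forall i j : 'I_k.+1, (i <= j)%N -> (mono_fun i <= mono_fun j)%N }.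

(* The functor laws play no role in what an isomorphism is, so they are left out. *)
Record simplicial := Simplicial {
  cell :> nat -> Type;
  face : forall k n, monotone_map k n -> cell n -> cell k }.

Definition simplicial_subset (X : simplicial) (A : forall n, set (X n)) :=
  forall k n (f : monotone_map k n) (x : X n), A n x -> A k (face f x).

Definition subsimplicial (X : simplicial) (A : forall n, set (X n))
    (stable : simplicial_subset A) : simplicial :=
  @Simplicial (fun n => {x : X n | A n x})
    (fun k n f x => exist (A k) (face f (sval x)) (stable k n f _ (proj2_sig x))).

Definition simplicial_iso (X Y : simplicial) :=
  exists phi : forall n, X n -> Y n,
    (forall n, bijective (phi n)) /\
    (forall k n (f : monotone_map k n) (x : X n),
       phi k (face f x) = face f (phi n x)).

(* A category whose identities and composition are given by their graphs;
   is_comp u v w means v o u = w. *)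
Record category := Category {
  ob : Type;
  hom : ob -> ob -> Type;
  is_id : forall a, hom a a -> Prop;
  is_comp : forall a b c, hom a b -> hom b c -> hom a c -> Prop }.

(* An n-simplex of the nerve is a functor from the poset {0 < ... < n} to C. *)
Record nerve_cell (C : category) (n : nat) := NerveCell {
  nerve_ob : 'I_n.+1 -> ob C;
  nerve_mor : forall i j : 'I_n.+1, (i <= j)%N -> hom (nerve_ob i) (nerve_ob j);
  nerve_id : forall (i : 'I_n.+1) (ii : (i <= i)%N), is_id (nerve_mor ii);
  nerve_comp : forall (i j k : 'I_n.+1)
    (ij : (i <= j)%N) (jk : (j <= k)%N) (ik : (i <= k)%N),
    is_comp (nerve_mor ij) (nerve_mor jk) (nerve_mor ik) }.

Definition nerve_face (C : category) k n (f : monotone_map k n)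
    (F : nerve_cell C n) : nerve_cell C k :=
  @NerveCell C k (fun i => nerve_ob F (f i))
    (fun i j ij => nerve_mor F (mono_funP f ij))
    (fun i ii => nerve_id F (mono_funP f ii))
    (fun i j l ij jl il =>
       nerve_comp F (mono_funP f ij) (mono_funP f jl) (mono_funP f il)).

Definition nerve (C : category) : simplicial :=
  @Simplicial (nerve_cell C) (@nerve_face C).

Section Deligne.
Variables (K : fieldType) (L : dgLieData K).

Fixpoint nested_br (w : seq L) : L :=
  match w with
  | [::] => 0
  | [:: x] => x
  | x :: w' => lie_br x (nested_br w')
  end.

(* The part of degree N in (X, Y) of the Campbell-Hausdorff series
   log (e^X e^Y), in Dynkin's form: the sum over k >= 1 and r_i + s_i > 0 of
     (-1)^(k-1) / k * [X^r_1 Y^s_1 ... X^r_k Y^s_k] / (N r_1! s_1! ... r_k! s_k!)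
   where N = r_1 + s_1 + ... + r_k + s_k and brackets are nested to the right. *)
Definition CH_part (X Y : L) (N : nat) : L :=
  \sum_(k < N) ((-1) ^+ k / k.+1%:R) *:
    \sum_(e : {ffun 'I_k.+1 -> 'I_N.+1 * 'I_N.+1} |
          [forall i, (0 < (e i).1 + (e i).2)%N] &&
          (\sum_i ((e i).1 + (e i).2) == N)%N)
      (N * \prod_i ((e i).1`! * (e i).2`!))%N%:R^-1 *:
        nested_br (flatten
          [seq nseq (e i).1 X ++ nseq (e i).2 Y | i <- enum 'I_k.+1]).

Definition CH (X Y : L) : L := \sum_(N \in [set: nat]) CH_part X Y N.

(* e^X . a, a finite sum because the Lie algebra is nilpotent *)
Definition exp_act (X a : L) : L :=
  a - \sum_(n \in [set: nat])
        (n.+1)`!%:R^-1 *: iter n (lie_br X) (lie_diff X + lie_br a X).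

(* e^X is represented by X, in degree 0 *)
Definition deligne_hom (a b : {a : L | MC a}) :=
  {X : L | lie_homog 0 X /\ exp_act X (sval a) = sval b}.

Definition Deligne : category :=
  @Category {a : L | MC a} deligne_hom
    (fun a X => sval X = 0)
    (fun a b c X Y Z => sval Z = CH (sval Y) (sval X)).

End Deligne.

(* The free graded commutative algebra K[t_0..t_(m-1), dt_0..dt_(m-1)]:
   x stands for the sum over C of x C * dt_C, where dt_C is the product of the
   dt_i, i in C, in increasing order. *)
Notation pforms K m := {ffun {set 'I_m} -> {mpoly K[m]}}.

Section PolynomialForms.
Variable K : fieldType.

Section Operations.
Variable m : nat.

(* dt_A dt_B = (-1)^(inversions A B) dt_(A u B) for disjoint A and B *)
Definition inversions (A B : {set 'I_m}) : nat :=
  #|[pred p : 'I_m * 'I_m | [&& p.1 \in A, p.2 \in B & (p.2 < p.1)%N]]|.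

Definition pf_mul (x y : pforms K m) : pforms K m :=
  [ffun C : {set 'I_m} => \sum_(A : {set 'I_m} | A \subset C)
    (-1) ^+ inversions A (C :\: A) * (x A * y (C :\: A))].

Definition pf_fun (p : {mpoly K[m]}) : pforms K m :=
  [ffun C : {set 'I_m} => if C == finset.set0 then p else 0].

Definition pf_one : pforms K m := pf_fun 1.

Definition pf_diff (x : pforms K m) : pforms K m :=
  [ffun C : {set 'I_m} => \sum_(i in C)
    (-1) ^+ #|[pred j in C | (j < i)%N]| * (x (C :\ i))^`M(i)].

Definition pf_comp (p : nat) (x : pforms K m) : pforms K m :=
  [ffun C : {set 'I_m} => if #|C| == p then x C else 0].

Definition pf_t (i : 'I_m) : pforms K m := pf_fun 'X_i.
Definition pf_dt (i : 'I_m) : pforms K m := pf_diff (pf_t i).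

End Operations.

(* The morphism of dg algebras with t_i |-> tau i. *)
Definition pf_subst m m' (tau : 'I_m -> {mpoly K[m']}) (x : pforms K m) :
    pforms K m' :=
  \sum_(C : {set 'I_m})
    pf_mul (pf_fun (x C \mPo [tuple tau i | i < m]))
      (\big[@pf_mul m'/pf_one m']_(i in C) pf_diff (pf_fun (tau i))).

Section Simplex.
Variable n : nat.
Local Notation forms := (pforms K n.+1).

Definition omega_gen : set forms :=
  [set g | g = \sum_i pf_t i - pf_one n.+1 \/ g = \sum_i pf_dt i].

(* Its linear span is the two-sided ideal generated by omega_gen; the latter is
   closed under the differential. *)
Definition omega_rel : set forms :=
  [set x | exists a g b, omega_gen g /\ x = pf_mul (pf_mul a g) b].

Definition Omega_mod := quotmod omega_rel.
HB.instance Definition _ := GRing.Lmodule.on Omega_mod.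

(* The operations descend to the quotient, so the choice of representatives made
   by qrepr does not matter; likewise in pullback and integral. *)
Definition Omega : dgaData K := @DgaData K Omega_mod
  (fun p a => qproj omega_rel (pf_comp p (qrepr a)))
  (fun a => qproj omega_rel (pf_diff (qrepr a)))
  (fun a b => qproj omega_rel (pf_mul (qrepr a) (qrepr b))).

End Simplex.

(* Pullback along the affine map sending the vertex e_j to e_(f j), for f not
   necessarily monotone. *)
Definition pullback k n (f : 'I_k.+1 -> 'I_n.+1) (a : Omega n) : Omega k :=
  qproj (@omega_rel k)
    (pf_subst (fun i => \sum_(j | f j == i) 'X_j) (qrepr a)).

(* t_0 |-> 1 - t_1 - ... - t_k, dt_0 |-> - dt_1 - ... - dt_k *)
Definition eliminate_t0 k : pforms K k.+1 -> pforms K k.+1 :=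
  pf_subst (fun i => if i == ord0 then 1 - \sum_(j | j != ord0) 'X_j else 'X_i).

(* The coefficient of dt_1 ... dt_k, integrated monomial by monomial. *)
Definition integral k (a : Omega k) : K :=
  let p := eliminate_t0 (qrepr a) (~: [set ord0])%SET in
  \sum_(e <- msupp p) p@_e *
    ((\prod_(i | i != ord0) (e i)`!)%N%:R /
     ((\sum_(i | i != ord0) e i + k)`!)%N%:R).

Definition elementary_form k n (f : 'I_k.+1 -> 'I_n.+1) : Omega n :=
  qproj (@omega_rel n) (k`!%:R *: \sum_(j < k.+1) (-1 : K) ^+ j *:
    pf_mul (pf_t (f j))
      (\big[@pf_mul n.+1/pf_one n.+1]_(p < k.+1 | p != j) pf_dt (f p))).

(* The projection P_n; f runs over the sequences i_0 < ... < i_k. *)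
Definition whitney n (a : Omega n) : Omega n :=
  \sum_(k < n.+1)
    \sum_(f : {ffun 'I_k.+1 -> 'I_n.+1} |
          [forall i : 'I_k.+1, forall j : 'I_k.+1, (i < j)%N ==> (f i < f j)%N])
      integral (pullback f a) *: elementary_form f.

Definition form_homog n (p : nat) : set (Omega n) :=
  [set a | dga_comp p a = a].

Record contraction (s : forall n, Omega n -> Omega n) : Prop := Contraction {
  contraction_lin : forall n, linear (s n);
  contraction_deg0 : forall n (a : Omega n), form_homog 0 a -> s n a = 0;
  contraction_degS : forall n p (a : Omega n),
    form_homog p.+1 a -> form_homog p (s n a);
  contraction_face : forall k n (f : monotone_map k n) (a : Omega n),
    pullback f (s n a) = s k (pullback f a);
  contraction_homotopy : forall n (a : Omega n),
    a - whitney a = dga_diff (s n a) + s n (dga_diff a) }.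

Definition gauge (s : forall n, Omega n -> Omega n) :=
  contraction s /\ forall n (a : Omega n), s n (s n a) = 0.

Definition forms_on_simplices (L : dgLieData K) : simplicial :=
  @Simplicial (fun n => tensLie L (Omega n))
    (fun k n f => tens_map (pullback f)).

Definition gamma (s : forall n, Omega n -> Omega n) (L : dgLieData K) (n : nat) :
    set (forms_on_simplices L n) :=
  [set a | @MC K (tensLie L (Omega n)) a /\ tens_map (s n) a = 0].

End PolynomialForms.

Arguments gamma {K} s L n.

(* Main.v *)
From HB Require Import structures.
From mathcomp Require Import all_boot all_order all_algebra.
From mathcomp Require Import ring zify.
From mathcomp Require Import freeg mpoly.
Require Import Defs.

Set Implicit Arguments.
Unset Strict Implicit.
Unset Printing Implicit Defensive.

Import GRing.Theory Num.Theory.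
Local Open Scope ring_scope.

(* Let a_i and - X_ij be the integrals of alpha in gamma_n over the vertices and edges.
   The homotopy formula turns s alpha = 0 and the Maurer-Cartan equation into
   alpha = P alpha - 1/2 s [alpha, alpha], which by nilpotency has exactly one solution
   for each value of P alpha, that is of the a_i and X_ij.  Conversely, by the Bianchi
   identity the curvature F of such a solution satisfies F = P F - s [alpha, F], so it
   vanishes as soon as its integrals over the faces do; for degree reasons only faces of
   dimension at most 2 matter.  On a vertex this says that a_i is Maurer-Cartan, on an
   edge, where e^(tX) . a solves the equation, that e^(X_ij) . a_i = a_j, and on a
   triangle that X_ik = CH (X_jk, X_ij).
     For the last point, the part u of bidegree (0, 1) of alpha is flat, and is
   determined by its edges 01 and 12.  Fill the horn with edges z x and z y over
   g (x) K[z, dz].  Its third edge Z acts on degree 1 as the composition of the other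
   two; the action being affine with constant term - dZ, the logarithm of e^(z y) e^(z x)
   expresses dZ by Dynkin words.  The dz part of this identity says that Z and
   CH (z y, z x) have the same derivative, hence are equal; put z = 1. *)

(** The obstacle is the composition law. [CH] is given as Dynkin's explicit series, while a flat
    triangle only yields e^Z . a = e^Y . (e^X . a), and this action need not be faithful: if the
    differential of g vanishes and X is central, then e^X acts trivially. Over K[z, dz] the
    differential of an element of degree 0 contains its z-derivative, so the constant term of the
    affine action determines Z as soon as Z vanishes at z = 0. The factor 1/N in Dynkin's form is
    then the integral of z^(N-1) dz from 0 to 1.

    The gauge enters through its axioms alone. They give s P = P s = 0, and s and P commute with
    restriction to faces, so every claim on an edge or a triangle is one about g ⊗ Ω_1 or g ⊗ Ω_2.
    Uniqueness there rests on one rigidity principle: u = 0 if s u = 0, if P u is a multiple of a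
    single elementary form whose differential has a nonzero integral, and if d u always lies one
    step deeper in the filtration than u. The edge integrals are - X_ij because the connection x dt
    transports a to e^(-x) . a. *)

Section LinearMaps.
Variables (K : pzRingType) (U V : lmodType K) (f : U -> V).
Hypothesis lf : linear f.

Lemma linD : {morph f : x y / x + y}.
Proof. by move=> x y; rewrite -[x in LHS]scale1r lf scale1r. Qed.

Lemma lin0 : f 0 = 0.
Proof. by have := linD 0 0; rewrite addr0 => /eqP; rewrite eq_sym addrC -subr_eq0 addrK => /eqP. Qed.

Lemma linZ c x : f (c *: x) = c *: f x.
Proof. by rewrite -[c *: x]addr0 lf lin0 addr0. Qed.

Lemma linN : {morph f : x / - x}.
Proof. by move=> x; rewrite -scaleN1r linZ scaleN1r. Qed.

Lemma linB : {morph f : x y / x - y}.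
Proof. by move=> x y; rewrite linD linN. Qed.

Lemma lin_sum I (r : seq I) (P : pred I) (F : I -> U) :
  f (\sum_(i <- r | P i) F i) = \sum_(i <- r | P i) f (F i).
Proof. exact: (big_morph f linD lin0). Qed.

End LinearMaps.

Lemma lin_comp (K : pzRingType) (U V W : lmodType K) (g : V -> W) (f : U -> V) :
  linear g -> linear f -> linear (fun x => g (f x)).
Proof. by move=> lg lf c x y; rewrite lf lg. Qed.

Lemma scaler_signn (K : pzRingType) (V : lmodType K) n (v : V) :
  (-1) ^+ n *: v = if odd n then - v else v.
Proof. by rewrite -signr_odd scaler_sign. Qed.

Lemma mulr_signn (R : pzRingType) n (v : R) :
  (-1) ^+ n * v = if odd n then - v else v.
Proof. by rewrite -signr_odd mulr_sign. Qed.

(** * Polynomial forms *)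

Section Inversions.
Variable m : nat.
Implicit Types A B C : {set 'I_m}.

Lemma inversionsE A B :
  inversions A B = (\sum_(i in A) \sum_(j in B) (j < i)%N)%N.
Proof.
rewrite /inversions -sum1_card pair_big /= [in RHS]big_mkcond [in LHS]big_mkcond.
by apply: eq_bigr => -[i j] _; rewrite !inE /=; do !case: (_ \in _); case: (_ < _)%N.
Qed.

Lemma sum_setU A B (F : 'I_m -> nat) : [disjoint A & B] ->
  (\sum_(i in A :|: B) F i = \sum_(i in A) F i + \sum_(i in B) F i)%N.
Proof.
move=> dAB; rewrite -bigU //; apply: eq_bigl => i; by rewrite !inE.
Qed.

Lemma inversionsUl A B C : [disjoint A & B] ->
  inversions (A :|: B) C = (inversions A C + inversions B C)%N.
Proof. by move=> dAB; rewrite !inversionsE sum_setU. Qed.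

Lemma inversionsUr A B C : [disjoint B & C] ->
  inversions A (B :|: C) = (inversions A B + inversions A C)%N.
Proof.
move=> dAB; rewrite !inversionsE -big_split; apply: eq_bigr => i _ /=.
by rewrite sum_setU.
Qed.

(** A pair (i, j) in A × B has i <> j by disjointness, so it is an inversion in exactly one of the
    two orders. This is the sign of graded commutativity. *)
Lemma inversions_addC A B : [disjoint A & B] ->
  (inversions A B + inversions B A = #|A| * #|B|)%N.
Proof.
move=> dAB; rewrite !inversionsE [X in (_ + X)%N]exchange_big -big_split /=.
rewrite -sum_nat_const; apply: eq_bigr => i iA.
rewrite -big_split /= -sum1_card; apply: eq_bigr => j jB.
have : i != j by apply: contraTneq jB => <-; rewrite (disjointFr dAB).
by rewrite -val_eqE /= neq_ltn; case: ltngtP.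
Qed.

Lemma inversions0l A : inversions set0 A = 0%N.
Proof. by rewrite inversionsE big_set0. Qed.

Lemma inversions0r A : inversions A set0 = 0%N.
Proof. by rewrite inversionsE big1 // => i _; rewrite big_set0. Qed.

Lemma inversions1l i A : inversions [set i] A = #|[pred j in A | (j < i)%N]|.
Proof.
rewrite inversionsE big_set1 -sum1_card [RHS]big_mkcond [LHS]big_mkcond /=.
by apply: eq_bigr => j _; rewrite inE; case: (_ \in _); case: (_ < _)%N.
Qed.

End Inversions.

Section PolynomialFormsAlgebra.
Variables (K : fieldType) (m : nat).
Local Notation forms := {ffun {set 'I_m} -> {mpoly K[m]}}.
Implicit Types (x y z : forms) (A B C : {set 'I_m}) (p q : {mpoly K[m]}).

(** The form p dt_A. *)
Definition pf_mon A p : forms := [ffun C => if C == A then p else 0].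

Lemma pf_mon_sum x : x = \sum_A pf_mon A (x A).
Proof.
apply/ffunP => C; rewrite sum_ffunE (bigD1 C) //= big1 ?addr0 ?ffunE ?eqxx //.
by move=> D DC; rewrite ffunE eq_sym (negPf DC).
Qed.

Lemma pf_mon_ind (P : forms -> Prop) :
  (forall A p, P (pf_mon A p)) -> (forall x y, P x -> P y -> P (x + y)) ->
  forall x, P x.
Proof.
move=> Pm PD x; rewrite [x]pf_mon_sum; apply: (big_ind P) => //.
suff -> : 0 = pf_mon set0 0 by [].
by apply/ffunP=> C; rewrite !ffunE if_same.
Qed.

Lemma pf_mon_lin A : linear (pf_mon A).
Proof.
move=> c p q; apply/ffunP=> C; rewrite !ffunE.
by case: eqP => // _; rewrite scaler0 addr0.
Qed.

Lemma pf_mul_linl y : linear ((@pf_mul K m)^~ y).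
Proof.
move=> c x z; apply/ffunP=> C; rewrite !ffunE scaler_sumr -big_split.
apply: eq_bigr => A _ /=; rewrite !ffunE mulrDl mulrDr; congr (_ + _).
by rewrite -scalerAl -scalerAr.
Qed.

Lemma pf_mul_linr x : linear (@pf_mul K m x).
Proof.
move=> c y z; apply/ffunP=> C; rewrite !ffunE scaler_sumr -big_split.
apply: eq_bigr => A _ /=; rewrite !ffunE mulrDr mulrDr; congr (_ + _).
by rewrite -!scalerAr.
Qed.

(** The laws of the algebra are multilinear, so they are checked on the forms p dt_A, where this
    formula leaves only a count of inversions. *)
Lemma pf_mul_mon A B p q : pf_mul (pf_mon A p) (pf_mon B q) =
  if [disjoint A & B] then
    pf_mon (A :|: B) ((-1) ^+ inversions A B * (p * q)) else 0.
Proof.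
apply/ffunP=> C; rewrite ffunE.
have -> : \sum_(D : {set 'I_m} | D \subset C) (-1) ^+ inversions D (C :\: D) *
   (pf_mon A p D * pf_mon B q (C :\: D)) =
   if (A \subset C) && (C :\: A == B) then (-1) ^+ inversions A B * (p * q) else 0.
  case: ifP => [/andP[AC /eqP CB]|h].
    rewrite (bigD1 A) //= big1 ?addr0 ?ffunE ?CB ?eqxx // => D /andP[_ DA].
    by rewrite !ffunE (negPf DA) mul0r mulr0.
  apply: big1 => D DC; rewrite !ffunE; case: eqP => [DA|_]; last by rewrite mul0r mulr0.
  case: eqP => [CB|_]; last by rewrite !mulr0.
  by move: h; rewrite -DA DC CB eqxx.
have -> : (A \subset C) && (C :\: A == B) = [disjoint A & B] && (C == A :|: B).
  apply/andP/andP => [[AC /eqP <-]|[dAB /eqP ->]].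
    split; first by rewrite -setI_eq0 setIDA setDIl setDv set0I.
    apply/eqP/setP => i; rewrite !inE; case iA: (i \in A) => //=.
    by rewrite (subsetP AC).
  rewrite subsetUl setDUl setDv set0U; split => //.
  by apply/eqP/setDidPl; rewrite disjoint_sym.
by case: [disjoint A & B]; rewrite ?ffunE.
Qed.

Lemma pf_mulA x y z : pf_mul x (pf_mul y z) = pf_mul (pf_mul x y) z.
Proof.
elim/pf_mon_ind: x => [A p|x x' IH IH']; last first.
  by rewrite !(linD (pf_mul_linl _)) IH IH'.
elim/pf_mon_ind: y => [B q|y y' IH IH']; last first.
  by rewrite !(linD (pf_mul_linl _)) !(linD (pf_mul_linr _)) !(linD (pf_mul_linl _)) IH IH'.
elim/pf_mon_ind: z => [C r|z z' IH IH']; last first.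
  by rewrite !(linD (pf_mul_linr _)) IH IH'.
rewrite !pf_mul_mon.
have dU (D E F : {set 'I_m}) : [disjoint D :|: E & F] = [disjoint D & F] && [disjoint E & F].
  by rewrite -!setI_eq0 setIUl setU_eq0.
case: (boolP [disjoint B & C]) => BC; case: (boolP [disjoint A & B]) => AB;
  rewrite ?(lin0 (pf_mul_linl _)) ?(lin0 (pf_mul_linr _)) ?pf_mul_mon //.
- rewrite dU BC andbT [[disjoint A & B :|: C]]disjoint_sym dU.
  rewrite ![[disjoint _ & A]]disjoint_sym AB /=; case: ifP => // AC.
  rewrite setUA; congr pf_mon; rewrite inversionsUl // inversionsUr //.
  rewrite !exprD; ring.
- by rewrite disjoint_sym dU disjoint_sym (negPf AB).
- by rewrite dU (negPf BC) andbF.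
Qed.

Lemma pf_funE p : pf_fun p = pf_mon set0 p.
Proof. by []. Qed.

Lemma pf_mul1 x : pf_mul (pf_one K m) x = x.
Proof.
elim/pf_mon_ind: x => [A p|x y IH IH']; last by rewrite (linD (pf_mul_linr _)) IH IH'.
rewrite /pf_one pf_funE pf_mul_mon -setI_eq0 set0I eqxx set0U inversions0l.
by rewrite expr0 !mul1r.
Qed.

Lemma pf_mulr1 x : pf_mul x (pf_one K m) = x.
Proof.
elim/pf_mon_ind: x => [A p|x y IH IH']; last by rewrite (linD (pf_mul_linl _)) IH IH'.
rewrite /pf_one pf_funE pf_mul_mon -setI_eq0 setI0 eqxx setU0 inversions0r.
by rewrite expr0 !mul1r mulr1.
Qed.

Lemma pf_comp_lin i : linear (@pf_comp K m i).
Proof.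
move=> c x y; apply/ffunP=> C; rewrite !ffunE; case: ifP => //.
by rewrite scaler0 addr0.
Qed.

Lemma pf_compE i x C : pf_comp i x C = if #|C| == i then x C else 0.
Proof. by rewrite ffunE. Qed.

Lemma pf_mul_set0 x y : pf_mul x y set0 = x set0 * y set0.
Proof.
rewrite ffunE (big_pred1 set0) => [|A]; last by rewrite subset0.
by rewrite inversions0l expr0 mul1r setD0.
Qed.

Lemma pf_comp_mon i A p :
  pf_comp i (pf_mon A p) = if #|A| == i then pf_mon A p else 0.
Proof.
apply/ffunP=> C; rewrite !ffunE; case: (altP (C =P A)) => [->|CA]; last first.
  by rewrite if_same; case: ifP; rewrite ffunE ?(negPf CA).
by case: ifP; rewrite ffunE ?eqxx.
Qed.

Lemma pf_comp_comp i j x :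
  pf_comp i (pf_comp j x) = if i == j then pf_comp j x else 0.
Proof.
apply/ffunP=> C; rewrite !ffunE; case: (altP (i =P j)) => [->|ij].
  by rewrite ffunE; case: (#|C| == j).
by rewrite ffunE; case: (altP (#|C| =P i)) => // ->; rewrite (negPf ij).
Qed.

Lemma pf_comp_sum x : \sum_(i < m.+1) pf_comp i x = x.
Proof.
apply/ffunP=> C; rewrite sum_ffunE.
have cC : (#|C| < m.+1)%N by rewrite ltnS -[m in (_ <= m)%N]card_ord max_card.
rewrite (bigD1 (Ordinal cC)) //= big1 ?addr0 ?ffunE ?eqxx // => i.
by rewrite -val_eqE /= ffunE eq_sym => /negPf ->.
Qed.

Lemma pf_comp_bound i x : (m < i)%N -> pf_comp i x = 0.
Proof.
move=> mi; apply/ffunP=> C; rewrite !ffunE; case: eqP => // Ci; move: mi.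
by rewrite -Ci ltnNge -[m in (_ <= m)%N]card_ord max_card.
Qed.

Lemma pf_comp_mul i j x y :
  pf_comp (i + j) (pf_mul (pf_comp i x) (pf_comp j y)) =
  pf_mul (pf_comp i x) (pf_comp j y).
Proof.
elim/pf_mon_ind: x => [A p|x x' IH IH']; last first.
  by rewrite !(linD (pf_comp_lin _), linD (pf_mul_linl _)) IH IH'.
elim/pf_mon_ind: y => [B q|y y' IH IH']; last first.
  by rewrite !(linD (pf_comp_lin _), linD (pf_mul_linr _)) IH IH'.
rewrite !pf_comp_mon; case: eqP => [<-|_]; last first.
  by rewrite (lin0 (pf_mul_linl _)) (lin0 (pf_comp_lin _)).
case: eqP => [<-|_]; last by rewrite (lin0 (pf_mul_linr _)) (lin0 (pf_comp_lin _)).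
rewrite pf_mul_mon; case: ifP => [dAB|_]; last by rewrite (lin0 (pf_comp_lin _)).
by rewrite pf_comp_mon cardsU (eqP (_ : A :&: B == set0)) ?setI_eq0 // cards0 subn0 eqxx.
Qed.

Lemma pf_mulC i j x y : pf_mul (pf_comp i x) (pf_comp j y) =
  (-1) ^+ (i * j) *: pf_mul (pf_comp j y) (pf_comp i x).
Proof.
elim/pf_mon_ind: x => [A p|x x' IH IH']; last first.
  by rewrite !(linD (pf_comp_lin _), linD (pf_mul_linl _), linD (pf_mul_linr _)) scalerDr IH IH'.
elim/pf_mon_ind: y => [B q|y y' IH IH']; last first.
  by rewrite !(linD (pf_comp_lin _), linD (pf_mul_linl _), linD (pf_mul_linr _)) scalerDr IH IH'.
rewrite !pf_comp_mon; case: eqP => [<-|_]; last first.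
  by rewrite (lin0 (pf_mul_linl _)) (lin0 (pf_mul_linr _)) scaler0.
case: eqP => [<-|_]; last by rewrite (lin0 (pf_mul_linl _)) (lin0 (pf_mul_linr _)) scaler0.
rewrite !pf_mul_mon [in RHS]disjoint_sym; case: ifP => [dAB|_]; last by rewrite scaler0.
rewrite setUC -(linZ (pf_mon_lin _)); congr pf_mon.
rewrite -(inversions_addC dAB) [q * p]mulrC scaler_signn !mulr_signn oddD.
by do 2!case: (odd _) => //=; rewrite opprK.
Qed.

Definition pf_pd (i : 'I_m) x : forms := [ffun C => (x C)^`M(i)].
Local Notation e i := (pf_mon [set i] 1).

Lemma pf_pd_lin i : linear (pf_pd i).
Proof. by move=> c x y; apply/ffunP=> C; rewrite !ffunE mderivD mderivZ. Qed.

Lemma pf_pd_mon i A p : pf_pd i (pf_mon A p) = pf_mon A p^`M(i).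
Proof. by apply/ffunP=> C; rewrite !ffunE; case: ifP; rewrite ?mderiv0. Qed.

Lemma pf_pdC i j x : pf_pd i (pf_pd j x) = pf_pd j (pf_pd i x).
Proof. by apply/ffunP=> C; rewrite !ffunE mderiv_comm. Qed.

Lemma pf_pdM i x y :
  pf_pd i (pf_mul x y) = pf_mul (pf_pd i x) y + pf_mul x (pf_pd i y).
Proof.
apply/ffunP=> C; rewrite !ffunE (lin_sum (mderiv_is_linear i)) -big_split.
apply: eq_bigr => A _ /=; rewrite !ffunE -mulrDr -mderivM.
by rewrite !mulr_signn; case: ifP => // _; rewrite mderivN.
Qed.

Lemma pf_mul_dt i x C : pf_mul (e i) x C =
  if i \in C then (-1) ^+ #|[pred j in C | (j < i)%N]| * x (C :\ i) else 0.
Proof.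
rewrite ffunE; case: ifP => iC.
  rewrite (bigD1 [set i]) /= ?sub1set // big1 ?addr0.
    rewrite ffunE eqxx mul1r inversions1l; congr (_ ^+ _ * _).
    apply: eq_card => j; rewrite !inE; case: eqP => [->|] //=.
    by rewrite ltnn andbF.
  by move=> D /andP[_ Di]; rewrite ffunE (negPf Di) mul0r mulr0.
apply: big1 => D DC; rewrite ffunE; case: eqP => [Di|_]; last by rewrite mul0r mulr0.
by move: DC; rewrite Di sub1set iC.
Qed.

(** Written as the sum of the dt_i ∂_i, the differential has its Leibniz rule and its square
    governed by the commuting derivations ∂_i and the anticommuting dt_i. *)
Lemma pf_diffE x : pf_diff x = \sum_i pf_mul (e i) (pf_pd i x).
Proof.
apply/ffunP=> C; rewrite sum_ffunE !ffunE big_mkcond; apply: eq_bigr => i _.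
by rewrite pf_mul_dt !ffunE.
Qed.

Lemma pf_diff_lin : linear (@pf_diff K m).
Proof.
move=> c x y; rewrite !pf_diffE scaler_sumr -big_split; apply: eq_bigr => i _.
by rewrite pf_pd_lin pf_mul_linr.
Qed.

Lemma pf_comp_dt i : pf_comp 1 (e i) = e i.
Proof. by rewrite pf_comp_mon cards1. Qed.

Lemma pf_mul_dtC i j x : pf_mul (e i) (pf_comp j x) = (-1) ^+ j *: pf_mul (pf_comp j x) (e i).
Proof. by rewrite -[e i]pf_comp_dt pf_mulC mul1n. Qed.

Lemma pf_diffM j x y : pf_diff (pf_mul (pf_comp j x) y) =
  pf_mul (pf_diff (pf_comp j x)) y + (-1) ^+ j *: pf_mul (pf_comp j x) (pf_diff y).
Proof.
rewrite !pf_diffE (lin_sum (pf_mul_linl _)) (lin_sum (pf_mul_linr _)).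
rewrite scaler_sumr -big_split; apply: eq_bigr => i _ /=.
rewrite pf_pdM (linD (pf_mul_linr _)) !pf_mulA; congr (_ + _).
by rewrite pf_mul_dtC (linZ (pf_mul_linl _)).
Qed.

Lemma pf_diff_comp i x : pf_comp i.+1 (pf_diff x) = pf_diff (pf_comp i x).
Proof.
apply/ffunP=> C; rewrite !ffunE; case: ifP => h.
  apply: eq_bigr => j jC; congr (_ * _); rewrite ffunE.
  by move: h; rewrite (cardsD1 j) jC add1n eqSS => ->.
rewrite big1 // => j jC; rewrite ffunE; move: h.
by rewrite (cardsD1 j) jC add1n eqSS => ->; rewrite mderiv0 mulr0.
Qed.

Lemma pf_diff_comp0 x : pf_comp 0 (pf_diff x) = 0.
Proof.
apply/ffunP=> C; rewrite !ffunE; case: eqP => // /eqP.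
by rewrite cards_eq0 => /eqP ->; rewrite big_set0.
Qed.

(** Exchanging the two summation indices changes the sign, since the ∂_i commute and the dt_i
    anticommute; so the double sum equals its own opposite, and 2 is invertible. *)
Lemma pf_diff2 x : 2 != 0 :> K -> pf_diff (pf_diff x) = 0.
Proof.
move=> two_neq0; set S := pf_diff _.
have E : S = \sum_i \sum_j pf_mul (pf_mul (e i) (e j)) (pf_pd i (pf_pd j x)).
  rewrite /S [pf_diff x]pf_diffE pf_diffE; apply: eq_bigr => i _.
  rewrite (lin_sum (pf_pd_lin _)) (lin_sum (pf_mul_linr _)).
  apply: eq_bigr => j _; rewrite pf_pdM pf_pd_mon -[1]mpolyC1 mderivC.
  by rewrite (lin0 (pf_mon_lin _)) (lin0 (pf_mul_linl _)) add0r pf_mulA.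
have SN : S = - S.
  rewrite [in RHS]E exchange_big [LHS]E -sumrN; apply: eq_bigr => i _.
  rewrite -sumrN; apply: eq_bigr => j _.
  rewrite [pf_pd j (pf_pd i x)]pf_pdC -[in RHS](pf_comp_dt i) pf_mul_dtC pf_comp_dt.
  by rewrite (linZ (pf_mul_linl _)) expr1 scaleN1r opprK.
have /eqP : 2 *: S = 0 by rewrite scaler_nat mulr2n {1}SN addNr.
by rewrite scaler_eq0 (negPf two_neq0) => /eqP.
Qed.

Lemma pf_mul_fun_mon p A q : pf_mul (pf_fun p) (pf_mon A q) = pf_mon A (p * q).
Proof.
rewrite pf_funE pf_mul_mon -setI_eq0 set0I eqxx set0U inversions0l.
by rewrite expr0 mul1r.
Qed.

(** Functions and the dt_i generate all forms by left multiplication. This induction suits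
    statements about morphisms of dg algebras, which are then checked on generators. *)
Lemma pf_gen_ind (P : forms -> Prop) :
  (forall x y, P x -> P y -> P (x + y)) -> P (pf_one K m) ->
  (forall p x, P x -> P (pf_mul (pf_fun p) x)) ->
  (forall i x, P x -> P (pf_mul (e i) x)) -> forall x, P x.
Proof.
move=> PD P1 Pf Pe; apply: pf_mon_ind => // A p.
rewrite -[p]mulr1 -pf_mul_fun_mon; apply: (Pf).
have [k] := ubnP #|A|; elim: k A => // k IH A ltA.
case: (set_0Vmem A) => [->|[i iA]]; first exact: P1.
have dA : [disjoint [set i] & A :\ i].
  by rewrite disjoints_subset sub1set !inE eqxx.
(* Pulling dt_i out of dt_A costs a sign; written as a constant function, it is absorbed by the
   hypothesis on multiplication by functions. *)
have -> : pf_mon A 1 = pf_mul (pf_fun ((-1) ^+ inversions [set i] (A :\ i)))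
    (pf_mul (e i) (pf_mon (A :\ i) 1)).
  rewrite pf_mul_mon dA pf_mul_fun_mon setD1K // mulr1 mulrA mulr1.
  by rewrite -exprD addnn -mul2n exprM sqrrN !expr1n.
apply: (Pf); apply: (Pe); apply: IH.
by move: ltA; rewrite (cardsD1 i) iA.
Qed.

Lemma pf_dtE i : pf_dt K i = e i.
Proof.
rewrite /pf_dt pf_diffE (bigD1 i) //= big1.
  rewrite addr0 /pf_t pf_funE pf_pd_mon mderivX mnmE eqxx scale1r.
  have -> : (U_(i) - U_(i) = 0)%MM by apply/mnmP=> j; rewrite !mnmE subnn.
  by rewrite mpolyX0 -pf_funE -/(pf_one K m) pf_mulr1.
move=> j ji; rewrite /pf_t pf_funE pf_pd_mon mderivX mnmE eq_sym (negPf ji) scale0r.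
by rewrite (lin0 (pf_mon_lin _)) (lin0 (pf_mul_linr _)).
Qed.

Lemma pf_compM1 a y i : pf_comp 1 a = a ->
  pf_comp i.+1 (pf_mul a y) = pf_mul a (pf_comp i y).
Proof.
move=> <-; rewrite -[y in LHS]pf_comp_sum (lin_sum (pf_mul_linr _)).
rewrite (lin_sum (pf_comp_lin _)) (eq_bigr (fun j : 'I_m.+1 =>
  if j == i :> nat then pf_mul (pf_comp 1 a) (pf_comp i y) else 0)); last first.
  move=> j _; rewrite -pf_comp_mul pf_comp_comp add1n eqSS eq_sym.
  by case: eqP => // ->; rewrite -[i.+1]add1n pf_comp_mul.
rewrite -big_mkcond; case: (ltnP i m.+1) => im.
  by rewrite (big_pred1 (Ordinal im)) // => j; rewrite -val_eqE.
rewrite (pf_comp_bound y im) (lin0 (pf_mul_linr _)) big_pred0 // => j.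
by rewrite ltn_eqF // (leq_trans (ltn_ord j)).
Qed.

Lemma pf_comp0M1 a y : pf_comp 1 a = a -> pf_comp 0 (pf_mul a y) = 0.
Proof.
move=> <-; rewrite -[y in LHS]pf_comp_sum (lin_sum (pf_mul_linr _)).
rewrite (lin_sum (pf_comp_lin _)) big1 // => j _.
by rewrite -pf_comp_mul pf_comp_comp.
Qed.

Lemma pf_comp_fun p : pf_comp 0 (pf_fun p) = pf_fun p.
Proof. by rewrite pf_funE pf_comp_mon cards0. Qed.

Lemma pf_compM0 p y i : pf_comp i (pf_mul (pf_fun p) y) = pf_mul (pf_fun p) (pf_comp i y).
Proof.
elim/pf_mon_ind: y => [A q|x x' IH IH']; last first.
  by rewrite !(linD (pf_comp_lin _), linD (pf_mul_linr _)) IH IH'.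
rewrite pf_mul_fun_mon !pf_comp_mon; case: ifP => _; first by rewrite pf_mul_fun_mon.
by rewrite (lin0 (pf_mul_linr _)).
Qed.

Lemma pf_diffM0 p y : pf_diff (pf_mul (pf_fun p) y) =
  pf_mul (pf_diff (pf_fun p)) y + pf_mul (pf_fun p) (pf_diff y).
Proof. by rewrite -[pf_fun p]pf_comp_fun pf_diffM expr0 scale1r. Qed.

Lemma pf_diffM1 a y : pf_comp 1 a = a -> pf_diff (pf_mul a y) =
  pf_mul (pf_diff a) y - pf_mul a (pf_diff y).
Proof. by move=> <-; rewrite pf_diffM expr1 scaleN1r. Qed.

Lemma pf_comp_diff_fun p : pf_comp 1 (pf_diff (pf_fun p)) = pf_diff (pf_fun p).
Proof. by rewrite pf_diff_comp pf_comp_fun. Qed.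

Lemma pf_mul_fun p q : pf_mul (pf_fun p) (pf_fun q) = pf_fun (p * q).
Proof. by rewrite [pf_fun q]pf_funE pf_mul_fun_mon. Qed.

Lemma pf_mul_funC p y : pf_mul (pf_fun p) y = pf_mul y (pf_fun p).
Proof.
rewrite -[y in LHS]pf_comp_sum (lin_sum (pf_mul_linr _)).
rewrite -[y in RHS]pf_comp_sum (lin_sum (pf_mul_linl _)).
by apply: eq_bigr => i _; rewrite -pf_comp_fun pf_mulC mul0n expr0 scale1r.
Qed.

Lemma pf_diff_one : pf_diff (pf_one K m) = 0.
Proof.
rewrite pf_diffE big1 // => i _; rewrite /pf_one pf_funE pf_pd_mon -[1]mpolyC1 mderivC.
by rewrite (lin0 (pf_mon_lin _)) (lin0 (pf_mul_linr _)).
Qed.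

Lemma pf_diff_dt i : pf_diff (e i) = 0.
Proof.
rewrite pf_diffE big1 // => j _; rewrite pf_pd_mon -[1]mpolyC1 mderivC.
by rewrite (lin0 (pf_mon_lin _)) (lin0 (pf_mul_linr _)).
Qed.

End PolynomialFormsAlgebra.

Lemma mpoly_gen_ind (R : comNzRingType) n (Q : {mpoly R[n]} -> Prop) :
  (forall c, Q c%:MP) -> (forall i, Q 'X_i) ->
  (forall p q, Q p -> Q q -> Q (p + q)) -> (forall p q, Q p -> Q q -> Q (p * q)) ->
  forall p, Q p.
Proof.
move=> Qc QX QD QM; elim/mpolyind => [|c m p _ _ IH]; first by rewrite -mpolyC0.
apply: (QD) => //; rewrite -mul_mpolyC; apply: (QM) => //.
rewrite mpolyXE_id; apply: (big_ind Q) => // [|i _]; first by rewrite -mpolyC1.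
by elim: (m i) => [|k IHk]; rewrite ?expr0 -?mpolyC1 ?exprS //; apply: QM.
Qed.

Section Substitution.
Variables (K : fieldType) (m m' : nat) (tau : 'I_m -> {mpoly K[m']}).
Implicit Types (A B C : {set 'I_m}).
Local Notation fst := {ffun {set 'I_m} -> {mpoly K[m]}}.
Implicit Types x y : fst.
Local Notation cmp p := (p \mPo [tuple tau i | i < m]).
Local Notation dtau i := (pf_diff (pf_fun (tau i))).
Local Notation W C := (\big[@pf_mul K m'/pf_one K m']_(i in C) dtau i).
Local Notation subst := (pf_subst tau).

Lemma mPo_X i : cmp 'X_i = tau i.
Proof. by rewrite comp_mpolyXU -tnth_nth tnth_mktuple. Qed.

Lemma pf_mul_dtau i j : pf_mul (dtau i) (dtau j) = - pf_mul (dtau j) (dtau i).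
Proof.
by rewrite -[dtau i]pf_comp_diff_fun -[dtau j]pf_comp_diff_fun pf_mulC expr1 scaleN1r.
Qed.

Lemma pf_mul_odd2 n (a : {ffun {set 'I_n} -> {mpoly K[n]}}) : 2 != 0 :> K ->
  pf_comp 1 a = a -> pf_mul a a = 0.
Proof.
move=> two_neq0 a1.
have SN : pf_mul a a = - pf_mul a a by rewrite -a1 {1}pf_mulC expr1 scaleN1r.
have /eqP : 2 *: pf_mul a a = 0 by rewrite scaler_nat mulr2n {1}SN addNr.
by rewrite scaler_eq0 (negPf two_neq0) => /eqP.
Qed.

(** A product over a set runs through the sorted enumeration, so the induction is on a sorted list.
    The factor [dtau i] moves past those of smaller index in C, one sign for each, and meets its own
    square, which is 0, when i is in C. *)
Lemma pf_mul_dtau_seq (r : seq 'I_m) (i : 'I_m) C : 2 != 0 :> K ->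
  sorted (fun a b : 'I_m => (a < b)%N) r -> i \in r ->
  pf_mul (dtau i) (\big[@pf_mul K m'/pf_one K m']_(j <- r | j \in C) dtau j) =
  if i \in C then 0 else
  (-1) ^+ count (fun j : 'I_m => (j \in C) && (j < i)%N) r *:
     (\big[@pf_mul K m'/pf_one K m']_(j <- r | j \in i |: C) dtau j).
Proof.
move=> two_neq0; elim: r => // a r IH sr; rewrite inE.
have ltr : all (fun b : 'I_m => (a < b)%N) r.
  by apply: (order_path_min _ sr) => x y z; apply: ltn_trans.
have [-> _|ia ir] := eqVneq i a.
  rewrite !big_cons in_setU1 eqxx /=; case: ifP => aC.
    rewrite pf_mulA pf_mul_odd2 ?(lin0 (pf_mul_linl _)) //.
    exact: pf_comp_diff_fun.
  rewrite ltnn /= (eq_in_count (a2 := pred0)) ?count_pred0 ?expr0 ?scale1r.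
    congr pf_mul; rewrite big_seq_cond [in RHS]big_seq_cond; apply: eq_bigl => j.
    case jr: (j \in r) => //=; rewrite in_setU1.
    by case: eqP => // ja; move/allP: ltr => /(_ _ jr); rewrite ja ltnn.
  by move=> j jr; rewrite ltnNge ltnW ?andbF //; move/allP: ltr => ->.
have {}IH := IH (path_sorted sr) ir.
have ai : (a < i)%N by move/allP: ltr => ->.
rewrite !big_cons in_setU1 eq_sym (negPf ia) /=; case: ifP => aC; last by rewrite IH.
rewrite ai /= pf_mulA pf_mul_dtau (linN (pf_mul_linl _)) -pf_mulA IH.
case: ifP => _; first by rewrite (lin0 (pf_mul_linr _)) oppr0.
by rewrite (linZ (pf_mul_linr _)) exprS mulN1r scaleNr.
Qed.

Lemma pf_mul_dtauW i C : 2 != 0 :> K -> pf_mul (dtau i) (W C) =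
  if i \in C then 0 else (-1) ^+ inversions [set i] C *: W (i |: C).
Proof.
move=> two_neq0; rewrite pf_mul_dtau_seq ?mem_index_enum //; last first.
  by have := iota_ltn_sorted 0 m; rewrite -val_enum_ord sorted_map enumT.
rewrite inversions1l -sum1_card -sum1_count /=; by case: ifP.
Qed.

Lemma pf_subst_lin : linear subst.
Proof.
move=> c x y; rewrite /pf_subst scaler_sumr -big_split; apply: eq_bigr => C _ /=.
rewrite !ffunE comp_mpolyD comp_mpolyZ !pf_funE pf_mon_lin.
by rewrite (linD (pf_mul_linl _)) (linZ (pf_mul_linl _)).
Qed.

Lemma pf_subst_mon A p : subst (pf_mon A p) = pf_mul (pf_fun (cmp p)) (W A).
Proof.
rewrite /pf_subst (bigD1 A) //= ffunE eqxx big1 ?addr0 // => B BA.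
rewrite ffunE (negPf BA) comp_mpoly0 pf_funE (lin0 (pf_mon_lin _)).
by rewrite (lin0 (pf_mul_linl _)).
Qed.

Lemma pf_subst_fun p x : subst (pf_mul (pf_fun p) x) = pf_mul (pf_fun (cmp p)) (subst x).
Proof.
elim/pf_mon_ind: x => [A q|x y IH IH']; last first.
  by rewrite !(linD pf_subst_lin, linD (pf_mul_linr _)) IH IH'.
by rewrite pf_mul_fun_mon !pf_subst_mon pf_mulA pf_mul_fun rmorphM.
Qed.

Lemma pf_subst_dt i x : 2 != 0 :> K ->
  subst (pf_mul (pf_mon [set i] 1) x) = pf_mul (dtau i) (subst x).
Proof.
move=> two_neq0; elim/pf_mon_ind: x => [A q|x y IH IH']; last first.
  by rewrite !(linD pf_subst_lin, linD (pf_mul_linr _)) IH IH'.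
rewrite pf_mul_mon pf_subst_mon pf_mulA -pf_mul_funC -pf_mulA pf_mul_dtauW //.
rewrite disjoints_subset sub1set inE; case: ifP => [iA|/negbFE ->]; last first.
  by rewrite (lin0 (pf_mul_linr _)) (lin0 pf_subst_lin).
rewrite (negPf iA).
rewrite pf_subst_mon mul1r (linZ (pf_mul_linr _)) -(linZ (pf_mul_linl _)) pf_funE.
rewrite -(linZ (pf_mon_lin _)) scaler_signn mulr_signn; case: odd => //.
by rewrite raddfN.
Qed.

Lemma pf_subst_one : subst (pf_one K m) = pf_one K m'.
Proof.
by rewrite /pf_one [in LHS]pf_funE pf_subst_mon comp_mpoly1 big_set0 pf_mulr1.
Qed.

Lemma pf_substM x y : 2 != 0 :> K ->
  subst (pf_mul x y) = pf_mul (subst x) (subst y).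
Proof.
move=> two_neq0; elim/pf_gen_ind: x => [x x' IH IH'||p x IH|i x IH].
- by rewrite !(linD pf_subst_lin, linD (pf_mul_linl _)) IH IH'.
- by rewrite pf_subst_one !pf_mul1.
- by rewrite -pf_mulA !pf_subst_fun IH pf_mulA.
- by rewrite -pf_mulA !(pf_subst_dt _ _ two_neq0) IH pf_mulA.
Qed.

Lemma pf_subst_pf_fun p : subst (pf_fun p) = pf_fun (cmp p).
Proof. by rewrite -[pf_fun p]pf_mulr1 pf_subst_fun pf_subst_one pf_mulr1. Qed.

Lemma pf_diff_funM n (p q : {mpoly K[n]}) : pf_diff (pf_fun (p * q)) =
  pf_mul (pf_fun p) (pf_diff (pf_fun q)) + pf_mul (pf_fun q) (pf_diff (pf_fun p)).
Proof. by rewrite -pf_mul_fun pf_diffM0 -pf_mul_funC addrC. Qed.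

Lemma pf_diff_const n (c : K) : pf_diff (pf_fun (c%:MP : {mpoly K[n]})) = 0.
Proof.
rewrite pf_diffE big1 // => i _; rewrite pf_funE pf_pd_mon mderivC.
by rewrite (lin0 (pf_mon_lin _)) (lin0 (pf_mul_linr _)).
Qed.

Lemma pf_subst_diff_fun p : 2 != 0 :> K ->
  subst (pf_diff (pf_fun p)) = pf_diff (pf_fun (cmp p)).
Proof.
move=> two_neq0; elim/mpoly_gen_ind: p => [c|i|p q IH IH'|p q IH IH'].
- by rewrite comp_mpolyC !pf_diff_const (lin0 pf_subst_lin).
- rewrite -[pf_diff _]/(pf_dt K i) pf_dtE mPo_X -[pf_mon _ _]pf_mulr1.
  by rewrite pf_subst_dt // pf_subst_one pf_mulr1.
- rewrite raddfD /= ![pf_fun (_ + _)]pf_funE !(linD (pf_mon_lin _)).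
  by rewrite !(linD (@pf_diff_lin _ _)) (linD pf_subst_lin) IH IH'.
- by rewrite rmorphM !pf_diff_funM (linD pf_subst_lin) !pf_subst_fun IH IH'.
Qed.

Lemma pf_subst_diff x : 2 != 0 :> K -> subst (pf_diff x) = pf_diff (subst x).
Proof.
move=> two_neq0; elim/pf_gen_ind: x => [x x' IH IH'||p x IH|i x IH].
- by rewrite !(linD pf_subst_lin, linD (@pf_diff_lin _ _)) IH IH'.
- by rewrite pf_subst_one !pf_diff_one (lin0 pf_subst_lin).
- rewrite pf_subst_fun !pf_diffM0 (linD pf_subst_lin) pf_substM // pf_subst_fun.
  by rewrite IH pf_subst_diff_fun.
- rewrite (pf_subst_dt _ _ two_neq0) (pf_diffM1 _ (pf_comp_dt K i)).
  rewrite (pf_diffM1 _ (pf_comp_diff_fun _)) pf_diff_dt (pf_diff2 _ two_neq0).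
  rewrite !(lin0 (pf_mul_linl _)) !sub0r (linN pf_subst_lin).
  by rewrite (pf_subst_dt _ _ two_neq0) IH.
Qed.

Lemma pf_subst_comp i x : 2 != 0 :> K -> subst (pf_comp i x) = pf_comp i (subst x).
Proof.
move=> two_neq0; elim/pf_gen_ind: x i => [x x' IH IH'|| p x IH|j x IH] i.
- by rewrite !(linD pf_subst_lin, linD (pf_comp_lin _)) IH IH'.
- rewrite pf_subst_one /pf_one !pf_funE !pf_comp_mon !cards0; case: eqP => // _.
    by rewrite -!pf_funE pf_subst_one.
  by rewrite (lin0 pf_subst_lin).
- by rewrite pf_compM0 !pf_subst_fun pf_compM0 IH.
- rewrite (pf_subst_dt _ _ two_neq0); case: i => [|i].
    rewrite (pf_comp0M1 _ (pf_comp_dt K j)) (pf_comp0M1 _ (pf_comp_diff_fun _)).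
    exact: (lin0 pf_subst_lin).
  rewrite (pf_compM1 _ _ (pf_comp_dt K j)) (pf_compM1 _ _ (pf_comp_diff_fun _)).
  by rewrite (pf_subst_dt _ _ two_neq0) IH.
Qed.

Lemma eq_pf_subst (tau' : 'I_m -> {mpoly K[m']}) x : tau =1 tau' ->
  pf_subst tau x = pf_subst tau' x.
Proof. by move=> e; rewrite (boolp.funext e). Qed.

End Substitution.

Opaque pf_subst pf_mul pf_diff pf_comp.

Lemma pf_subst_subst (K : fieldType) m m' m'' (tau : 'I_m -> {mpoly K[m']})
    (sigma : 'I_m' -> {mpoly K[m'']}) x : 2 != 0 :> K ->
  pf_subst sigma (pf_subst tau x) =
  pf_subst (fun i => tau i \mPo [tuple sigma j | j < m']) x.
Proof.
move=> two_neq0; elim/pf_gen_ind: x => [x x' IH IH'||p x IH|i x IH].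
- rewrite [pf_subst tau _](linD (pf_subst_lin tau)).
  rewrite [LHS](linD (pf_subst_lin sigma)).
  rewrite [RHS](linD (pf_subst_lin (fun i => tau i \mPo _))).
  exact: (f_equal2 +%R IH IH').
- by rewrite !pf_subst_one.
- rewrite !pf_subst_fun IH; congr (pf_mul (pf_fun _) _).
  elim/mpoly_gen_ind: p => [c|i|p q IHp IHq|p q IHp IHq].
  + by rewrite !comp_mpolyC.
  + by rewrite !mPo_X.
  + by rewrite !raddfD /= IHp IHq.
  + by rewrite !rmorphM /= IHp IHq.
- rewrite (pf_subst_dt tau _ _ two_neq0) (pf_substM sigma _ _ two_neq0) IH.
  rewrite (pf_subst_diff_fun sigma _ two_neq0).
  by rewrite (pf_subst_dt (fun i => tau i \mPo _) _ _ two_neq0).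
Qed.

(** * The dg algebra of forms on a simplex *)

Section LinSpan.
Variables (K : fieldType) (V : lmodType K) (A : V -> Prop).

Lemma lin_spanD x y : lin_span A x -> lin_span A y -> lin_span A (x + y).
Proof. by move=> Ax Ay; rewrite -[x]scale1r; apply: lin_span_lin. Qed.

Lemma lin_spanZ c x : lin_span A x -> lin_span A (c *: x).
Proof. by move=> Ax; rewrite -[_ *: _]addr0; apply: lin_span_lin => //; apply: lin_span0. Qed.

Lemma lin_spanN x : lin_span A x -> lin_span A (- x).
Proof. by move=> Ax; rewrite -scaleN1r; apply: lin_spanZ. Qed.

Lemma lin_spanB x y : lin_span A x -> lin_span A y -> lin_span A (x - y).
Proof. by move=> Ax Ay; apply: lin_spanD => //; apply: lin_spanN. Qed.

Lemma lin_span_gen x : A x -> lin_span A x.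
Proof.
move=> Ax; rewrite -[x]addr0 -[x]scale1r; apply: lin_spanZD => //.
exact: lin_span0.
Qed.

Lemma lin_span_sum I (r : seq I) (P : pred I) (F : I -> V) :
  (forall i, P i -> lin_span A (F i)) -> lin_span A (\sum_(i <- r | P i) F i).
Proof.
move=> AF; apply: (big_ind (lin_span A)) => //; first exact: lin_span0.
exact: lin_spanD.
Qed.

Lemma qproj_lin : linear (qproj A).
Proof. by move=> c x y; rewrite qprojD -qscaleE. Qed.

Lemma qproj0P x : qproj A x = 0 <-> lin_span A x.
Proof. by rewrite -(lin0 qproj_lin) qproj_eq subr0. Qed.

Lemma qproj_ind (P : quotmod A -> Prop) : (forall x, P (qproj A x)) -> forall a, P a.
Proof. by move=> h a; rewrite -(qreprK a). Qed.

End LinSpan.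

Lemma lin_span_map (K : fieldType) (V W : lmodType K) (A : V -> Prop) (B : W -> Prop)
    (f : V -> W) : linear f -> (forall x, A x -> lin_span B (f x)) ->
  forall x, lin_span A x -> lin_span B (f x).
Proof.
move=> lf AB x; elim=> [|c {}x y Ax _ IH]; first by rewrite (lin0 lf); apply: lin_span0.
by rewrite lf; apply: lin_span_lin => //; apply: AB.
Qed.

(** The bound N on the degrees turns sums over all components into sums over ordinals. Graded
    commutativity and Leibniz are stated on components, so that no homogeneity hypothesis has to be
    carried along. *)
Record isCdga (K : fieldType) (A : dgaData K) (N : nat) : Prop := IsCdga {
  cdga_comp_lin : forall i, linear (dga_comp i : A -> A);
  cdga_comp_comp : forall i j (a : A),
    dga_comp i (dga_comp j a) = if i == j then dga_comp j a else 0;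
  cdga_comp_bound : forall i (a : A), (N <= i)%N -> dga_comp i a = 0;
  cdga_comp_sum : forall a : A, \sum_(i < N) dga_comp i a = a;
  cdga_diff_lin : linear (dga_diff : A -> A);
  cdga_diff_comp : forall i (a : A), dga_comp i.+1 (dga_diff a) = dga_diff (dga_comp i a);
  cdga_diff_comp0 : forall a : A, dga_comp 0 (dga_diff a) = 0;
  cdga_diff2 : forall a : A, dga_diff (dga_diff a) = 0;
  cdga_mul_linl : forall b, linear (fun a : A => dga_mul a b);
  cdga_mul_linr : forall a : A, linear (dga_mul a);
  cdga_mul_comp : forall i j (a b : A),
    dga_comp (i + j) (dga_mul (dga_comp i a) (dga_comp j b)) =
    dga_mul (dga_comp i a) (dga_comp j b);
  cdga_mulA : forall a b c : A, dga_mul a (dga_mul b c) = dga_mul (dga_mul a b) c;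
  cdga_mulC : forall i j (a b : A), dga_mul (dga_comp i a) (dga_comp j b) =
    (-1) ^+ (i * j) *: dga_mul (dga_comp j b) (dga_comp i a);
  cdga_leibniz : forall i (a b : A), dga_diff (dga_mul (dga_comp i a) b) =
    dga_mul (dga_diff (dga_comp i a)) b + (-1) ^+ i *: dga_mul (dga_comp i a) (dga_diff b) }.

Section Simplex.
Variables (K : fieldType).
Hypothesis two_neq0 : 2 != 0 :> K.

Section Ideal.
Variable n : nat.
Local Notation rel := (@omega_rel K n).
Local Notation forms := {ffun {set 'I_n.+1} -> {mpoly K[n.+1]}}.
Local Notation pi := (qproj rel).

Definition simplex_fun : forms := \sum_i pf_t K i - pf_one K n.+1.

Lemma pf_diff_simplex_fun : pf_diff simplex_fun = \sum_i pf_dt K i.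
Proof. by rewrite (linB (@pf_diff_lin _ _)) pf_diff_one subr0 (lin_sum (@pf_diff_lin _ _)). Qed.

Lemma omega_genP (g : forms) : @omega_gen K n g <-> g = simplex_fun \/ g = pf_diff simplex_fun.
Proof. by rewrite pf_diff_simplex_fun. Qed.

Lemma omega_gen_homog (g : forms) : @omega_gen K n g -> exists i, pf_comp i g = g.
Proof.
have h : pf_comp 0 simplex_fun = simplex_fun.
  rewrite (linB (pf_comp_lin _)) (lin_sum (pf_comp_lin _)) /pf_one pf_comp_fun.
  by congr (_ - _); apply: eq_bigr => i _; rewrite pf_comp_fun.
move/omega_genP => [->|->]; [by exists 0%N | exists 1%N].
by rewrite pf_diff_comp h.
Qed.

Lemma omega_mull (x y : forms) : lin_span rel x -> lin_span rel (pf_mul y x).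
Proof.
apply: lin_span_map => [|{}x [a [g [b [gg ->]]]]]; first exact: pf_mul_linr.
apply: lin_span_gen; exists (pf_mul y a), g, b; split => //.
by rewrite !pf_mulA.
Qed.

Lemma omega_mulr (x y : forms) : lin_span rel x -> lin_span rel (pf_mul x y).
Proof.
apply: (@lin_span_map _ _ _ _ _ (fun x => pf_mul x y)) => [|{}x [a [g [b [gg ->]]]]].
  exact: pf_mul_linl.
apply: lin_span_gen; exists a, g, (pf_mul b y); split => //.
by rewrite !pf_mulA.
Qed.

Lemma omega_gen_span (g : forms) : @omega_gen K n g -> lin_span rel g.
Proof.
move=> gg; apply: lin_span_gen; exists (pf_one K n.+1), g, (pf_one K n.+1).
by rewrite pf_mul1 pf_mulr1.
Qed.

(** The differential exchanges the first generator of the ideal for the second and kills the second.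
    The Leibniz rule asks for a homogeneous left factor, whence the splitting of [a] into
    components. *)
Lemma omega_diff (x : forms) : lin_span rel x -> lin_span rel (pf_diff x).
Proof.
apply: lin_span_map => [|{}x [a [g [b [gg ->]]]]]; first exact: pf_diff_lin.
rewrite -[a]pf_comp_sum !(lin_sum (pf_mul_linl _)) (lin_sum (@pf_diff_lin _ _)).
apply: lin_span_sum => i _; rewrite -pf_mulA pf_diffM.
have [k gk] := omega_gen_homog gg.
apply: lin_spanD; first by apply: omega_mull; apply: omega_mulr; apply: omega_gen_span.
apply: lin_spanZ; apply: omega_mull; rewrite -gk pf_diffM.
apply: lin_spanD; last by apply: lin_spanZ; apply: omega_mulr; rewrite gk; apply: omega_gen_span.
apply: omega_mulr; rewrite gk; move/omega_genP: gg => [->|->].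
  by apply: omega_gen_span; apply/omega_genP; right.
by rewrite pf_diff2 //; apply: lin_span0.
Qed.

Lemma omega_comp i (x : forms) : lin_span rel x -> lin_span rel (pf_comp i x).
Proof.
apply: lin_span_map => [|{}x [a [g [b [gg ->]]]]]; first exact: pf_comp_lin.
have [k gk] := omega_gen_homog gg.
rewrite -[a]pf_comp_sum !(lin_sum (pf_mul_linl _)) (lin_sum (pf_comp_lin _)).
apply: lin_span_sum => j _.
rewrite -[b]pf_comp_sum (lin_sum (pf_mul_linr _)) (lin_sum (pf_comp_lin _)).
apply: lin_span_sum => l _; rewrite -gk -pf_comp_mul -pf_comp_mul pf_comp_comp.
case: ifP => _; last exact: lin_span0.
rewrite !pf_comp_mul gk; apply: lin_span_gen; exists (pf_comp j a), g, (pf_comp l b).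
by [].
Qed.

Lemma pi_eq (x y : forms) : lin_span rel (x - y) -> pi x = pi y.
Proof. by move/qproj_eq. Qed.

Lemma qrepr_pi (x : forms) : lin_span rel (qrepr (pi x) - x).
Proof. by apply/qproj_eq; rewrite qreprK. Qed.

Lemma Omega_compE i (x : forms) : dga_comp i (pi x : Omega K n) = pi (pf_comp i x).
Proof. by apply: pi_eq; rewrite -(linB (pf_comp_lin _)); apply/omega_comp/qrepr_pi. Qed.

Lemma Omega_diffE (x : forms) : dga_diff (pi x : Omega K n) = pi (pf_diff x).
Proof. by apply: pi_eq; rewrite -(linB (@pf_diff_lin _ _)); apply/omega_diff/qrepr_pi. Qed.

Lemma Omega_mulE (x y : forms) :
  dga_mul (pi x : Omega K n) (pi y : Omega K n) = pi (pf_mul x y).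
Proof.
apply: pi_eq.
rewrite -[X in X - _](subrK (pf_mul x (qrepr (pi y)))) -addrA; apply: lin_spanD.
  by rewrite -(linB (pf_mul_linl _)); apply/omega_mulr/qrepr_pi.
by rewrite -(linB (pf_mul_linr _)); apply/omega_mull/qrepr_pi.
Qed.

Lemma pi_ind (P : Omega K n -> Prop) : (forall x, P (pi x)) -> forall a, P a.
Proof. exact: qproj_ind. Qed.

Let piL := qproj_lin rel.

(** Modulo the ideal dt_0 ... dt_n vanishes: it equals up to sign the product of dt_0 + ... + dt_n
    with dt_1 ... dt_n, because the summands dt_i with i > 0 repeat a factor. *)
Lemma omega_top (x : forms) : lin_span rel (pf_comp n.+1 x).
Proof.
elim/pf_mon_ind: x => [A p|x y IH IH']; last first.
  by rewrite (linD (pf_comp_lin _)); apply: lin_spanD.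
rewrite pf_comp_mon; case: eqP => [cA|_]; last exact: lin_span0.
have {cA} -> : A = setT.
  by apply/eqP; rewrite eqEcard subsetT cA cardsT card_ord leqnn.
rewrite -[p]mulr1 -pf_mul_fun_mon; apply: omega_mull.
set B := setT :\ (ord0 : 'I_n.+1).
have -> : pf_mon setT 1 = pf_mul (\sum_i pf_dt K i)
    ((-1) ^+ inversions [set ord0] B *: pf_mon B 1) :> forms.
  rewrite (linZ (pf_mul_linr _)) (lin_sum (pf_mul_linl _)) (bigD1 ord0) //= big1.
    rewrite pf_dtE pf_mul_mon disjoints_subset sub1set !inE eqxx addr0 /=.
    rewrite setD1K ?inE // -(linZ (pf_mon_lin _)) !mulr1 scaler_signn.
    by rewrite -signr_odd; case: odd => /=; rewrite ?expr1 ?opprK ?expr0.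
  move=> i i0; rewrite pf_dtE pf_mul_mon disjoints_subset sub1set !inE.
  by rewrite (negPf i0).
by apply/omega_mulr/omega_gen_span/omega_genP; right; rewrite pf_diff_simplex_fun.
Qed.

Lemma Omega_isCdga : isCdga (Omega K n) n.+1.
Proof.
have compL i : linear (dga_comp i : Omega K n -> Omega K n).
  move=> c; elim/pi_ind=> x; elim/pi_ind=> y.
  by rewrite -piL !Omega_compE -piL pf_comp_lin.
have top i (a : Omega K n) : (n.+1 <= i)%N -> dga_comp i a = 0.
  elim/pi_ind: a => x; rewrite Omega_compE leq_eqVlt => /predU1P[<-|ni].
    by apply/qproj0P/omega_top.
  by rewrite pf_comp_bound // (lin0 piL).
split => //.
- move=> i j; elim/pi_ind=> x; rewrite !Omega_compE pf_comp_comp.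
  by case: ifP => // _; rewrite (lin0 piL).
(* Forms in n + 1 variables have degrees 0 to n + 1, one more than the bound allows; the last
   component is zero in the quotient. *)
- elim/pi_ind=> x; transitivity (pi (\sum_(i < n.+1) pf_comp i x + pf_comp n.+1 x)); last first.
    by rewrite -[in RHS](pf_comp_sum x) [in RHS]big_ord_recr.
  rewrite (linD piL) (lin_sum piL) -[X in _ + X]Omega_compE top // addr0.
  by apply: eq_bigr => i _; rewrite Omega_compE.
- move=> c; elim/pi_ind=> x; elim/pi_ind=> y.
  by rewrite -piL !Omega_diffE -piL pf_diff_lin.
- by move=> i; elim/pi_ind=> x; rewrite Omega_diffE !Omega_compE Omega_diffE pf_diff_comp.
- by elim/pi_ind=> x; rewrite Omega_diffE Omega_compE pf_diff_comp0 (lin0 piL).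
- by elim/pi_ind=> x; rewrite !Omega_diffE pf_diff2 // (lin0 piL).
- elim/pi_ind=> z c; elim/pi_ind=> x; elim/pi_ind=> y.
  by rewrite -piL !Omega_mulE -piL pf_mul_linl.
- elim/pi_ind=> z c; elim/pi_ind=> x; elim/pi_ind=> y.
  by rewrite -piL !Omega_mulE -piL pf_mul_linr.
- move=> i j; elim/pi_ind=> x; elim/pi_ind=> y.
  by rewrite (Omega_compE i x) (Omega_compE j y) Omega_mulE Omega_compE pf_comp_mul.
- elim/pi_ind=> x; elim/pi_ind=> y; elim/pi_ind=> z.
  by rewrite !Omega_mulE pf_mulA.
- move=> i j; elim/pi_ind=> x; elim/pi_ind=> y.
  by rewrite (Omega_compE i x) (Omega_compE j y) !Omega_mulE -(linZ piL) pf_mulC.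
- move=> i; elim/pi_ind=> x; elim/pi_ind=> y.
  rewrite (Omega_compE i x) Omega_mulE !Omega_diffE !Omega_mulE -(linZ piL) -(linD piL).
  by rewrite pf_diffM.
Qed.

Definition Om_one : Omega K n := pi (pf_one K n.+1).
Definition Om_t (i : 'I_n.+1) : Omega K n := pi (pf_t K i).

Lemma Om_mul1 (a : Omega K n) : dga_mul Om_one a = a.
Proof. by elim/pi_ind: a => x; rewrite Omega_mulE pf_mul1. Qed.

Lemma Om_mulr1 (a : Omega K n) : dga_mul a Om_one = a.
Proof. by elim/pi_ind: a => x; rewrite Omega_mulE pf_mulr1. Qed.

Lemma Om_diff_one : dga_diff Om_one = 0.
Proof. by rewrite Omega_diffE pf_diff_one (lin0 piL). Qed.

Lemma Om_comp_one : dga_comp 0 Om_one = Om_one.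
Proof. by rewrite Omega_compE /pf_one pf_comp_fun. Qed.

Lemma Om_comp_t i : dga_comp 0 (Om_t i) = Om_t i.
Proof. by rewrite Omega_compE pf_comp_fun. Qed.

Lemma Om_sum_t : \sum_i Om_t i = Om_one.
Proof.
apply/eqP; rewrite -subr_eq0 -(lin_sum piL) -(linB piL); apply/eqP/qproj0P.
by apply/omega_gen_span/omega_genP; left.
Qed.

End Ideal.

Section Pullback.
Variables (k n : nat).

Definition affine_sub (f : 'I_k.+1 -> 'I_n.+1) (i : 'I_n.+1) : {mpoly K[k.+1]} :=
  \sum_(j | f j == i) 'X_j.

Lemma pf_subst_simplex_fun m (tau : 'I_n.+1 -> {mpoly K[m]}) :
  pf_subst tau (simplex_fun n) = pf_fun (\sum_i tau i - 1).
Proof.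
rewrite (linB (pf_subst_lin _)) pf_subst_one (lin_sum (pf_subst_lin _)).
rewrite !pf_funE (linB (pf_mon_lin _)) (lin_sum (pf_mon_lin _)).
by congr (_ - _); apply: eq_bigr => i _; rewrite pf_subst_pf_fun mPo_X.
Qed.

(** The fibres of f partition the vertices of the source, so the sum of the t_i pulls back to the
    sum of the t_j, and each generator of the ideal to the corresponding one. *)
Lemma omega_subst (f : 'I_k.+1 -> 'I_n.+1) x : lin_span (@omega_rel K n) x ->
  lin_span (@omega_rel K k) (pf_subst (affine_sub f) x).
Proof.
apply: lin_span_map => [|{}x [a [g [b [gg ->]]]]]; first exact: pf_subst_lin.
rewrite !pf_substM //; apply/omega_mulr/omega_mull/omega_gen_span.
have e : pf_subst (affine_sub f) (simplex_fun n) = simplex_fun k.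
  rewrite pf_subst_simplex_fun.
  have -> : \sum_i affine_sub f i = \sum_j 'X_j by rewrite [RHS](partition_big f predT).
  by rewrite pf_funE (linB (pf_mon_lin _)) (lin_sum (pf_mon_lin _)).
apply/omega_genP; move/omega_genP: gg => [->|->]; first by left.
by right; rewrite pf_subst_diff // e.
Qed.

Lemma pullbackE (f : 'I_k.+1 -> 'I_n.+1) x :
  pullback f (qproj (@omega_rel K n) x) = qproj (@omega_rel K k) (pf_subst (affine_sub f) x).
Proof.
by apply: pi_eq; rewrite -(linB (pf_subst_lin _)); apply/omega_subst/qrepr_pi.
Qed.

Variable f : 'I_k.+1 -> 'I_n.+1.
Implicit Types a b : Omega K n.

Lemma pullback_lin : linear (@pullback K k n f).
Proof.
move=> c; elim/pi_ind=> x; elim/pi_ind=> y.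
by rewrite -qproj_lin !pullbackE -qproj_lin pf_subst_lin.
Qed.

Lemma pullback_mul a b : pullback f (dga_mul a b) = dga_mul (pullback f a) (pullback f b).
Proof.
elim/pi_ind: a => x; elim/pi_ind: b => y.
by rewrite Omega_mulE !pullbackE Omega_mulE pf_substM.
Qed.

Lemma pullback_diff a : pullback f (dga_diff a) = dga_diff (pullback f a).
Proof. by elim/pi_ind: a => x; rewrite Omega_diffE !pullbackE Omega_diffE pf_subst_diff. Qed.

Lemma pullback_comp i a : pullback f (dga_comp i a) = dga_comp i (pullback f a).
Proof. by elim/pi_ind: a => x; rewrite Omega_compE !pullbackE Omega_compE pf_subst_comp. Qed.

Lemma pullback_one : pullback f (Om_one n) = Om_one k.
Proof. by rewrite pullbackE pf_subst_one. Qed.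

Lemma pullback_t i : pullback f (Om_t i) = \sum_(j | f j == i) Om_t j.
Proof.
rewrite pullbackE pf_subst_pf_fun mPo_X /affine_sub pf_funE (lin_sum (pf_mon_lin _)).
by rewrite (lin_sum (qproj_lin _)).
Qed.

End Pullback.

Lemma pullback_pullback l k n (f : 'I_k.+1 -> 'I_n.+1) (g : 'I_l.+1 -> 'I_k.+1) (a : Omega K n) :
  pullback g (pullback f a) = pullback (f \o g) a.
Proof.
elim/pi_ind: a => x; rewrite !pullbackE pf_subst_subst //; congr qproj.
apply: eq_pf_subst => i; rewrite /affine_sub raddf_sum /=.
rewrite (eq_bigr (fun j => \sum_(h | g h == j) 'X_h)) => [|j _]; last by rewrite mPo_X.
rewrite (exchange_big_dep predT) //= [RHS]big_mkcond; apply: eq_bigr => j _.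
case: ifP => fgj.
  rewrite (big_pred1 (g j)) // => h /=; rewrite [g j == h]eq_sym.
  by case: (altP (h =P g j)) => [->|_]; rewrite ?andbF // [_ == i]fgj.
rewrite big_pred0 // => h /=; case: (altP (g j =P h)) => [<-|_]; last by rewrite andbF.
by rewrite [_ == i]fgj.
Qed.

End Simplex.

Lemma char0_natr (K : fieldType) n : [pchar K] =i pred0 -> n.+1%:R != 0 :> K.
Proof. by move=> /pcharf0P ->. Qed.

Section Cdga.
Variables (K : fieldType) (A : dgaData K) (N : nat).
Hypothesis cA : isCdga A N.
Implicit Types a b : A.

Lemma cdga_ind (P : A -> Prop) : (forall a b, P a -> P b -> P (a + b)) ->
  (forall i a, dga_comp i a = a -> P a) -> forall a, P a.
Proof.
move=> PD Ph a; rewrite -(cdga_comp_sum cA a); apply: (big_ind P) => //.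
  by apply: (Ph 0%N); rewrite (lin0 (cdga_comp_lin cA _)).
by move=> i _; apply: (Ph i); rewrite (cdga_comp_comp cA) eqxx.
Qed.

Lemma cdga_mul_homog i j a b : dga_comp i a = a -> dga_comp j b = b ->
  dga_comp (i + j) (dga_mul a b) = dga_mul a b.
Proof. by move=> <- <-; apply: cdga_mul_comp cA _ _ _ _. Qed.

Lemma cdga_mulC_homog i j a b : dga_comp i a = a -> dga_comp j b = b ->
  dga_mul a b = (-1) ^+ (i * j) *: dga_mul b a.
Proof. by move=> <- <-; apply: cdga_mulC cA _ _ _ _. Qed.

Lemma cdga_leibniz_homog i a b : dga_comp i a = a -> dga_diff (dga_mul a b) =
  dga_mul (dga_diff a) b + (-1) ^+ i *: dga_mul a (dga_diff b).
Proof. by move=> <-; apply: cdga_leibniz cA _ _ _. Qed.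

Lemma cdga_diff_homog i a : dga_comp i a = a -> dga_comp i.+1 (dga_diff a) = dga_diff a.
Proof. by move=> ai; rewrite (cdga_diff_comp cA) ai. Qed.

Lemma cdga_comp_homog i j a : dga_comp i a = a ->
  dga_comp j a = if j == i then a else 0.
Proof. by move=> <-; rewrite (cdga_comp_comp cA). Qed.

End Cdga.

(** * Integration over simplices and the elementary forms of low degree *)

Section Integral.
Variable K : fieldType.
Hypothesis charK0 : [pchar K] =i pred0.

Let two_neq0 : 2 != 0 :> K. Proof. exact: char0_natr. Qed.

Section Mint.
Variable k : nat.
Implicit Types p q : {mpoly K[k.+1]}.

(** The integral of t^e dt_1 ... dt_k over the standard simplex, once t_0 has been eliminated. *)
Definition int_weight (e : 'X_{1..k.+1}) : K :=
  (\prod_(i | i != ord0) (e i)`!)%N%:R / ((\sum_(i | i != ord0) e i + k)`!)%N%:R.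

Definition mint p : K := \sum_(e <- msupp p) p@_e * int_weight e.

(** A sum over the support of p is not visibly additive in p; a sum over a fixed list that contains
    all the supports is. *)
Lemma mint_widen p (r : seq 'X_{1..k.+1}) : uniq r -> {subset msupp p <= r} ->
  mint p = \sum_(e <- r) p@_e * int_weight e.
Proof.
move=> ur pr; rewrite (bigID (mem (msupp p))) /= [X in _ + X]big1 ?addr0; last first.
  by move=> e; rewrite mcoeff_msupp negbK => /eqP ->; rewrite mul0r.
rewrite -big_filter; apply: perm_big; apply: uniq_perm.
- exact: msupp_uniq.
- exact: filter_uniq.
- move=> e; rewrite mem_filter /=; case ep: (e \in msupp p) => //=.
  by rewrite pr.
Qed.

Lemma mint_lin : linear (mint : _ -> K^o).
Proof.
move=> c p q; pose r := undup (msupp (c *: p + q) ++ msupp p ++ msupp q).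
have sub s : {subset s <= msupp (c *: p + q) ++ msupp p ++ msupp q} -> {subset s <= r}.
  by move=> h e es; rewrite mem_undup h.
rewrite !(@mint_widen _ r) ?undup_uniq //.
- rewrite scaler_sumr -big_split; apply: eq_bigr => e _ /=.
  by rewrite mcoeffD mcoeffZ mulrDl -mulrA.
- by apply: sub => e es; rewrite !mem_cat es !orbT.
- by apply: sub => e es; rewrite !mem_cat es !orbT.
- by apply: sub => e es; rewrite !mem_cat es.
Qed.

Lemma mint1 : mint 1 = (k`!%:R)^-1.
Proof.
rewrite /mint msupp1 big_seq1 mcoeff1 eqxx mul1r /int_weight.
rewrite !big1 ?add0n ?mul1r // => i _; by rewrite mnm0E.
Qed.

Local Notation top := (~: [set ord0 : 'I_k.+1]).

Lemma eliminate_lin : linear (@eliminate_t0 K k).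
Proof. exact: pf_subst_lin. Qed.

(** The substitution sends t_0 + ... + t_k - 1 to 0, hence kills the whole ideal; this is why the
    integral is independent of the representative. *)
Lemma eliminate_omega x : lin_span (@omega_rel K k) x -> eliminate_t0 x = 0.
Proof.
elim=> [|c {}x y [a [g [b [gg ->]]]] _ IH]; first exact: (lin0 (pf_subst_lin _)).
rewrite /eliminate_t0 pf_subst_lin [X in _ + X]IH addr0 !(pf_substM _ _ _ two_neq0).
have e : eliminate_t0 (simplex_fun K k) = 0.
  rewrite /eliminate_t0 pf_subst_simplex_fun (bigD1 ord0) //=.
  rewrite [X in _ + X - _](eq_bigr (fun i => 'X_i)) => [|i /negPf -> //].
  by rewrite subrK subrr pf_funE (lin0 (pf_mon_lin _)).
suff eg : eliminate_t0 g = 0.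
  by rewrite [pf_subst _ g]eg (lin0 (pf_mul_linr _)) (lin0 (pf_mul_linl _)) scaler0.
move/omega_genP: gg => [->|->]; first exact: e.
by rewrite /eliminate_t0 (pf_subst_diff _ _ two_neq0) [X in pf_diff X]e (lin0 (@pf_diff_lin _ _)).
Qed.

Lemma integralE x : integral (qproj (@omega_rel K k) x) = mint (eliminate_t0 x top).
Proof.
have e : eliminate_t0 (qrepr (qproj (@omega_rel K k) x)) = eliminate_t0 x.
  apply/eqP; rewrite -subr_eq0 -(linB eliminate_lin); apply/eqP/eliminate_omega.
  exact: qrepr_pi.
by rewrite /integral e.
Qed.

Lemma integral_lin : linear (@integral K k : Omega K k -> K^o).
Proof.
move=> c; elim/pi_ind=> x; elim/pi_ind=> y.
rewrite -qproj_lin !integralE eliminate_lin 2!ffunE.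
exact: mint_lin.
Qed.

Lemma integral_comp i (a : Omega K k) :
  integral (dga_comp i a) = if i == k then integral a else 0.
Proof.
elim/pi_ind: a => x; rewrite Omega_compE !integralE /eliminate_t0 (pf_subst_comp _ _ _ two_neq0).
have ct : #|top| = k by rewrite cardsC1 card_ord.
rewrite pf_compE ct eq_sym; case: ifP => // _.
exact: (lin0 mint_lin).
Qed.

End Mint.

Lemma integral_one : integral (Om_one K 0) = 1.
Proof.
rewrite integralE /eliminate_t0 pf_subst_one ffunE.
have -> : ~: [set ord0 : 'I_1] = set0.
  by apply/setP=> i; rewrite !inE ord1.
by rewrite eqxx mint1 invr1.
Qed.

(** On a point the integral is evaluation at t_0 = 1, a ring morphism. *)
Lemma integral0_mul (a b : Omega K 0) :
  integral (dga_mul a b) = integral a * integral b.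
Proof.
have e0 : ~: [set ord0 : 'I_1] = set0 by apply/setP=> i; rewrite !inE ord1.
have E (p : {mpoly K[1]}) : mint p = p.@[fun=> 1].
  rewrite mevalE /mint; apply: eq_bigr => e _; congr (_ * _).
  rewrite [RHS]big1 => [|i _]; last by rewrite expr1n.
  have p0 (i : 'I_1) : (i != ord0) = false by rewrite ord1 eqxx.
  by rewrite /int_weight [X in X%:R]big_pred0 // [X in (X + _)%N]big_pred0 // divr1.
have EM (p q : {mpoly K[1]}) : mint (p * q) = mint p * mint q.
  by rewrite !E rmorphM.
elim/pi_ind: a => x; elim/pi_ind: b => y.
rewrite Omega_mulE.
rewrite (integralE (pf_mul x y)) (integralE x) (integralE y).
rewrite /eliminate_t0 (pf_substM _ x y two_neq0) e0 pf_mul_set0.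
exact: EM.
Qed.

Lemma Om0_t i : Om_t K i = Om_one K 0.
Proof. by rewrite -Om_sum_t big_ord_recl big_ord0 addr0 ord1. Qed.

Lemma integral1_dt : integral (dga_diff (Om_t K (ord_max : 'I_2))) = 1.
Proof.
rewrite (Omega_diffE two_neq0) integralE /eliminate_t0 -[pf_diff _]/(pf_dt _ _) pf_dtE.
rewrite -[pf_mon _ _]pf_mulr1 (pf_subst_dt _ _ _ two_neq0) pf_subst_one pf_mulr1 /=.
rewrite -[pf_diff _]/(pf_dt _ _) pf_dtE ffunE.
have -> : ~: [set ord0] = [set ord_max : 'I_2].
  by apply/setP=> i; rewrite !inE; case: i => [] [|[]].
by rewrite eqxx mint1 invr1.
Qed.

(** Eliminating dt_0 = - dt_1 - dt_2 gives dt_0 dt_2 = - dt_1 dt_2, and the integral of dt_1 dt_2 is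
    1/2!. *)
Lemma integral2_dt : integral (dga_mul (dga_diff (Om_t K (ord0 : 'I_3)))
   (dga_diff (Om_t K (ord_max : 'I_3)))) = - 2^-1.
Proof.
pose o1 : 'I_3 := inord 1.
have v1 : o1 = 1%N :> nat by rewrite inordK.
rewrite !(Omega_diffE two_neq0) Omega_mulE integralE /eliminate_t0.
rewrite -![pf_diff _]/(pf_dt _ _) !pf_dtE (pf_subst_dt _ _ _ two_neq0).
rewrite -[pf_mon [set ord_max] 1]pf_mulr1 (pf_subst_dt _ _ _ two_neq0) pf_subst_one pf_mulr1 /=.
rewrite (bigD1 ord_max) //= (bigD1 o1) /=; last first.
  by rewrite -!val_eqE /= v1.
rewrite big_pred0; last first.
  by move=> i; rewrite -!val_eqE /= v1; case: i => [] [|[|[]]].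
rewrite addr0 pf_funE !(linB (pf_mon_lin _)) (linD (pf_mon_lin _)) -!pf_funE.
rewrite (linB (@pf_diff_lin _ _)) (linD (@pf_diff_lin _ _)) [pf_diff (pf_fun 1)]pf_diff_one.
rewrite -![pf_diff _]/(pf_dt _ _) !pf_dtE sub0r (linN (pf_mul_linl _)).
rewrite (linD (pf_mul_linl _)) [X in - (X + _)](@pf_mul_odd2 K 3) ?pf_comp_dt // add0r.
rewrite pf_mul_mon disjoints_subset sub1set !inE -val_eqE /= v1 /=.
rewrite !ffunE; have -> : ~: [set ord0] = [set o1] :|: [set ord_max].
  by apply/setP=> i; rewrite !inE -!val_eqE /= v1; case: i => [] [|[|[]]].
rewrite eqxx inversions1l eq_card0 ?expr0 ?mulr1; last first.
  by move=> j; rewrite !inE; case: eqP => // ->; rewrite /= v1.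
by rewrite (linN (@mint_lin 2)) mint1.
Qed.

HB.instance Definition _ m := Monoid.isLaw.Build {ffun {set 'I_m} -> {mpoly K[m]}}
  (pf_one K m) (@pf_mul K m) (@pf_mulA K m) (@pf_mul1 K m) (@pf_mulr1 K m).

Section ElementaryForms.
Variable n : nat.

(** The elementary form of the edge ij. *)
Definition Om_edge (i j : 'I_n.+1) : Omega K n :=
  dga_mul (Om_t K i) (dga_diff (Om_t K j)) - dga_mul (Om_t K j) (dga_diff (Om_t K i)).

Lemma elementary_form0 (f : 'I_1 -> 'I_n.+1) : elementary_form K f = Om_t K (f ord0).
Proof.
rewrite /elementary_form big_ord_recl big_ord0 expr0 !scale1r addr0.
by rewrite big_pred0 ?pf_mulr1 // => p; rewrite ord1 eqxx.
Qed.

Lemma elementary_form1 (f : 'I_2 -> 'I_n.+1) :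
  elementary_form K f = Om_edge (f ord0) (f ord_max).
Proof.
have l0 : fintype.lift ord0 (ord0 : 'I_1) = ord_max :> 'I_2 by apply/val_inj.
rewrite /elementary_form !big_ord_recl big_ord0 l0 expr0 expr1 !scale1r addr0.
rewrite (big_pred1 ord_max) => [|p]; last by case: p => [] [|[]].
rewrite (big_pred1 ord0) => [|p]; last by case: p => [] [|[]].
by rewrite scaleN1r (linB (qproj_lin _)) -!Omega_mulE -!(Omega_diffE two_neq0).
Qed.

Lemma Om_comp_edge i j : dga_comp 1 (Om_edge i j) = Om_edge i j.
Proof.
have cA := Omega_isCdga two_neq0 n.
rewrite (linB (cdga_comp_lin cA 1)); congr (_ - _).
  by apply: (cdga_mul_homog cA (i := 0) (j := 1));
    rewrite ?(cdga_diff_homog cA) ?Om_comp_t.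
by apply: (cdga_mul_homog cA (i := 0) (j := 1));
  rewrite ?(cdga_diff_homog cA) ?Om_comp_t.
Qed.

Lemma integral_pullback_t (f : 'I_1 -> 'I_n.+1) i :
  integral (pullback f (Om_t K i)) = (f ord0 == i)%:R.
Proof.
rewrite (pullback_t two_neq0) big_mkcond big_ord1 Om0_t.
by case: eqP => _; rewrite ?integral_one // (lin0 (@integral_lin 0)).
Qed.

End ElementaryForms.

Lemma pullback_edge k n (f : 'I_k.+1 -> 'I_n.+1) i j : pullback f (Om_edge i j) =
  dga_mul (pullback f (Om_t K i)) (dga_diff (pullback f (Om_t K j))) -
  dga_mul (pullback f (Om_t K j)) (dga_diff (pullback f (Om_t K i))).
Proof. by rewrite (linB (pullback_lin two_neq0 _)) !(pullback_mul two_neq0) !(pullback_diff two_neq0). Qed.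

Lemma Om1_t0 : Om_t K (ord0 : 'I_2) = Om_one K 1 - Om_t K ord_max.
Proof.
rewrite -Om_sum_t big_ord_recl big_ord1.
by rewrite (_ : fintype.lift ord0 ord0 = ord_max) ?addrK //; apply/val_inj.
Qed.

Lemma Om1_edge : Om_edge (ord0 : 'I_2) ord_max = dga_diff (Om_t K ord_max).
Proof.
have cA := Omega_isCdga two_neq0 1.
rewrite /Om_edge Om1_t0 (linB (cdga_diff_lin cA)) (Om_diff_one two_neq0) sub0r.
rewrite (linN (cdga_mul_linr cA _)) opprK -(linD (cdga_mul_linl cA _)) subrK.
exact: Om_mul1.
Qed.

(** Each t_p pulls back to the sum of the t_q with f q = p. As both edges are increasing, one of the
    two barycentric coordinates of the edge g pulls back to 0 unless the edges agree. *)
Lemma integral_pullback_edge n (f g : 'I_2 -> 'I_n.+1) :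
  (f ord0 < f ord_max)%N -> (g ord0 < g ord_max)%N ->
  integral (pullback f (Om_edge (g ord0) (g ord_max))) =
  ((f ord0 == g ord0) && (f ord_max == g ord_max))%:R.
Proof.
have cA := Omega_isCdga two_neq0 1.
have [i fi] : {i | f ord0 = i} by exists (f ord0).
have [j fj] : {j | f ord_max = j} by exists (f ord_max).
rewrite fi fj; move: (g ord0) (g ord_max) => k l ij kl.
have tE p : pullback f (Om_t K p) =
    (if i == p then Om_t K ord0 else 0) + (if j == p then Om_t K ord_max else 0).
  rewrite (pullback_t two_neq0) big_mkcond big_ord_recl big_ord1 fi.
  by rewrite (_ : fintype.lift ord0 ord0 = ord_max) ?fj //; apply/val_inj.
have z1 := lin0 (cdga_mul_linl cA _); have z2 := lin0 (cdga_mul_linr cA _).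
have z3 := lin0 (cdga_diff_lin cA); have z4 := lin0 (@integral_lin 1).
rewrite pullback_edge !tE.
have [ik|ik] := altP (i =P k).
  have -> : (i == l) = false by apply/negbTE; rewrite ik -val_eqE /= neq_ltn kl.
  have -> : (j == k) = false by apply/negbTE; rewrite -ik -val_eqE /= neq_ltn ij orbT.
  rewrite addr0 add0r; case: eqP => _; last by rewrite z3 z1 z2 subr0 z4.
  by rewrite -/(Om_edge ord0 ord_max) Om1_edge integral1_dt.
have [jk|jk] := altP (j =P k).
  have -> : (i == l) = false.
    by apply/negbTE; rewrite -val_eqE /= neq_ltn (ltn_trans ij) // jk.
  have -> : (j == l) = false by apply/negbTE; rewrite jk -val_eqE /= neq_ltn kl.
  by rewrite !addr0 z3 z1 z2 subr0 z4.
by rewrite !add0r z3 z1 z2 subr0 z4.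
Qed.

(** Here d ω_02 = 2 dt_0 dt_2. The value -1 agrees with Stokes: the edge 02 enters the boundary of
    the triangle with sign -1. That it is nonzero makes the third edge of a triangle computable from
    the other two. *)
Lemma integral2_edge : integral (dga_diff (Om_edge (ord0 : 'I_3) ord_max)) = - 1.
Proof.
have cA := Omega_isCdga two_neq0 2.
have t0 i := Om_comp_t K (i : 'I_3).
rewrite (linB (cdga_diff_lin cA)) !(cdga_leibniz_homog cA _ (t0 _)).
rewrite !(cdga_diff2 cA) !(lin0 (cdga_mul_linr cA _)) !scaler0 !addr0.
rewrite [X in _ - X](cdga_mulC_homog cA (i := 1) (j := 1)) ?(cdga_diff_homog cA) //.
rewrite expr1 scaleN1r opprK -mulr2n -scaler_nat (linZ (@integral_lin 2)).
by rewrite integral2_dt scalerN -[_ *: _]/(2 * 2^-1) divff.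
Qed.

End Integral.

From mathcomp Require Import boolp classical_sets functions cardinality fsbigop.

(** Koszul signs are compared through the parities of the degrees, so that every sign identity
    becomes a finite case check. *)
Definition oddz (z : int) : bool := odd `|z|%N.

Lemma oddzD a b : oddz (a + b) = oddz a (+) oddz b.
Proof. by rewrite /oddz; lia. Qed.

Lemma oddzN a : oddz (- a) = oddz a.
Proof. by rewrite /oddz abszN. Qed.

Lemma oddzM a b : oddz (a * b) = oddz a && oddz b.
Proof. by rewrite /oddz abszM oddM. Qed.

Lemma oddz_nat (n : nat) : oddz n%:Z = odd n.
Proof. by []. Qed.

Definition oddzE := (oddzD, oddzN, oddzM, oddz_nat, oddD, oddM).

Lemma scaler_signz (K : fieldType) (V : lmodType K) (z : int) (v : V) :
  (-1) ^ z *: v = if oddz z then - v else v.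
Proof.
case: z => n; rewrite /oddz /=; first exact: scaler_signn.
by rewrite -[_ ^ _]/((-1) ^- n.+1) -exprVn invrN1 scaler_signn.
Qed.

(** * Tensor products of dg Lie algebras and dg algebras *)

Section FiniteSums.
Variables (I : choiceType) (V : nmodType).

Lemma fsum_seq (r : seq I) (F : I -> V) : uniq r ->
  (forall i, i \notin r -> F i = 0) ->
  \sum_(i \in [set: I]) F i = \sum_(i <- r) F i.
Proof.
move=> ur h; rewrite (fsbigE r F ur) //; last by move=> i _; apply: h.
by apply: eq_bigl => i; apply: in_setT.
Qed.

Lemma fsum_one (i0 : I) (F : I -> V) : (forall i, i != i0 -> F i = 0) ->
  \sum_(i \in [set: I]) F i = F i0.
Proof.
by move=> h; rewrite (@fsum_seq [:: i0]) ?big_seq1 // => i; rewrite inE; apply: h.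
Qed.

End FiniteSums.

Lemma finite_set_seq (I : choiceType) (A : set I) : finite_set A ->
  exists2 r : seq I, uniq r & forall i, A i -> i \in r.
Proof.
move=> /finite_seqP [s ->]; exists (undup s); first exact: undup_uniq.
by move=> i; rewrite mem_undup.
Qed.

Lemma fsum_nat (V : nmodType) N (F : nat -> V) : (forall i, (N <= i)%N -> F i = 0) ->
  \sum_(i \in [set: nat]) F i = \sum_(i < N) F i.
Proof.
move=> h; rewrite (@fsum_seq _ _ (index_iota 0 N) F) ?iota_uniq ?big_mkord // => i.
by rewrite mem_index_iota -leqNgt; apply: h.
Qed.

Section Tensor.
Variables (K : fieldType) (V W : lmodType K).
Local Notation "x ⊗ a" := (@tens K V W x a) (at level 40).

Lemma tens_linl a : linear (fun x : V => x ⊗ a).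
Proof.
move=> c x y; rewrite /tens -qproj_lin; apply/qproj_eq/lin_span_gen.
by left; exists c, x, y, a; rewrite opprD addrA.
Qed.

Lemma tens_linr x : linear (fun a : W => x ⊗ a).
Proof.
move=> c a b; rewrite /tens -qproj_lin; apply/qproj_eq/lin_span_gen.
by right; exists c, x, a, b; rewrite opprD addrA.
Qed.

Lemma tens_ind (P : tensor V W -> Prop) : (forall u v, P u -> P v -> P (u + v)) ->
  (forall x a, P (x ⊗ a)) -> forall u, P u.
Proof.
move=> PD Pt u; rewrite -(qreprK u); move: (qrepr u) => D.
elim/freeg_ind_dom0: D => [|k p D _ _ IH].
  suff -> : qproj (tensor_rel (V:=V) (W:=W)) 0 = 0 ⊗ 0 by apply: Pt.
  by rewrite (lin0 (qproj_lin _)) (lin0 (tens_linl _)).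
rewrite (linD (qproj_lin _)); apply: PD => //.
suff -> : << k *g p >> = k *: << (p.1, p.2) >> :> {freeg (V * W) / K}.
  by rewrite (linZ (qproj_lin _)) -[k *: _](linZ (tens_linl p.2)); apply: Pt.
case: p => x y; apply/eqP/freeg_eqP=> q.
by rewrite coeffZ !coeffU mul1r.
Qed.

Lemma lin_tens_ext (U : lmodType K) (F G : tensor V W -> U) : linear F -> linear G ->
  (forall x a, F (x ⊗ a) = G (x ⊗ a)) -> forall u, F u = G u.
Proof.
move=> lF lG h; apply: tens_ind => [u v IH IH'|//].
by rewrite (linD lF) (linD lG) IH IH'.
Qed.

Definition bilin (U : lmodType K) (f : V -> W -> U) :=
  (forall y, linear (f^~ y)) /\ (forall x, linear (f x)).

Lemma tliftE (U : lmodType K) (f : V -> W -> U) x a : bilin f -> tlift f (x ⊗ a) = f x a.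
Proof. by case=> ? ?; apply: tlift_tens. Qed.

Lemma tlift_lin (U : lmodType K) (f : V -> W -> U) : bilin f -> linear (tlift f).
Proof.
move=> bf; case: (bf) => fl fr.
have tD u v : tlift f (u + v) = tlift f u + tlift f v.
  rewrite -(qreprK u) -(qreprK v) -(linD (qproj_lin _)) !tlift_qproj //.
  move: (qrepr u) (qrepr v) => D E; set F := fglift _.
  have FB : {morph F : x y / x - y} by move=> x y; apply: lift_is_additive.
  have F0 : F 0 = 0 by rewrite -(subrr 0) FB subrr.
  by rewrite -[E in LHS]opprK FB -[- E]sub0r FB F0 sub0r opprK.
have tZ c u : tlift f (c *: u) = c *: tlift f u.
  elim/tens_ind: u => [u v IH IH'|x a]; first by rewrite scalerDr !tD scalerDr IH IH'.
  by rewrite -[c *: _](linZ (tens_linl a)) !tliftE // (linZ (fl a)).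
by move=> c u v; rewrite tD tZ.
Qed.

Lemma tlift_linf (U : lmodType K) (f g h : V -> W -> U) c : bilin f -> bilin g -> bilin h ->
  (forall x a, f x a = c *: g x a + h x a) ->
  forall u, tlift f u = c *: tlift g u + tlift h u.
Proof.
move=> bf bg bh e; apply: tens_ind => [u v IH IH'|x a].
  by rewrite !(linD (tlift_lin _)) // IH IH' scalerDr addrACA.
by rewrite !tliftE.
Qed.

End Tensor.

Section TensMap.
Variables (K : fieldType).

Definition tmap (V V' W W' : lmodType K) (g : V -> V') (f : W -> W') :
    tensor V W -> tensor V' W' := tlift (fun x a => tens (g x) (f a)).

Lemma tmap_bilin (V V' W W' : lmodType K) (g : V -> V') (f : W -> W') :
  linear g -> linear f -> bilin (fun x a => tens (g x) (f a)).
Proof.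
move=> lg lf; split=> [a|x].
  exact: (lin_comp (tens_linl (f a)) lg).
exact: (lin_comp (@tens_linr _ _ _ (g x)) lf).
Qed.

Variables (V V' W W' : lmodType K) (g : V -> V') (f : W -> W').
Hypotheses (lg : linear g) (lf : linear f).

Lemma tmapE x a : tmap g f (tens x a) = tens (g x) (f a).
Proof. exact/tliftE/tmap_bilin. Qed.

Lemma tmap_lin : linear (tmap g f).
Proof. exact/tlift_lin/tmap_bilin. Qed.

Definition tint_bilin (la : W -> K) (ll : linear (la : W -> K^o)) :
  bilin (fun (x : V) (a : W) => la a *: x).
Proof.
split=> [a c x y|x c a b]; first by rewrite scalerDr !scalerA [c * _]mulrC.
by rewrite ll scalerDl scalerA.
Qed.

(** The map id ⊗ la, with values in V ⊗ K = V. With an integral for la it reads off the coordinates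
    of a form with coefficients in V. *)
Definition tint (la : W -> K) : tensor V W -> V := tlift (fun x a => la a *: x).

Lemma tintE la x a : linear (la : W -> K^o) -> tint la (tens x a) = la a *: x.
Proof. by move=> ll; exact/tliftE/tint_bilin. Qed.

Lemma tint_lin la : linear (la : W -> K^o) -> linear (tint la).
Proof. by move=> ll; exact/tlift_lin/tint_bilin. Qed.

End TensMap.

Lemma lin_id (K : pzRingType) (V : lmodType K) : linear (fun x : V => x).
Proof. by []. Qed.

Section LieLemmas.
Variables (K : fieldType) (L : dgLieData K).
Hypothesis hL : isDgLie L.
Implicit Types x y : L.

Lemma lie_ind (P : L -> Prop) : (forall x y, P x -> P y -> P (x + y)) ->
  (forall i x, lie_comp i x = x -> P x) -> forall x, P x.
Proof.
move=> PD Ph x; rewrite -(lie_comp_sum hL x); apply: (big_ind P) => //.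
  by apply: (Ph 0); rewrite (lin0 (lie_comp_lin hL _)).
by move=> i _; apply: (Ph i); rewrite (lie_comp_comp hL) eqxx.
Qed.

Lemma lie_comp_homog i j x : lie_comp i x = x -> lie_comp j x = if j == i then x else 0.
Proof. by move=> <-; rewrite (lie_comp_comp hL). Qed.

Lemma lie_finsupp x y : exists2 r : seq int, uniq r &
  forall i, i \notin r -> lie_comp i x = 0 /\ lie_comp i y = 0.
Proof.
have [r ur hr] := finite_set_seq (lie_comp_fin hL x).
have [s us hs] := finite_set_seq (lie_comp_fin hL y).
exists (undup (r ++ s)); first exact: undup_uniq.
move=> i; rewrite mem_undup mem_cat negb_or => /andP[ir it].
by split; apply/eqP; [apply: contraNT ir|apply: contraNT it] => h; [apply: hr|apply: hs].
Qed.

(** The sign (-1)^(z |x|) as a linear operator. With it the differential of g ⊗ A is δ ⊗ 1 + twist ⊗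
    d, and the bracket of x ⊗ a and y ⊗ b is [x, twist y] ⊗ ab for homogeneous a, where y need not
    be homogeneous. *)
Definition twist (z : int) x : L := \sum_(j \in [set: int]) (-1) ^ (z * j) *: lie_comp j x.

Lemma twist_lin z : linear (twist z).
Proof.
move=> c x y; have [r ur hr] := lie_finsupp x y.
rewrite /twist !(@fsum_seq _ _ r) //.
- rewrite scaler_sumr -big_split; apply: eq_bigr => i _ /=.
  by rewrite (lie_comp_lin hL) scalerDr !scalerA mulrC.
- by move=> i /hr [_ ->]; rewrite scaler0.
- by move=> i /hr [-> _]; rewrite scaler0.
- by move=> i /hr [hx hy]; rewrite (lie_comp_lin hL) hx hy !scaler0 addr0 scaler0.
Qed.

Lemma twist_homog z j x : lie_comp j x = x -> twist z x = (-1) ^ (z * j) *: x.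
Proof.
move=> xj; rewrite /twist (@fsum_one _ _ j) ?xj // => i ij.
by rewrite (lie_comp_homog _ xj) (negPf ij) scaler0.
Qed.

Lemma twist_br z x y : twist z (lie_br x y) = lie_br (twist z x) (twist z y).
Proof.
elim/lie_ind: x => [x x' IH IH'|i x xi].
  by rewrite !(linD (lie_br_linl hL _), linD (twist_lin _)) IH IH'.
elim/lie_ind: y => [y y' IH IH'|j y yj].
  by rewrite !(linD (lie_br_linr hL _), linD (twist_lin _)) IH IH'.
rewrite (twist_homog z (lie_br_deg hL xi yj)) (twist_homog z xi) (twist_homog z yj).
rewrite (linZ (lie_br_linl hL _)) (linZ (lie_br_linr hL _)) !scaler_signz !oddzE.
by case: (oddz z); case: (oddz i); case: (oddz j); rewrite /= ?opprK.
Qed.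

Lemma twistK z x : twist z (twist z x) = x.
Proof.
elim/lie_ind: x => [x x' IH IH'|i x xi].
  by rewrite !(linD (twist_lin _)) IH IH'.
rewrite (twist_homog z xi) (linZ (twist_lin _)) (twist_homog z xi) !scaler_signz.
by case: oddz; rewrite ?opprK.
Qed.

Lemma twist_diff x : twist 1 (lie_diff x) = - lie_diff (twist 1 x).
Proof.
elim/lie_ind: x => [x x' IH IH'|i x xi].
  by rewrite !(linD (lie_diff_lin hL), linD (twist_lin _)) IH IH' opprD.
rewrite (twist_homog 1 xi) (twist_homog 1 (lie_diff_deg hL xi)) (linZ (lie_diff_lin hL)).
by rewrite !scaler_signz !oddzE; case: oddz; rewrite ?opprK.
Qed.

End LieLemmas.

Lemma lin_add (K : pzRingType) (U V : lmodType K) (f g : U -> V) :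
  linear f -> linear g -> linear (fun x => f x + g x).
Proof. by move=> lf lg c x y; rewrite lf lg scalerDr addrACA. Qed.

Lemma lin_bigsum (K : pzRingType) (U V : lmodType K) I (r : seq I) (f : I -> U -> V) :
  (forall i, linear (f i)) -> linear (fun x => \sum_(i <- r) f i x).
Proof.
move=> lf c x y; rewrite scaler_sumr -big_split; apply: eq_bigr => i _.
by rewrite lf.
Qed.

Lemma lin_scale (K : comPzRingType) (U V : lmodType K) (f : U -> V) k :
  linear f -> linear (fun x => k *: f x).
Proof. by move=> lf c x y; rewrite lf scalerDr !scalerA mulrC. Qed.

Section TensorDgLie.
Variables (K : fieldType) (L : dgLieData K) (A : dgaData K) (N : nat).
Hypotheses (hL : isDgLie L) (cA : isCdga A N).
Local Notation T := (tensor L A).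
Local Notation "x ⊗ a" := (@tens K L A x a) (at level 40).
Implicit Types (x y z : L) (a b c : A) (u v w : T).
Local Notation hom i x := (lie_comp i x = x).
Local Notation deg i a := (dga_comp i a = a).

Lemma tens_hom_ind (P : T -> Prop) : (forall u v, P u -> P v -> P (u + v)) ->
  (forall i j x a, hom i x -> deg j a -> P (x ⊗ a)) -> forall u, P u.
Proof.
move=> PD Ph; apply: tens_ind => // x a; elim/(lie_ind hL): x => [x y IH IH'|i x xi].
  by rewrite (linD (tens_linl a)); apply: PD.
elim/(cdga_ind cA): a => [a b IH IH'|j a aj]; last exact: (Ph i j).
by rewrite (linD (tens_linr x)); apply: PD.
Qed.

Let tcomp p x a := \sum_(i < N) lie_comp (p - i%:Z) x ⊗ dga_comp i a.

Lemma tens_compE p : @tens_comp K L A p = tlift (tcomp p).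
Proof.
apply: funext => u; congr (tlift _ _); apply: funext => x; apply: funext => a.
apply: fsum_nat => i Ni; rewrite (cdga_comp_bound cA a Ni).
exact: (lin0 (tens_linr _)).
Qed.

Lemma tcomp_bilin p : bilin (tcomp p).
Proof.
split=> [a|x]; apply: lin_bigsum => i.
  exact: (lin_comp (tens_linl _) (lie_comp_lin hL _)).
exact: (lin_comp (@tens_linr _ _ _ _) (cdga_comp_lin cA _)).
Qed.

Lemma tens_comp_lin p : linear (@tens_comp K L A p).
Proof. by rewrite tens_compE; apply/tlift_lin/tcomp_bilin. Qed.

Lemma cdga_deg_bound i a : deg i a -> (N <= i)%N -> a = 0.
Proof. by move=> <- Ni; apply: (cdga_comp_bound cA). Qed.

Lemma tens_comp_pure n p i x a : hom p x -> deg i a ->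
  tens_comp n (x ⊗ a) = if n == p + i%:Z then x ⊗ a else 0.
Proof.
move=> xp ai; rewrite tens_compE (tliftE _ _ (tcomp_bilin n)) /tcomp.
have [iN|Ni] := ltnP i N; last first.
  rewrite (cdga_deg_bound ai Ni) (lin0 (tens_linr x)) if_same big1 // => j _.
  by rewrite (lin0 (cdga_comp_lin cA _)) (lin0 (tens_linr _)).
rewrite (bigD1 (Ordinal iN)) //= big1 => [|j ji]; last first.
  move: ji; rewrite -val_eqE /= (cdga_comp_homog cA _ ai) => /negPf ->.
  exact: (lin0 (tens_linr _)).
rewrite addr0 ai (lie_comp_homog hL _ xp) subr_eq.
by case: ifP => // _; exact: (lin0 (tens_linl _)).
Qed.

(** The projection onto degree r sends a homogeneous pure tensor to itself or to 0, so an element of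
    degree r is a sum of homogeneous pure tensors of degree r. *)
Lemma tens_deg_ind r (P : T -> Prop) : P 0 -> (forall u v, P u -> P v -> P (u + v)) ->
  (forall i j x a, hom i x -> deg j a -> i + j%:Z = r -> P (x ⊗ a)) ->
  forall u, tens_comp r u = u -> P u.
Proof.
move=> P0 PD Ph u <-; elim/tens_hom_ind: u => [u v IH IH'|i j x a xi aj].
  by rewrite (linD (tens_comp_lin r)); apply: PD.
rewrite (tens_comp_pure r xi aj); case: eqP => // e.
exact: (Ph i j).
Qed.

Lemma tens_comp_comp i j u :
  tens_comp i (tens_comp j u) = if i == j then tens_comp j u else 0.
Proof.
elim/tens_hom_ind: u => [u v IH IH'|p k x a xp ak].
  rewrite !(linD (tens_comp_lin _)) IH IH'; case: ifP => // _; exact: addr0.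
rewrite !(tens_comp_pure _ xp ak); case: (altP (j =P _)) => [->|nj].
  by rewrite (tens_comp_pure _ xp ak); case: ifP.
by rewrite if_same (lin0 (tens_comp_lin _)).
Qed.

Lemma tens_comp_fin u : finite_set [set i | tens_comp i u != 0].
Proof.
elim/tens_hom_ind: u => [u v IH IH'|p k x a xp ak].
  apply: (@sub_finite_set _ _ (setU [set i | tens_comp i u != 0] [set i | tens_comp i v != 0])).
    move=> i /=; rewrite (linD (tens_comp_lin _)) => h.
    case: (eqVneq (tens_comp i u) 0) => [e|]; [right|by left].
    by move: h; rewrite e add0r.
  by rewrite finite_setU.
apply: (@sub_finite_set _ _ [set p + k%:Z]); last exact: finite_set1.
by move=> i /=; rewrite (tens_comp_pure _ xp ak); case: ifP => [/eqP -> //|_ /eqP].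
Qed.

Lemma tens_comp_sum u : \sum_(i \in [set: int]) tens_comp i u = u.
Proof.
elim/tens_hom_ind: u => [u v IH IH'|p k x a xp ak]; last first.
  rewrite (@fsum_one _ _ (p + k%:Z)) ?(tens_comp_pure _ xp ak) ?eqxx // => i.
  by rewrite (tens_comp_pure _ xp ak) => /negPf ->.
rewrite -[in RHS]IH -[in RHS]IH'.
have [r ur hr] := finite_set_seq (tens_comp_fin u).
have [s us hs] := finite_set_seq (tens_comp_fin v).
have ut : uniq (undup (r ++ s)) by apply: undup_uniq.
have hu i : i \notin undup (r ++ s) -> tens_comp i u = 0.
  rewrite mem_undup mem_cat negb_or => /andP[ir _].
  by apply/eqP; apply: contraNT ir => h; apply: hr.
have hv i : i \notin undup (r ++ s) -> tens_comp i v = 0.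
  rewrite mem_undup mem_cat negb_or => /andP[_ it].
  by apply/eqP; apply: contraNT it => h; apply: hs.
rewrite (fsum_seq ut hu) (fsum_seq ut hv) (fsum_seq ut) => [|i it].
  by rewrite -big_split; apply: eq_bigr => i _; rewrite (linD (tens_comp_lin _)).
by rewrite (linD (tens_comp_lin _)) hu // hv // addr0.
Qed.

(** The differential of g ⊗ A splits into two anticommuting ones, [tdL] from g and [tdA] from A. A
    gauge contracts the second and, with its Koszul sign, anticommutes with the first. *)
Definition tdL : T -> T := tmap lie_diff (fun a => a).
Definition tdA : T -> T := tmap (twist 1) dga_diff.

Lemma tdL_lin : linear tdL.
Proof. exact: (tmap_lin (lie_diff_lin hL) (@lin_id _ _)). Qed.

Lemma tdA_lin : linear tdA.
Proof. exact: (tmap_lin (twist_lin hL 1) (cdga_diff_lin cA)). Qed.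

Lemma tdLE x a : tdL (x ⊗ a) = lie_diff x ⊗ a.
Proof. exact: (tmapE (lie_diff_lin hL) (@lin_id _ _)). Qed.

Lemma tdAE x a : tdA (x ⊗ a) = twist 1 x ⊗ dga_diff a.
Proof. exact: (tmapE (twist_lin hL 1) (cdga_diff_lin cA)). Qed.

Lemma tdA_pure p x a : hom p x -> tdA (x ⊗ a) = (-1) ^ p *: (x ⊗ dga_diff a).
Proof. by move=> xp; rewrite tdAE (twist_homog hL 1 xp) mul1r (linZ (tens_linl _)). Qed.

Lemma tens_diffE u : tens_diff u = tdL u + tdA u.
Proof.
have e : @tens_diff K L A =
    tlift (fun x a => lie_diff x ⊗ a + twist 1 x ⊗ dga_diff a).
  apply: funext => v; congr (tlift _ v); apply: funext => x; apply: funext => a.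
  congr (_ + _); have [r ur hr] := finite_set_seq (lie_comp_fin hL x).
  have hr' i : i \notin r -> lie_comp i x = 0.
    by move=> ir; apply/eqP; apply: contraNT ir => h; apply: hr.
  rewrite /twist !(@fsum_seq _ _ r) ?(lin_sum (tens_linl _)) //.
  - by apply: eq_bigr => i _; rewrite mul1r (linZ (tens_linl _)).
  - by move=> i /hr' ->; rewrite scaler0.
  - by move=> i /hr' ->; rewrite (lin0 (tens_linl _)) scaler0.
rewrite e; have b1 := tmap_bilin (lie_diff_lin hL) (@lin_id _ A).
have b2 := tmap_bilin (twist_lin hL 1) (cdga_diff_lin cA).
rewrite -[tdL u]scale1r; apply: (tlift_linf _ b1 b2) => [|x a]; last by rewrite scale1r.
split=> [a|x]; apply: lin_add; [exact: b1.1|exact: b2.1|exact: b1.2|exact: b2.2].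
Qed.

Let tbr x a y b := \sum_(i < N) lie_br x (twist i%:Z y) ⊗ dga_mul (dga_comp i a) b.

Lemma tbr_bilin x a : bilin (tbr x a).
Proof.
split=> [b|y]; apply: lin_bigsum => i.
  exact: (lin_comp (tens_linl _) (lin_comp (lie_br_linr hL _) (twist_lin hL _))).
exact: (lin_comp (@tens_linr _ _ _ _) (cdga_mul_linr cA _)).
Qed.

Lemma tbr_bilin2 v : bilin (fun x a => tlift (tbr x a) v).
Proof.
split=> [a|x] c p q; apply: tlift_linf => [||| y b]; try exact: tbr_bilin.
  rewrite /tbr scaler_sumr -big_split; apply: eq_bigr => i _ /=.
  by rewrite (lie_br_linl hL) tens_linl.
rewrite /tbr scaler_sumr -big_split; apply: eq_bigr => i _ /=.
by rewrite (cdga_comp_lin cA) (cdga_mul_linl cA) tens_linr.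
Qed.

Lemma tens_brE u v : tens_br u v = tlift (fun x a => tlift (tbr x a) v) u.
Proof.
congr (tlift _ _); apply: funext => x; apply: funext => a.
congr (tlift _ _); apply: funext => y; apply: funext => b.
have [r ur hr] := finite_set_seq (lie_comp_fin hL y).
have hr' i : i \notin r -> lie_comp i y = 0.
  by move=> ir; apply/eqP; apply: contraNT ir => h; apply: hr.
have e i : \sum_(j \in [set: int]) (-1) ^ (i%:Z * j) *:
    (lie_br x (lie_comp j y) ⊗ dga_mul (dga_comp i a) b) =
    lie_br x (twist i%:Z y) ⊗ dga_mul (dga_comp i a) b.
  rewrite /twist !(@fsum_seq _ _ r) //.
  - rewrite (lin_sum (lie_br_linr hL _)) (lin_sum (tens_linl _)).
    by apply: eq_bigr => j _; rewrite (linZ (lie_br_linr hL _)) (linZ (tens_linl _)).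
  - by move=> j /hr' ->; rewrite scaler0.
  - by move=> j /hr' ->; rewrite (lin0 (lie_br_linr hL _)) (lin0 (tens_linl _)) scaler0.
rewrite (fsum_nat (N := N)) => [|i Ni]; first by apply: eq_bigr => i _; rewrite e.
rewrite e (cdga_comp_bound cA _ Ni) (lin0 (cdga_mul_linl cA _)).
exact: (lin0 (tens_linr _)).
Qed.

Lemma tens_br_linl v : linear (fun u => tens_br u v).
Proof.
move=> c u w; rewrite !tens_brE; exact: (tlift_lin (tbr_bilin2 v)).
Qed.

Lemma tens_br_linr u : linear (tens_br u).
Proof.
move=> c v w; elim/tens_ind: u => [u u' IH IH'|x a].
  by rewrite !(linD (tens_br_linl _)) IH IH' scalerDr addrACA.
by rewrite !tens_brE !(tliftE _ _ (tbr_bilin2 _)) (tlift_lin (tbr_bilin x a)).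
Qed.

Lemma tens_br_pure i q x a y b : deg i a -> hom q y ->
  tens_br (x ⊗ a) (y ⊗ b) = (-1) ^ (i%:Z * q) *: (lie_br x y ⊗ dga_mul a b).
Proof.
move=> ai yq; rewrite tens_brE (tliftE _ _ (tbr_bilin2 _)) (tliftE _ _ (tbr_bilin _ _)) /tbr.
have [iN|Ni] := ltnP i N; last first.
  rewrite (cdga_deg_bound ai Ni) (lin0 (cdga_mul_linl cA _)) (lin0 (tens_linr _)) scaler0.
  apply: big1 => j _.
  by rewrite (lin0 (cdga_comp_lin cA _)) (lin0 (cdga_mul_linl cA _)) (lin0 (tens_linr _)).
rewrite (bigD1 (Ordinal iN)) //= big1 => [|j ji]; last first.
  move: ji; rewrite -val_eqE /= (cdga_comp_homog cA _ ai) => /negPf ->.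
  rewrite (lin0 (cdga_mul_linl cA _)).
  exact: (lin0 (tens_linr _)).
rewrite addr0 ai (twist_homog hL _ yq) (linZ (lie_br_linr hL _)).
by rewrite (linZ (tens_linl _)).
Qed.

Lemma tens_br_deg p q u v : tens_comp p u = u -> tens_comp q v = v ->
  tens_comp (p + q) (tens_br u v) = tens_br u v.
Proof.
move: u; apply: (tens_deg_ind (r := p)) => [|u u' IH IH' vq|i j x a xi aj <-].
- by move=> _; rewrite (lin0 (tens_br_linl _)) (lin0 (tens_comp_lin _)).
- by rewrite (linD (tens_br_linl _)) (linD (tens_comp_lin _)) IH // IH'.
move: v; apply: (tens_deg_ind (r := q)) => [|v v' IH IH'|k l y b yk bl <-].
- by rewrite (lin0 (tens_br_linr _)) (lin0 (tens_comp_lin _)).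
- by rewrite (linD (tens_br_linr _)) (linD (tens_comp_lin _)) IH // IH'.
rewrite (tens_br_pure _ _ aj yk) (linZ (tens_comp_lin _)); congr (_ *: _).
rewrite (tens_comp_pure _ (lie_br_deg hL xi yk) (cdga_mul_homog cA aj bl)).
by rewrite PoszD addrACA eqxx.
Qed.

Lemma tens_br_antisym p q u v : tens_comp p u = u -> tens_comp q v = v ->
  tens_br u v = - ((-1 : K) ^ (p * q) *: tens_br v u).
Proof.
move: u; apply: (tens_deg_ind (r := p)) => [|u u' IH IH' vq|i j x a xi aj <-].
- by move=> _; rewrite (lin0 (tens_br_linl _)) (lin0 (tens_br_linr _)) scaler0 oppr0.
- by rewrite (linD (tens_br_linl _)) (linD (tens_br_linr _)) scalerDr opprD IH // IH'.
move: v; apply: (tens_deg_ind (r := q)) => [|v v' IH IH'|k l y b yk bl <-].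
- by rewrite (lin0 (tens_br_linl _)) (lin0 (tens_br_linr _)) scaler0 oppr0.
- by rewrite (linD (tens_br_linl _)) (linD (tens_br_linr _)) scalerDr opprD IH // IH'.
rewrite (tens_br_pure _ _ aj yk) (tens_br_pure _ _ bl xi).
rewrite (lie_br_antisym hL xi yk) (cdga_mulC_homog cA aj bl) (linN (tens_linl _)).
rewrite (linZ (tens_linl _)) (linZ (tens_linr _)).
move: (_ ⊗ _) => t; rewrite !scaler_signz scaler_signn !oddzE.
by case: (oddz i); case: (odd j); case: (oddz k); case: (odd l); rewrite /= ?opprK.
Qed.

(** On homogeneous pure tensors everything is a multiple of [[x, y], z] ⊗ abc or of [y, [x, z]] ⊗
    abc; only the signs remain to be compared. *)
Lemma tens_jacobi p q u v w : tens_comp p u = u -> tens_comp q v = v ->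
  tens_br u (tens_br v w) =
  tens_br (tens_br u v) w + (-1 : K) ^ (p * q) *: tens_br v (tens_br u w).
Proof.
move: u; apply: (tens_deg_ind (r := p)) => [|u u' IH IH' vq|i j x a xi aj <-].
- move=> _; rewrite !(lin0 (tens_br_linl _), lin0 (tens_br_linr _)) scaler0 addr0 //.
- rewrite !(linD (tens_br_linl _)) !(linD (tens_br_linr _)) scalerDr IH // IH' //.
  by rewrite addrACA.
move: v; apply: (tens_deg_ind (r := q)) => [|v v' IH IH'|k l y b yk bl <-].
- by rewrite !(lin0 (tens_br_linl _), lin0 (tens_br_linr _)) scaler0 addr0.
- rewrite !(linD (tens_br_linl _), linD (tens_br_linr _)) scalerDr IH // IH' //.
  by rewrite addrACA.
elim/tens_hom_ind: w => [w w' IH IH'|m n z c zm cn].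
  by rewrite !(linD (tens_br_linr _)) IH IH' scalerDr addrACA.
rewrite (tens_br_pure _ _ bl zm) (tens_br_pure _ _ aj yk) (tens_br_pure _ _ aj zm).
rewrite !(linZ (tens_br_linr _)) (linZ (tens_br_linl _)).
rewrite (tens_br_pure _ _ aj (lie_br_deg hL yk zm)).
rewrite (tens_br_pure _ _ bl (lie_br_deg hL xi zm)).
rewrite (tens_br_pure _ _ (cdga_mul_homog cA aj bl) zm).
rewrite (lie_jacobi hL z xi yk) (linD (tens_linl _)) (linZ (tens_linl _)).
rewrite (cdga_mulA cA b a c) (cdga_mulC_homog cA bl aj) (linZ (cdga_mul_linl cA _)).
rewrite (linZ (tens_linr _)) (cdga_mulA cA).
move: (_ ⊗ _) (_ ⊗ _) => t t'; rewrite PoszD !scaler_signz !scaler_signn !oddzE.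
by case: (oddz i); case: (odd j); case: (oddz k); case: (odd l); case: (oddz m);
  rewrite /= ?opprK ?opprD ?opprK.
Qed.

Lemma tdA_leibniz p u v : tens_comp p u = u ->
  tdA (tens_br u v) = tens_br (tdA u) v + (-1) ^ p *: tens_br u (tdA v).
Proof.
move: u; apply: (tens_deg_ind (r := p)) => [|u u' IH IH'|i j x a xi aj <-].
- by rewrite !(lin0 (tens_br_linl _), lin0 tdA_lin) scaler0 addr0.
- by rewrite !(linD (tens_br_linl _), linD tdA_lin) scalerDr IH IH' addrACA.
elim/tens_hom_ind: v => [v v' IH IH'|k l y b yk bl].
  by rewrite !(linD (tens_br_linr _), linD tdA_lin) scalerDr IH IH' addrACA.
rewrite (tens_br_pure _ _ aj yk) (linZ tdA_lin) (tdA_pure _ (lie_br_deg hL xi yk)).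
rewrite (tdA_pure _ xi) (tdA_pure _ yk) (linZ (tens_br_linl _)) (linZ (tens_br_linr _)).
rewrite (tens_br_pure _ _ (cdga_diff_homog cA aj) yk) (tens_br_pure _ _ aj yk).
rewrite (cdga_leibniz_homog cA _ aj) (linD (tens_linr _)) (linZ (tens_linr _)).
move: (_ ⊗ _) (_ ⊗ _) => t t'; rewrite intS !scaler_signz !scaler_signn !oddzE.
by case: (oddz i); case: (odd j); case: (oddz k); rewrite /= ?opprK ?opprD ?opprK.
Qed.

Lemma tdL_leibniz p u v : tens_comp p u = u ->
  tdL (tens_br u v) = tens_br (tdL u) v + (-1) ^ p *: tens_br u (tdL v).
Proof.
move: u; apply: (tens_deg_ind (r := p)) => [|u u' IH IH'|i j x a xi aj <-].
- by rewrite !(lin0 (tens_br_linl _), lin0 tdL_lin) scaler0 addr0.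
- by rewrite !(linD (tens_br_linl _), linD tdL_lin) scalerDr IH IH' addrACA.
elim/tens_hom_ind: v => [v v' IH IH'|k l y b yk bl].
  by rewrite !(linD (tens_br_linr _), linD tdL_lin) scalerDr IH IH' addrACA.
rewrite (tens_br_pure _ _ aj yk) (linZ tdL_lin) !tdLE.
rewrite (tens_br_pure _ _ aj yk) (tens_br_pure _ _ aj (lie_diff_deg hL yk)).
rewrite (lie_leibniz hL _ xi) (linD (tens_linl _)) (linZ (tens_linl _)).
move: (_ ⊗ _) (_ ⊗ _) => t t'; rewrite !scaler_signz !oddzE.
by case: (oddz i); case: (odd j); case: (oddz k); rewrite /= ?opprK ?opprD ?opprK.
Qed.

Lemma tdL_deg p u : tens_comp p u = u -> tens_comp (p + 1) (tdL u) = tdL u.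
Proof.
move: u; apply: (tens_deg_ind (r := p)) => [|u u' IH IH'|i j x a xi aj <-].
- by rewrite (lin0 tdL_lin) (lin0 (tens_comp_lin _)).
- by rewrite (linD tdL_lin) (linD (tens_comp_lin _)) IH IH'.
by rewrite tdLE (tens_comp_pure _ (lie_diff_deg hL xi) aj) addrAC eqxx.
Qed.

Lemma tdA_deg p u : tens_comp p u = u -> tens_comp (p + 1) (tdA u) = tdA u.
Proof.
move: u; apply: (tens_deg_ind (r := p)) => [|u u' IH IH'|i j x a xi aj <-].
- by rewrite (lin0 tdA_lin) (lin0 (tens_comp_lin _)).
- by rewrite (linD tdA_lin) (linD (tens_comp_lin _)) IH IH'.
rewrite (tdA_pure _ xi) (linZ (tens_comp_lin _)).
by rewrite (tens_comp_pure _ xi (cdga_diff_homog cA aj)) -addrA -[j.+1]addn1 PoszD eqxx.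
Qed.

Lemma tdA_tdL u : tdA (tdL u) = - tdL (tdA u).
Proof.
elim/tens_ind: u => [u v IH IH'|x a].
  by rewrite !(linD tdA_lin, linD tdL_lin) IH IH' opprD.
by rewrite tdLE !tdAE tdLE (twist_diff hL) (linN (tens_linl _)).
Qed.

Lemma tdA2 u : tdA (tdA u) = 0.
Proof.
elim/tens_ind: u => [u v IH IH'|x a]; first by rewrite !(linD tdA_lin) IH IH' addr0.
by rewrite !tdAE (cdga_diff2 cA) (lin0 (tens_linr _)).
Qed.

Lemma tdL2 u : tdL (tdL u) = 0.
Proof.
elim/tens_ind: u => [u v IH IH'|x a]; first by rewrite !(linD tdL_lin) IH IH' addr0.
by rewrite !tdLE (lie_diff2 hL) (lin0 (tens_linl _)).
Qed.

Lemma tensLie_isDgLie : isDgLie (tensLie L A).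
Proof.
split.
- exact: tens_comp_lin.
- exact: tens_comp_comp.
- exact: tens_comp_fin.
- exact: tens_comp_sum.
- by move=> c u v; rewrite /= !tens_diffE tdL_lin tdA_lin scalerDr addrACA.
- move=> i u ui; rewrite /lie_homog /= tens_diffE (linD (tens_comp_lin _)).
  by rewrite tdL_deg // tdA_deg.
- move=> u; rewrite /= !tens_diffE (linD tdL_lin) (linD tdA_lin) tdL2 tdA2 tdA_tdL.
  by rewrite add0r addr0 subrr.
- exact: tens_br_linl.
- exact: tens_br_linr.
- exact: tens_br_deg.
- exact: tens_br_antisym.
- by move=> i j u v w ui vj; apply: tens_jacobi.
- move=> i u v ui; rewrite /= !tens_diffE (tdL_leibniz _ ui) (tdA_leibniz _ ui).
  by rewrite (linD (tens_br_linl _)) (linD (tens_br_linr _)) scalerDr addrACA.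
Qed.

End TensorDgLie.

(** * Fixed points of maps that contract a finite filtration *)

Section Filtration.
Variables (V : zmodType) (Fil : nat -> V -> Prop).
Hypotheses (Fil_all : forall v, Fil 0 v).
Hypotheses (Fil_nil : exists k, forall v, Fil k v -> v = 0).

Lemma fil_zero v : (forall k, Fil k v -> Fil k.+1 v) -> v = 0.
Proof.
move=> h; case: Fil_nil => k hk; apply: hk; elim: k => [|k]; first exact: Fil_all.
exact: h.
Qed.

Variable Phi : V -> V.
Hypothesis Phi_contr : forall k u v, Fil k (u - v) -> Fil k.+1 (Phi u - Phi v).

Lemma fix_unique u v : u = Phi u -> v = Phi v -> u = v.
Proof.
move=> eu ev; apply/eqP; rewrite -subr_eq0; apply/eqP/fil_zero => k h.
by rewrite eu ev; apply: Phi_contr.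
Qed.

(** Successive iterates of 0 differ by an element of ever deeper filtration, so the iteration
    becomes stationary. Q carries the linear constraints, such as degrees, through it. *)
Lemma fix_exists (Q : V -> Prop) : Q 0 -> (forall u, Q u -> Q (Phi u)) ->
  exists2 u, u = Phi u & Q u.
Proof.
move=> Q0 QS; case: Fil_nil => k hk; exists (iter k Phi 0); last first.
  by elim: k {hk} => //= k; apply: QS.
apply/esym/eqP; rewrite -subr_eq0; apply/eqP/hk; rewrite -iterS.
by elim: k {hk} => [|k IH] /=; [apply: Fil_all | apply: Phi_contr].
Qed.

End Filtration.

(** * The lower central series and the filtration it induces on g ⊗ A *)

Section LowerCentral.
Variables (K : fieldType) (L : dgLieData K).
Hypothesis hL : isDgLie L.
Local Notation LC := (@lower_central K L).
Implicit Types x y : L.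

Lemma LC_lin k c x y : LC k x -> LC k y -> LC k (c *: x + y).
Proof. case: k => [//|k]; exact: lin_span_lin. Qed.

Lemma LC0 k : LC k (0 : L).
Proof. case: k => [//|k]; exact: lin_span0. Qed.

Lemma LCD k x y : LC k x -> LC k y -> LC k (x + y).
Proof. by move=> hx; rewrite -[x]scale1r; apply: LC_lin. Qed.

Lemma LCZ k c x : LC k x -> LC k (c *: x).
Proof. by move=> hx; rewrite -[_ *: _]addr0; apply: LC_lin (LC0 k). Qed.

Lemma LC_sum k I (r : seq I) (P : pred I) (F : I -> L) :
  (forall i, LC k (F i)) -> LC k (\sum_(i <- r | P i) F i).
Proof. move=> h; apply: (big_ind (LC k)) => //; [exact: LC0 | exact: LCD]. Qed.

Lemma LC_brr k x y : LC k y -> LC k.+1 (lie_br x y).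
Proof. by move=> hy; apply: lin_span_gen; exists x, y. Qed.

Lemma lie_comp_br i j x y : lie_comp i x = x ->
  lie_comp j (lie_br x y) = lie_br x (lie_comp (j - i) y).
Proof.
move=> xi; elim/(lie_ind hL): y => [y y' IH IH'|l y yl].
  by rewrite !(linD (lie_br_linr hL _), linD (lie_comp_lin hL _)) IH IH'.
rewrite (lie_comp_homog hL _ (lie_br_deg hL xi yl)) (lie_comp_homog hL _ yl).
rewrite subr_eq [l + i]addrC; case: ifP => // _.
by rewrite (lin0 (lie_br_linr hL _)).
Qed.

Lemma LC_comp k i x : LC k x -> LC k (lie_comp i x).
Proof.
elim: k i x => [//|k IH] i x.
elim=> [|c {}x y [z [t [ht ->]]] _ IHy].
  by rewrite (lin0 (lie_comp_lin hL _)); apply: LC0.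
rewrite (lie_comp_lin hL); apply: (@LC_lin k.+1) => // {IHy y}.
elim/(lie_ind hL): z => [z z' IHz IHz'|j z zj].
  by rewrite (linD (lie_br_linl hL _)) (linD (lie_comp_lin hL _)); apply: (@LCD k.+1).
by rewrite (lie_comp_br _ _ zj); apply/LC_brr/IH.
Qed.

Lemma LC_twist k z x : LC k x -> LC k (twist z x).
Proof.
elim: k x => [//|k IH] x.
elim=> [|c {}x y [t [r [hr ->]]] _ IHy]; first by rewrite (lin0 (twist_lin hL _)); apply: LC0.
rewrite (twist_lin hL); apply: (@LC_lin k.+1) => //.
by rewrite (twist_br hL); apply/LC_brr/IH.
Qed.

(** The series is generated by brackets whose right entry lies in the previous step. Antisymmetry
    moves the left entry there, but it is available for homogeneous elements only; hence the appeal
    to the stability of each step under projection to components. *)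
Lemma LC_brl k x y : LC k x -> LC k.+1 (lie_br x y).
Proof.
move=> hx; elim/(lie_ind hL): y => [y y' IH IH'|j y yj].
  by rewrite (linD (lie_br_linr hL _)); apply: (@LCD k.+1).
have [r ur hr] := finite_set_seq (lie_comp_fin hL x).
have hr' i : i \notin r -> lie_comp i x = 0.
  by move=> ir; apply/eqP; apply: contraNT ir => h; apply: hr.
rewrite -(lie_comp_sum hL x) (fsum_seq ur hr') (lin_sum (lie_br_linl hL _)).
apply: (@LC_sum k.+1) => i.
have ci : lie_comp i (lie_comp i x) = lie_comp i x by rewrite (lie_comp_comp hL) eqxx.
rewrite (lie_br_antisym hL ci yj) -scaleN1r; apply: (@LCZ k.+1); apply: (@LCZ k.+1).
by apply/LC_brr/LC_comp.
Qed.

Section TensorFiltration.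
Variables (A : dgaData K) (N : nat).
Hypothesis cA : isCdga A N.
Local Notation T := (tensor L A).

(** The image of LC_k ⊗ A in g ⊗ A. It contains the lower central series of g ⊗ A and is visibly
    stable under operators on forms such as s and P. *)
Definition Fil k (u : T) := lin_span (fun v : T => exists x a, LC k x /\ v = tens x a) u.

Lemma Fil_all u : Fil 0 u.
Proof.
elim/tens_ind: u => [u v|x a]; first exact: lin_spanD.
by apply: lin_span_gen; exists x, a.
Qed.

Lemma Fil_nil k : (forall x, LC k x -> x = 0) -> forall u, Fil k u -> u = 0.
Proof.
move=> hk u; elim=> [//|c v w [x [a [hx ->]]] _ ->]; rewrite (hk _ hx).
by rewrite (lin0 (tens_linl _)) scaler0 addr0.
Qed.

Lemma Fil_pure k x a : LC k x -> Fil k (tens x a).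
Proof. by move=> hx; apply: lin_span_gen; exists x, a. Qed.

Lemma Fil_tint k (la : A -> K) u : linear (la : A -> K^o) -> Fil k u -> LC k (tint la u).
Proof.
move=> ll; elim=> [|c v w [x [a [hx ->]]] _ IH].
  by rewrite (lin0 (tint_lin ll)); apply: LC0.
by rewrite (tint_lin ll) (tintE _ _ ll); apply: LC_lin => //; apply: LCZ.
Qed.

Lemma tens_br_twist i (x : L) (a : A) (y : L) (b : A) : dga_comp i a = a ->
  tens_br (tens x a) (tens y b) = tens (lie_br x (twist i%:Z y)) (dga_mul a b).
Proof.
move=> ai; elim/(lie_ind hL): y => [y y' IH IH'|j y yj].
  rewrite (linD (tens_linl _)) (linD (tens_br_linr hL cA _)) IH IH'.
  by rewrite (linD (twist_lin hL _)) (linD (lie_br_linr hL _)) (linD (tens_linl _)).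
rewrite (tens_br_pure hL cA _ _ ai yj) (twist_homog hL _ yj).
by rewrite (linZ (lie_br_linr hL _)) (linZ (tens_linl _)).
Qed.

Lemma Fil_brr k (u v : T) : Fil k v -> Fil k.+1 (tens_br u v).
Proof.
elim/(tens_hom_ind hL cA): u v => [u u' IH IH'|i j x a xi aj] v hv.
  by rewrite (linD (tens_br_linl hL cA _)); apply: lin_spanD; [apply: IH|apply: IH'].
elim: hv => [|c w {}v [y [b [hy ->]]] _ IH].
  by rewrite (lin0 (tens_br_linr hL cA _)); apply: lin_span0.
rewrite (tens_br_linr hL cA) (tens_br_twist _ _ _ aj); apply: lin_span_lin => //.
by apply/Fil_pure/LC_brr/LC_twist.
Qed.

Lemma Fil_brl k (u v : T) : Fil k u -> Fil k.+1 (tens_br u v).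
Proof.
elim=> [|c w {}u [x [a [hx ->]]] _ IH].
  by rewrite (lin0 (tens_br_linl hL cA _)); apply: lin_span0.
rewrite (tens_br_linl hL cA); apply: lin_span_lin => // {IH}.
elim/(cdga_ind cA): a => [a a' IH IH'|i a ai].
  by rewrite (linD (tens_linr _)) (linD (tens_br_linl hL cA _)); apply: lin_spanD.
elim/tens_ind: v => [v v' IH IH'|y b].
  by rewrite (linD (tens_br_linr hL cA _)); apply: lin_spanD.
by rewrite (tens_br_twist _ _ _ ai); apply/Fil_pure/LC_brl.
Qed.

Lemma lower_central_tensLie k u : @lower_central K (tensLie L A) k u -> Fil k u.
Proof.
elim: k u => [u _|k IH u]; first exact: Fil_all.
elim=> [|c v w [y [z [/IH hz ->]]] _ IHw]; first exact: lin_span0.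
by apply: lin_span_lin => //; apply: Fil_brr.
Qed.

End TensorFiltration.

Lemma Fil_tmap (A B : dgaData K) k (g : L -> L) (f : A -> B) (u : tensor L A) :
  linear g -> linear f -> (forall x, LC k x -> LC k (g x)) -> Fil k u -> Fil k (tmap g f u).
Proof.
move=> lg lf hg; elim=> [|c v w [x [a [hx ->]]] _ IH].
  by rewrite (lin0 (tmap_lin lg lf)); apply: lin_span0.
rewrite (tmap_lin lg lf) (tmapE lg lf); apply: lin_span_lin => //.
exact/Fil_pure/hg.
Qed.

End LowerCentral.

(** This permits the whole theory of flat triangles to be applied with coefficients in g ⊗ Ω_1,
    where the composition law is found. *)
Lemma nilpotent_tensLie (K : fieldType) (L : dgLieData K) (A : dgaData K) N :
  isDgLie L -> isCdga A N -> nilpotent_dgLie L -> nilpotent_dgLie (tensLie L A).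
Proof.
move=> hL cA [k hk]; exists k => u /(lower_central_tensLie hL cA).
exact: (Fil_nil hk).
Qed.

(** * Morphisms of tensor products *)

Record isCdgaMor (K : fieldType) (A B : dgaData K) (f : A -> B) : Prop := IsCdgaMor {
  cmor_lin : linear f;
  cmor_comp : forall i a, f (dga_comp i a) = dga_comp i (f a);
  cmor_mul : forall a b, f (dga_mul a b) = dga_mul (f a) (f b);
  cmor_diff : forall a, f (dga_diff a) = dga_diff (f a) }.

Record isLieMor (K : fieldType) (L L' : dgLieData K) (g : L -> L') : Prop := IsLieMor {
  lmor_lin : linear g;
  lmor_comp : forall i x, g (lie_comp i x) = lie_comp i (g x);
  lmor_br : forall x y, g (lie_br x y) = lie_br (g x) (g y);
  lmor_diff : forall x, g (lie_diff x) = lie_diff (g x) }.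

Section TensorMorphism.
Variables (K : fieldType) (L L' : dgLieData K) (A B : dgaData K) (N M : nat).
Hypotheses (hL : isDgLie L) (hL' : isDgLie L') (cA : isCdga A N) (cB : isCdga B M).
Variables (g : L -> L') (f : A -> B).
Hypotheses (mg : isLieMor g) (mf : isCdgaMor f).
Local Notation Phi := (tmap g f).

Let lg := lmor_lin mg.
Let lf := cmor_lin mf.
Let PE := tmapE lg lf.
Let PL := tmap_lin lg lf.

Lemma twist_mor z x : g (twist z x) = twist z (g x).
Proof.
elim/(lie_ind hL): x => [x y IH IH'|i x xi].
  by rewrite (linD (twist_lin hL _)) !(linD lg) (linD (twist_lin hL' _)) IH IH'.
have gi : lie_comp i (g x) = g x by rewrite -(lmor_comp mg) xi.
by rewrite (twist_homog hL _ xi) (linZ lg) (twist_homog hL' _ gi).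
Qed.

Lemma tmap_comp_mor i u : Phi (tens_comp i u) = tens_comp i (Phi u).
Proof.
elim/(tens_hom_ind hL cA): u => [u v IH IH'|p j x a xp aj].
  by rewrite (linD (tens_comp_lin hL cA _)) !(linD PL) (linD (tens_comp_lin hL' cB _)) IH IH'.
have gp : lie_comp p (g x) = g x by rewrite -(lmor_comp mg) xp.
have fj : dga_comp j (f a) = f a by rewrite -(cmor_comp mf) aj.
rewrite (tens_comp_pure hL cA _ xp aj) PE (tens_comp_pure hL' cB _ gp fj).
by case: ifP => _; rewrite ?PE ?(lin0 PL).
Qed.

Lemma tmap_tdA u : Phi (tdA u) = tdA (Phi u).
Proof.
elim/tens_ind: u => [u v IH IH'|x a].
  by rewrite (linD (tdA_lin hL cA)) !(linD PL) (linD (tdA_lin hL' cB)) IH IH'.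
by rewrite (tdAE hL cA) !PE (tdAE hL' cB) twist_mor (cmor_diff mf).
Qed.

Lemma tmap_tdL u : Phi (tdL u) = tdL (Phi u).
Proof.
elim/tens_ind: u => [u v IH IH'|x a].
  by rewrite (linD (tdL_lin hL)) !(linD PL) (linD (tdL_lin hL')) IH IH'.
by rewrite (tdLE hL) !PE (tdLE hL') (lmor_diff mg).
Qed.

Lemma tmap_br u v : Phi (tens_br u v) = tens_br (Phi u) (Phi v).
Proof.
elim/(tens_hom_ind hL cA): u => [u u' IH IH'|p i x a xp ai].
  by rewrite (linD (tens_br_linl hL cA _)) !(linD PL) (linD (tens_br_linl hL' cB _)) IH IH'.
elim/tens_ind: v => [v v' IH IH'|y b].
  by rewrite (linD (tens_br_linr hL cA _)) !(linD PL) (linD (tens_br_linr hL' cB _)) IH IH'.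
have fi : dga_comp i (f a) = f a by rewrite -(cmor_comp mf) ai.
rewrite (tens_br_twist hL cA _ _ _ ai) !PE (tens_br_twist hL' cB _ _ _ fi).
by rewrite (lmor_br mg) twist_mor (cmor_mul mf).
Qed.

End TensorMorphism.

Lemma lie_mor_id (K : fieldType) (L : dgLieData K) : isLieMor (fun x : L => x).
Proof. by split. Qed.

Lemma cdga_mor_id (K : fieldType) (A : dgaData K) : isCdgaMor (fun x : A => x).
Proof. by split. Qed.

Lemma pullback_mor (K : fieldType) k n (f : 'I_k.+1 -> 'I_n.+1) : 2 != 0 :> K ->
  isCdgaMor (@pullback K k n f).
Proof.
move=> two; split.
- exact: pullback_lin.
- by move=> i a; rewrite pullback_comp.
- by move=> a b; rewrite pullback_mul.
- by move=> a; rewrite pullback_diff.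
Qed.

Section TmapTmap.
Variables (K : fieldType) (V1 V2 V3 W1 W2 W3 : lmodType K).

Lemma tmap_tmap (g : V1 -> V2) (g' : V2 -> V3) (f : W1 -> W2) (f' : W2 -> W3) u :
  linear g -> linear g' -> linear f -> linear f' ->
  tmap g' f' (tmap g f u) = tmap (fun x => g' (g x)) (fun a => f' (f a)) u.
Proof.
move=> lg lg' lf lf'; elim/tens_ind: u => [u v IH IH'|x a].
  rewrite (linD (tmap_lin lg lf)) (linD (tmap_lin lg' lf')) IH IH'.
  by rewrite (linD (tmap_lin (lin_comp lg' lg) (lin_comp lf' lf))).
by rewrite !tmapE //; [exact: lin_comp | exact: lin_comp].
Qed.

Lemma tint_tmap (g : V1 -> V2) (f : W1 -> W2) (la : W2 -> K) u :
  linear g -> linear f -> linear (la : W2 -> K^o) ->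
  tint la (tmap g f u) = g (tint (fun a => la (f a)) u).
Proof.
move=> lg lf ll; have lc : linear (fun a => la (f a) : K^o) by exact: (lin_comp ll lf).
elim/tens_ind: u => [u v IH IH'|x a].
  by rewrite (linD (tmap_lin lg lf)) (linD (tint_lin ll)) IH IH' (linD (tint_lin lc)) (linD lg).
by rewrite tmapE // !tintE // (linZ lg).
Qed.

End TmapTmap.

Opaque pullback integral elementary_form.

(** * Gauges *)

Section GaugeForms.
Variable K : fieldType.
Hypothesis charK0 : [pchar K] =i pred0.
Variable s : forall n, Omega K n -> Omega K n.
Hypothesis gs : gauge s.

Let two_neq0 : 2 != 0 :> K. Proof. exact: char0_natr. Qed.
Let cs := gs.1.
Let cO n := Omega_isCdga two_neq0 n.

Lemma gauge_lin n : linear (@s n).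
Proof. exact: contraction_lin cs n. Qed.

Lemma integral_pullback_lin k n (f : 'I_k.+1 -> 'I_n.+1) :
  linear (fun a : Omega K n => integral (pullback f a) : K^o).
Proof. exact: (lin_comp (@integral_lin K charK0 k) (pullback_lin two_neq0 f)). Qed.

Lemma whitney_lin n : linear (@whitney K n).
Proof.
apply: lin_bigsum => k c a b.
rewrite scaler_sumr -big_split; apply: eq_bigr => f _.
have e : integral (pullback f (c *: a + b)) =
    c * integral (pullback f a) + integral (pullback f b).
  exact: (integral_pullback_lin f c a b).
apply: (etrans (f_equal (fun r => r *: elementary_form K f) e)).
by rewrite scalerDl -scalerA.
Qed.

Lemma gauge_comp n p (a : Omega K n) : dga_comp p (s a) = s (dga_comp p.+1 a).
Proof.
elim/(cdga_ind (cO n)): a => [a b IH IH'|i a ai].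
  rewrite (linD (@gauge_lin n)) !(linD (cdga_comp_lin (cO n) _)) IH IH'.
  by rewrite (linD (@gauge_lin n)).
rewrite (cdga_comp_homog (cO n) _ ai); case: i ai => [|i] ai.
  by rewrite (contraction_deg0 cs ai) (lin0 (cdga_comp_lin (cO n) _)) (lin0 (@gauge_lin n)).
rewrite (cdga_comp_homog (cO n) _ (contraction_degS cs ai)) eqSS.
by case: ifP => _; rewrite ?(lin0 (@gauge_lin n)).
Qed.

Lemma gauge_comp0 n (a : Omega K n) : s (dga_comp 0 a) = 0.
Proof. exact/(contraction_deg0 cs)/(cdga_comp_comp (cO n) 0 0). Qed.

(** By naturality the integral of s a over a face of dimension k is that of s b, with b the
    restriction of a to the face. Only the part of degree k of s b counts, and it is s applied to
    the part of degree k + 1 of b, which is zero on a k-simplex. *)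
Lemma whitney_gauge n (a : Omega K n) : whitney (s a) = 0.
Proof.
rewrite /whitney big1 // => k _; apply: big1 => f /forallP mf.
suff -> : integral (pullback f (s a)) = 0 by rewrite scale0r.
have mono (i j : 'I_k.+1) : (i <= j)%N -> (f i <= f j)%N.
  rewrite leq_eqVlt => /predU1P[/val_inj -> //|ij].
  by apply: ltnW; move/forallP: (mf i) => /(_ j) /implyP /(_ ij).
have := contraction_face cs (MonotoneMap mono) a; rewrite /= => ->.
move: (pullback f a) => b.
have h := integral_comp charK0 (k := k) k (s b); rewrite eqxx in h.
rewrite -h gauge_comp.
have -> : dga_comp k.+1 b = 0 by apply: (cdga_comp_bound (cO k)).
rewrite (lin0 (@gauge_lin k)); exact: (lin0 (@integral_lin K charK0 k)).
Qed.

(** The homotopy formula at s a gives s a = s d s a, by P s = 0 and s^2 = 0. Applying s to the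
    formula at a gives s a - s P a = s d s a; hence s P = 0. *)
Lemma gauge_whitney n (a : Omega K n) : s (whitney a) = 0.
Proof.
have e : whitney a = a - dga_diff (s a) - s (dga_diff a).
  by rewrite -addrA -opprD -(contraction_homotopy cs) opprB addrC subrK.
rewrite e !(linB (@gauge_lin n)) gs.2 subr0.
have := contraction_homotopy cs (s a); rewrite whitney_gauge gs.2 subr0.
by rewrite (lin0 (cdga_diff_lin (cO n))) add0r => {1}->; rewrite subrr.
Qed.

(** P = 1 - d s - s d commutes with d by its very form. Compatibility of P with degrees and with
    monotone pullbacks follows from the homotopy formula in the same way, without integrals. *)
Lemma whitney_diff n (a : Omega K n) : whitney (dga_diff a) = dga_diff (whitney a).
Proof.
have e b : whitney b = b - (dga_diff (s b) + s (dga_diff b)) :> Omega K n.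
  by rewrite -(contraction_homotopy cs) opprB addrC subrK.
rewrite !e (linB (cdga_diff_lin (cO n))) (linD (cdga_diff_lin (cO n))).
by rewrite !(cdga_diff2 (cO n)) (lin0 (@gauge_lin n)) addr0 add0r.
Qed.

Lemma whitney_comp n p (a : Omega K n) : dga_comp p (whitney a) = whitney (dga_comp p a).
Proof.
have e b : whitney b = b - (dga_diff (s b) + s (dga_diff b)) :> Omega K n.
  by rewrite -(contraction_homotopy cs) opprB addrC subrK.
rewrite !e (linB (cdga_comp_lin (cO n) _)) (linD (cdga_comp_lin (cO n) _)).
congr (_ - (_ + _)); last by rewrite gauge_comp (cdga_diff_comp (cO n)).
case: p => [|p]; last by rewrite (cdga_diff_comp (cO n)) gauge_comp.
by rewrite (cdga_diff_comp0 (cO n)) gauge_comp0 (lin0 (cdga_diff_lin (cO n))).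
Qed.

Lemma whitney_pullback k n (f : monotone_map k n) (a : Omega K n) :
  pullback f (whitney a) = whitney (pullback f a).
Proof.
have e m (b : Omega K m) : whitney b = b - (dga_diff (s b) + s (dga_diff b)).
  by rewrite -(contraction_homotopy cs) opprB addrC subrK.
rewrite !e (linB (pullback_lin two_neq0 f)) (linD (pullback_lin two_neq0 f)).
by rewrite (pullback_diff two_neq0) !(contraction_face cs) (pullback_diff two_neq0).
Qed.

End GaugeForms.

Section GaugeTensor.
Variable K : fieldType.
Hypothesis charK0 : [pchar K] =i pred0.
Variable s : forall n, Omega K n -> Omega K n.
Hypothesis gs : gauge s.
Variable L : dgLieData K.
Hypothesis hL : isDgLie L.

Let two_neq0 : 2 != 0 :> K. Proof. exact: char0_natr. Qed.
Let cO n := Omega_isCdga two_neq0 n.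
Let cs := gs.1.
Local Notation T n := (tensor L (Omega K n)).

(* Unlike [tens_map s], [tS] carries the Koszul sign (-1)^|x|, so that it satisfies the
   homotopy formula; by [tS_zero] both have the same kernel. *)
Definition tS n : T n -> T n := tmap (twist 1) (@s n).
Definition tP n : T n -> T n := tmap (fun x => x) (@whitney K n).
Definition tI k n (f : 'I_k.+1 -> 'I_n.+1) : T n -> L :=
  tint (fun a => integral (pullback f a)).
Definition tC n (p : nat) : T n -> T n := tmap (fun x => x) (dga_comp p).
Definition tpb k n (f : 'I_k.+1 -> 'I_n.+1) : T n -> T k := tmap (fun x => x) (pullback f).

Let tw := twist_lin hL 1.
Let li := @lin_id K L.
Let sl n := gauge_lin gs (n := n).
Let wl n := @whitney_lin K charK0 n.
Let pl k n f := @pullback_lin K two_neq0 k n f.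
Let cl n p := cdga_comp_lin (cO n) p.
Let il k n f := @integral_pullback_lin K charK0 k n f.

Lemma tS_lin n : linear (@tS n). Proof. exact: tmap_lin. Qed.
Lemma tP_lin n : linear (@tP n). Proof. exact: tmap_lin. Qed.
Lemma tI_lin k n (f : 'I_k.+1 -> 'I_n.+1) : linear (@tI k n f). Proof. exact: tint_lin. Qed.
Lemma tC_lin n p : linear (@tC n p). Proof. exact: tmap_lin. Qed.
Lemma tpb_lin k n (f : 'I_k.+1 -> 'I_n.+1) : linear (@tpb k n f). Proof. exact: tmap_lin. Qed.

Lemma tSE n (x : L) (a : Omega K n) : @tS n (tens x a) = tens (twist 1 x) (s a). Proof. exact: tmapE. Qed.
Lemma tPE n (x : L) (a : Omega K n) : @tP n (tens x a) = tens x (whitney a). Proof. exact: tmapE. Qed.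
Lemma tIE k n (f : 'I_k.+1 -> 'I_n.+1) (x : L) (a : Omega K n) : tI f (tens x a) = integral (pullback f a) *: x.
Proof. exact: tintE. Qed.
Lemma tCE n p (x : L) (a : Omega K n) : @tC n p (tens x a) = tens x (dga_comp p a). Proof. exact: tmapE. Qed.
Lemma tpbE k n (f : 'I_k.+1 -> 'I_n.+1) (x : L) (a : Omega K n) : tpb f (tens x a) = tens x (pullback f a).
Proof. exact: tmapE. Qed.

Let tdAl n := tdA_lin hL (cO n).
Let tdLl n := @tdL_lin K L (Omega K n) hL.
Let tdAe n := tdAE hL (cO n).

Lemma t_homotopy n (u : T n) : u - tP u = tdA (tS u) + tS (tdA u).
Proof.
elim/tens_ind: u => [u v IH IH'|x a].
  rewrite (linD (@tP_lin n)) (linD (@tS_lin n)) !(linD (@tdAl n)) (linD (@tS_lin n)).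
  by rewrite opprD addrACA IH IH' addrACA.
rewrite tPE tSE !tdAe tSE !(twistK hL) -(linB (tens_linr x)) (contraction_homotopy cs).
by rewrite (linD (tens_linr x)).
Qed.

Lemma tS2 n (u : T n) : tS (tS u) = 0.
Proof.
elim/tens_ind: u => [u v IH IH'|x a]; first by rewrite !(linD (@tS_lin n)) IH IH' addr0.
by rewrite !tSE gs.2 (lin0 (tens_linr _)).
Qed.

Lemma tP_tS n (u : T n) : tP (tS u) = 0.
Proof.
elim/tens_ind: u => [u v IH IH'|x a].
  by rewrite (linD (@tS_lin n)) (linD (@tP_lin n)) IH IH' addr0.
by rewrite tSE tPE (whitney_gauge charK0 gs) (lin0 (tens_linr _)).
Qed.

Lemma tS_tP n (u : T n) : tS (tP u) = 0.
Proof.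
elim/tens_ind: u => [u v IH IH'|x a].
  by rewrite (linD (@tP_lin n)) (linD (@tS_lin n)) IH IH' addr0.
by rewrite tPE tSE (gauge_whitney charK0 gs) (lin0 (tens_linr _)).
Qed.

Lemma tP_tdA n (u : T n) : tP (tdA u) = tdA (tP u).
Proof.
elim/tens_ind: u => [u v IH IH'|x a].
  by rewrite (linD (@tdAl n)) !(linD (@tP_lin n)) (linD (@tdAl n)) IH IH'.
by rewrite tdAe !tPE tdAe (whitney_diff charK0 gs).
Qed.

Lemma tS_tdL n (u : T n) : tS (tdL u) = - tdL (tS u).
Proof.
elim/tens_ind: u => [u v IH IH'|x a].
  by rewrite (linD (@tdLl n)) !(linD (@tS_lin n)) (linD (@tdLl n)) IH IH' opprD.
by rewrite (tdLE hL) !tSE (tdLE hL) (twist_diff hL) (linN (tens_linl _)).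
Qed.

Lemma tS_zero n (u : T n) : tens_map (@s n) u = 0 <-> tS u = 0.
Proof.
have e1 : tS u = tmap (twist 1) (fun a => a) (tens_map (@s n) u).
  by rewrite -[tens_map _ _]/(tmap (fun x => x) (@s n) u) (tmap_tmap u li tw (@sl n) (@lin_id _ _)).
have e2 : tens_map (@s n) u = tmap (twist 1) (fun a => a) (tS u).
  rewrite /tS (tmap_tmap u tw tw (@sl n) (@lin_id _ _)).
  rewrite -[LHS]/(tmap (fun x => x) (fun a => s a) u).
  by congr (tmap _ _ u); apply: funext => x; rewrite (twistK hL).
split=> h; [rewrite e1 h|rewrite e2 h]; exact: (lin0 (tmap_lin tw (@lin_id _ _))).
Qed.

Lemma tP_exp n (u : T n) : tP u = \sum_(k < n.+1)
    \sum_(f : {ffun 'I_k.+1 -> 'I_n.+1} |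
          [forall i : 'I_k.+1, forall j : 'I_k.+1, (i < j)%N ==> (f i < f j)%N])
      tens (tI f u) (elementary_form K f).
Proof.
elim/tens_ind: u => [u v IH IH'|x a].
  rewrite (linD (@tP_lin n)) IH IH' -big_split; apply: eq_bigr => k _.
  rewrite -big_split; apply: eq_bigr => f _ /=.
  by rewrite (linD (tI_lin f)) (linD (tens_linl _)).
rewrite tPE /whitney (lin_sum (tens_linr _)); apply: eq_bigr => k _.
rewrite (lin_sum (tens_linr _)); apply: eq_bigr => f _.
by rewrite tIE (linZ (tens_linr _)) (linZ (tens_linl _)).
Qed.

Section Pullback.
Variables (k n : nat) (f : 'I_k.+1 -> 'I_n.+1).
Let mf := pullback_mor f two_neq0.
Let mi := lie_mor_id L.

Lemma tpb_comp i u : tpb f (tens_comp i u) = tens_comp i (tpb f u).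
Proof. exact: (tmap_comp_mor hL hL (cO n) (cO k) mi mf). Qed.

Lemma tpb_tdA u : tpb f (tdA u) = tdA (tpb f u).
Proof. exact: (tmap_tdA hL hL (cO n) (cO k) mi mf). Qed.

Lemma tpb_tdL u : tpb f (tdL u) = tdL (tpb f u).
Proof. exact: (tmap_tdL hL hL mi mf). Qed.

Lemma tpb_br u v : tpb f (tens_br u v) = tens_br (tpb f u) (tpb f v).
Proof. exact: (tmap_br hL hL (cO n) (cO k) mi mf). Qed.

Lemma tpb_tC p u : tpb f (tC p u) = tC p (tpb f u).
Proof.
elim/tens_ind: u => [u v IH IH'|x a].
  by rewrite (linD (@tC_lin n p)) !(linD (tpb_lin f)) (linD (@tC_lin k p)) IH IH'.
by rewrite tCE !tpbE tCE (pullback_comp two_neq0).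
Qed.

Lemma tI_tpb l (h : 'I_l.+1 -> 'I_k.+1) u : tI h (tpb f u) = tI (f \o h) u.
Proof.
elim/tens_ind: u => [u v IH IH'|x a].
  by rewrite (linD (tpb_lin f)) !(linD (tI_lin _)) IH IH'.
by rewrite tpbE !tIE (pullback_pullback two_neq0).
Qed.

End Pullback.

Lemma tpb_tS k n (f : monotone_map k n) u : tpb f (tS u) = tS (tpb f u).
Proof.
elim/tens_ind: u => [u v IH IH'|x a].
  by rewrite (linD (@tS_lin n)) !(linD (tpb_lin f)) (linD (@tS_lin k)) IH IH'.
by rewrite tSE !tpbE tSE (contraction_face cs).
Qed.

Lemma tpb_tP k n (f : monotone_map k n) u : tpb f (tP u) = tP (tpb f u).
Proof.
elim/tens_ind: u => [u v IH IH'|x a].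
  by rewrite (linD (@tP_lin n)) !(linD (tpb_lin f)) (linD (@tP_lin k)) IH IH'.
by rewrite tPE !tpbE tPE (whitney_pullback charK0 gs).
Qed.

Lemma tI_top k (u : T k) (h : 'I_k.+1 -> 'I_k.+1) p : tI h (tC p u) = if p == k then tI h u else 0.
Proof.
elim/tens_ind: u => [u v IH IH'|x a].
  rewrite (linD (@tC_lin k p)) !(linD (tI_lin h)) IH IH'; case: ifP => // _; exact: addr0.
rewrite tCE !tIE (pullback_comp two_neq0) (integral_comp charK0).
by case: ifP => // _; rewrite scale0r.
Qed.

Lemma tI_comp p k n (f : 'I_k.+1 -> 'I_n.+1) (u : T n) : tens_comp p u = u ->
  lie_comp (p - k%:Z) (tI f u) = tI f u.
Proof.
move: u; apply: (tens_deg_ind hL (cO n) (r := p)) => [|u v IH IH'|i j x a xi aj <-].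
- by rewrite (lin0 (tI_lin f)) (lin0 (lie_comp_lin hL _)).
- by rewrite (linD (tI_lin f)) (linD (lie_comp_lin hL _)) IH IH'.
rewrite tIE (linZ (lie_comp_lin hL _)).
have pj : dga_comp j (pullback f a) = pullback f a.
  by rewrite -(pullback_comp two_neq0) aj.
rewrite -pj (integral_comp charK0); case: eqP => [->|_]; last by rewrite !scale0r.
by rewrite addrK xi.
Qed.

Lemma tS_comp p n (u : T n) : tens_comp p u = u -> tens_comp (p - 1) (tS u) = tS u.
Proof.
move: u; apply: (tens_deg_ind hL (cO n) (r := p)) => [|u v IH IH'|i j x a xi aj <-].
- by rewrite (lin0 (@tS_lin n)) (lin0 (tens_comp_lin hL (cO n) _)).
- by rewrite (linD (@tS_lin n)) (linD (tens_comp_lin hL (cO n) _)) IH IH'.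
rewrite tSE (twist_homog hL _ xi) (linZ (tens_linl _)) (linZ (tens_comp_lin hL (cO n) _)).
congr (_ *: _); case: j aj => [|j] aj.
  by rewrite (contraction_deg0 cs aj) (lin0 (tens_linr _)) (lin0 (tens_comp_lin hL (cO n) _)).
rewrite (tens_comp_pure hL (cO n) _ xi (contraction_degS cs aj)).
by rewrite -addn1 PoszD addrA addrK eqxx.
Qed.

Lemma tC_tS n p (u : T n) : tC p (tS u) = tS (tC p.+1 u).
Proof.
elim/tens_ind: u => [u v IH IH'|x a].
  by rewrite (linD (@tS_lin n)) !(linD (@tC_lin n _)) (linD (@tS_lin n)) IH IH'.
by rewrite tSE !tCE tSE (gauge_comp charK0 gs).
Qed.

Lemma tC_tP n p (u : T n) : tC p (tP u) = tP (tC p u).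
Proof.
elim/tens_ind: u => [u v IH IH'|x a].
  by rewrite (linD (@tP_lin n)) !(linD (@tC_lin n _)) (linD (@tP_lin n)) IH IH'.
by rewrite tPE !tCE tPE (whitney_comp charK0 gs).
Qed.

Lemma tS_tC0 n (u : T n) : tS (tC 0 u) = 0.
Proof.
elim/tens_ind: u => [u v IH IH'|x a].
  by rewrite (linD (@tC_lin n _)) (linD (@tS_lin n)) IH IH' addr0.
by rewrite tCE tSE (gauge_comp0 charK0 gs) (lin0 (tens_linr _)).
Qed.

Lemma tC_tdA n p (u : T n) : tC p.+1 (tdA u) = tdA (tC p u).
Proof.
elim/tens_ind: u => [u v IH IH'|x a].
  by rewrite (linD (@tdAl n)) !(linD (@tC_lin n _)) (linD (@tdAl n)) IH IH'.
by rewrite tdAe !tCE tdAe (cdga_diff_comp (cO n)).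
Qed.

Lemma tC_tdL n p (u : T n) : tC p (tdL u) = tdL (tC p u).
Proof.
elim/tens_ind: u => [u v IH IH'|x a].
  by rewrite (linD (@tdLl n)) !(linD (@tC_lin n _)) (linD (@tdLl n)) IH IH'.
by rewrite (tdLE hL) !tCE (tdLE hL).
Qed.

Lemma tC_comp n p i (u : T n) : tC p (tens_comp i u) = tens_comp i (tC p u).
Proof.
elim/(tens_hom_ind hL (cO n)): u => [u v IH IH'|r j x a xr aj].
  rewrite (linD (tens_comp_lin hL (cO n) _)) !(linD (@tC_lin n _)).
  by rewrite (linD (tens_comp_lin hL (cO n) _)) IH IH'.
rewrite tCE (tens_comp_pure hL (cO n) _ xr aj) (cdga_comp_homog (cO n) _ aj).
case: (altP (p =P j)) => [->|/negPf pj].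
  rewrite (tens_comp_pure hL (cO n) _ xr aj); case: ifP => _; first by rewrite tCE aj.
  exact: (lin0 (@tC_lin n _)).
rewrite (lin0 (tens_linr _)) (lin0 (tens_comp_lin hL (cO n) _)).
case: ifP => _; last exact: (lin0 (@tC_lin n _)).
by rewrite tCE (cdga_comp_homog (cO n) _ aj) pj (lin0 (tens_linr _)).
Qed.

Lemma tC_br n p q (u v : T n) : tC p u = u -> tC q v = v ->
  tC (p + q) (tens_br u v) = tens_br u v.
Proof.
move=> <- <-; elim/tens_ind: u => [u u' IH IH'|x a].
  rewrite (linD (@tC_lin n _)) (linD (tens_br_linl hL (cO n) _)).
  by rewrite (linD (@tC_lin n (p + q))) IH IH'.
elim/tens_ind: v => [v v' IH IH'|y b].
  rewrite (linD (@tC_lin n q)) (linD (tens_br_linr hL (cO n) _)).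
  by rewrite (linD (@tC_lin n (p + q))) IH IH'.
rewrite !tCE (tens_br_twist hL (cO n) (i := p)); last by rewrite (cdga_comp_comp (cO n)) eqxx.
by rewrite tCE (cdga_mul_comp (cO n)).
Qed.

Lemma tC_tC n p q (u : T n) : tC p (tC q u) = if p == q then tC q u else 0.
Proof.
elim/tens_ind: u => [u v IH IH'|x a].
  rewrite !(linD (@tC_lin n _)) IH IH'; case: ifP => // _; exact: addr0.
by rewrite !tCE (cdga_comp_comp (cO n)); case: ifP => // _; rewrite (lin0 (tens_linr _)).
Qed.

Lemma tC_sum n (u : T n) : u = \sum_(p < n.+1) tC p u.
Proof.
elim/tens_ind: u => [u v IH IH'|x a].
  rewrite {1}IH {1}IH' -big_split; apply: eq_bigr => p _ /=.
  by rewrite (linD (@tC_lin n _)).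
rewrite -{1}(cdga_comp_sum (cO n) a) (lin_sum (tens_linr _)).
by apply: eq_bigr => p _; rewrite tCE.
Qed.

Lemma tC_bound n p (u : T n) : (n < p)%N -> tC p u = 0.
Proof.
move=> np; elim/tens_ind: u => [u v IH IH'|x a].
  by rewrite (linD (@tC_lin n _)) IH IH' addr0.
by rewrite tCE (cdga_comp_bound (cO n) _ np) (lin0 (tens_linr _)).
Qed.

Lemma nonneg_homog i (x : L) : nonneg_graded L -> lie_comp i x = x -> i < 0 -> x = 0.
Proof. by move=> nn <- i0; apply: nn. Qed.

(** In total degree r, a summand of form degree p has Lie degree r - p, here negative. This is how
    the grading assumption on g bounds the form degrees. *)
Lemma tC_nonneg n p r (u : T n) : nonneg_graded L -> tens_comp r u = u -> r < p%:Z ->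
  tC p u = 0.
Proof.
move=> nn + rp; move: u; apply: (tens_deg_ind hL (cO n) (r := r)) => [|u v IH IH'|i j x a xi aj e].
- exact: (lin0 (@tC_lin n _)).
- by rewrite (linD (@tC_lin n _)) IH IH' addr0.
rewrite tCE (cdga_comp_homog (cO n) _ aj); case: eqP => [pj|_]; last by rewrite (lin0 (tens_linr _)).
rewrite (nonneg_homog nn xi) ?(lin0 (tens_linl _)) //.
by move: rp; rewrite -e pj gtrDr.
Qed.

Local Notation Fl n := (@Fil K L (Omega K n)).

Lemma Fil_tS n k (u : T n) : Fl n k u -> Fl n k (tS u).
Proof. by apply: Fil_tmap => //; apply: LC_twist. Qed.

Lemma Fil_tP n k (u : T n) : Fl n k u -> Fl n k (tP u).
Proof. exact: Fil_tmap. Qed.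

Lemma Fil_tI n k l (f : 'I_l.+1 -> 'I_n.+1) (u : T n) :
  Fl n k u -> @lower_central K L k (tI f u).
Proof. exact: Fil_tint. Qed.

End GaugeTensor.

(** * Vertices and edges, and the contraction estimates behind the fixed point equations *)

Definition vtx n (i : 'I_n.+1) : 'I_1 -> 'I_n.+1 := fun=> i.
Definition edge n (i j : 'I_n.+1) : 'I_2 -> 'I_n.+1 := fun p => if p == ord0 then i else j.

Lemma vtx_monoP n (i : 'I_n.+1) : forall p q : 'I_1, (p <= q)%N -> (vtx i p <= vtx i q)%N.
Proof. by []. Qed.

Lemma edge_monoP n (i j : 'I_n.+1) : (i <= j)%N ->
  forall p q : 'I_2, (p <= q)%N -> (edge i j p <= edge i j q)%N.
Proof.
by move=> ij p q; rewrite /edge -!val_eqE; case: p => [] [|[|]] //; case: q => [] [|[|]].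
Qed.

Definition vtx_mono n (i : 'I_n.+1) := MonotoneMap (@vtx_monoP n i).
Definition edge_mono n (i j : 'I_n.+1) (ij : (i <= j)%N) := MonotoneMap (edge_monoP ij).

Definition increasing k n (f : 'I_k.+1 -> 'I_n.+1) :=
  forall i j : 'I_k.+1, (i < j)%N -> (f i < f j)%N.

Lemma funE1 n (f : 'I_1 -> 'I_n.+1) : f = vtx (f ord0).
Proof. by apply: funext => p; rewrite (ord1 p). Qed.

Lemma funE2 n (f : 'I_2 -> 'I_n.+1) : f = edge (f ord0) (f ord_max).
Proof.
apply: funext => p; rewrite /edge -val_eqE; case: p => [] [|[|]] // h /=; congr f;
  exact: val_inj.
Qed.

Lemma subr_affine (V : zmodType) (n p q p' q' : V) :
  (n + p - q) - (n + p' - q') = (p - p') - (q - q').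
Proof.
rewrite -[n + p - q]addrA -[n + p' - q']addrA opprD addrACA subrr add0r.
by rewrite opprD addrACA -opprD.
Qed.

(** Induction from below gives f m >= m and induction from above f m <= m. So the only face of full
    dimension is the simplex itself. *)
Lemma increasing_id k (f : 'I_k.+1 -> 'I_k.+1) : increasing f -> f = id.
Proof.
move=> fi; have ge m (mk : (m < k.+1)%N) : (m <= f (Ordinal mk))%N.
  elim: m mk => // m IH mk; apply: leq_ltn_trans (IH (ltnW mk)) _.
  exact: fi.
have le m (mk : (m < k.+1)%N) : (f (Ordinal mk) <= m)%N.
  have [d] := ubnP (k - m)%N; elim: d m mk => // d IH m mk dm.
  have := mk; rewrite ltnS leq_eqVlt => /predU1P[e|mk'].
    by rewrite [X in (_ <= X)%N]e -ltnS.
  have h := fi (Ordinal mk) (Ordinal (mk' : (m.+1 < k.+1)%N)) (ltnSn m).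
  by rewrite -ltnS; apply: leq_trans h _; apply: IH; lia.
apply: funext => -[m mk]; apply: val_inj; apply/eqP.
by rewrite eqn_leq le ge.
Qed.

Section Deformation.
Variable K : fieldType.
Hypothesis charK0 : [pchar K] =i pred0.
Variable s : forall n, Omega K n -> Omega K n.
Hypothesis gs : gauge s.

Let two_neq0 : 2 != 0 :> K. Proof. exact: char0_natr. Qed.
Let cO n := Omega_isCdga two_neq0 n.

Section WhitneyElementary.
Variable n : nat.

Lemma integral_pullback_deg p k (f : 'I_k.+1 -> 'I_n.+1) (a : Omega K n) :
  dga_comp p a = a -> p != k -> integral (pullback f a) = 0.
Proof.
move=> pa pk; have := integral_comp charK0 p (pullback f a).
by rewrite -(pullback_comp two_neq0) pa (negPf pk).
Qed.

Lemma whitney_t (i : 'I_n.+1) : whitney (Om_t K i) = Om_t K i.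
Proof.
rewrite /whitney (bigD1 ord0) //= [X in _ + X]big1 ?addr0; last first.
  move=> k k0; apply: big1 => f _.
  by rewrite (integral_pullback_deg (p := 0)) ?scale0r ?Om_comp_t // eq_sym.
rewrite (bigD1 [ffun=> i]) /=; last first.
  by apply/forallP => j; apply/forallP => l; rewrite !ord1.
rewrite [X in _ + X]big1 ?addr0 => [|f /andP[_ fi]].
  by rewrite elementary_form0 (integral_pullback_t charK0) !ffunE eqxx scale1r.
rewrite (integral_pullback_t charK0) (_ : _ == i = false) ?scale0r //.
by apply: contraNF fi => /eqP fi; apply/eqP/ffunP => j; rewrite ffunE (ord1 j).
Qed.

(** A form of degree 1 has integrals over edges only, and by duality only the edge ij itself
    contributes to P. *)
Lemma whitney_edge (i j : 'I_n.+1) : (i < j)%N -> whitney (Om_edge K i j) = Om_edge K i j.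
Proof.
move=> ij; have n1 : (1 < n.+1)%N by have := ltn_ord j; lia.
rewrite /whitney (bigD1 (Ordinal n1)) //= [X in _ + X]big1 ?addr0; last first.
  move=> k k0; apply: big1 => f _; rewrite (integral_pullback_deg (p := 1)) ?scale0r //.
    exact: Om_comp_edge.
  by rewrite eq_sym.
pose g : {ffun 'I_2 -> 'I_n.+1} := [ffun p => edge i j p].
have g0 : g ord0 = i by rewrite ffunE.
have g1 : g ord_max = j by rewrite ffunE.
have gi : (g ord0 < g ord_max)%N by rewrite g0 g1.
rewrite (bigD1 g) /=; last first.
  apply/forallP => p; apply/forallP => q; apply/implyP; rewrite !ffunE /edge.
  by case: p => [] [|[|]] //; case: q => [] [|[|]].
rewrite [X in _ + X]big1 ?addr0 => [|f /andP[fi fg]].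
  have := integral_pullback_edge charK0 gi gi; rewrite !eqxx g0 g1 => ->.
  by rewrite (elementary_form1 charK0) g0 g1 scale1r.
have fi' : (f ord0 < f ord_max)%N.
  by move/forallP: fi => /(_ ord0) /forallP /(_ ord_max) /implyP; apply.
have := integral_pullback_edge charK0 fi' gi; rewrite g0 g1 => ->.
rewrite (_ : _ && _ = false) ?scale0r //; apply: contraNF fg => /andP[/eqP f0 /eqP f1].
apply/eqP/ffunP => p; rewrite ffunE /edge.
rewrite -val_eqE -f0 -f1; case: p => [] [|[|]] // h /=; congr (fun_of_fin f _);
  exact: val_inj.
Qed.

End WhitneyElementary.

Section Lie.
Variable L : dgLieData K.
Hypothesis hL : isDgLie L.

Local Notation T n := (tensor L (Omega K n)).
Local Notation br := (@tens_br K L _).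
Local Notation tS := (@tS K s L _).

Let tdAl n := tdA_lin hL (cO n).
Let brl n := tens_br_linl hL (cO n).
Let brr n := tens_br_linr hL (cO n).

Lemma tI_deg p k n (f : 'I_k.+1 -> 'I_n.+1) (u : T n) : tC p u = u -> p != k -> tI f u = 0.
Proof.
move=> pu pk; have := tI_top charK0 (tpb f u) id p.
by rewrite -(tpb_tC charK0) pu (negPf pk) (tI_tpb charK0).
Qed.

Lemma tP_zero n (u : T n) :
  (forall k (f : 'I_k.+1 -> 'I_n.+1), increasing f -> tI f u = 0) -> tP u = 0.
Proof.
move=> h; rewrite (tP_exp charK0); apply: big1 => k _; apply: big1 => f fi.
rewrite h ?(lin0 (tens_linl _)) // => i j ij.
by move/forallP: fi => /(_ i) /forallP /(_ j) /implyP; apply.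
Qed.

Lemma tP_zero0 n (u : T n) : tC 0 u = u -> (forall i, tI (vtx i) u = 0) -> tP u = 0.
Proof.
move=> u0 h; apply: tP_zero => -[|k] f fi; last by apply: (tI_deg (p := 0)).
by rewrite (funE1 f).
Qed.

Lemma tP_zero1 n (u : T n) : tC 1 u = u ->
  (forall i j : 'I_n.+1, (i < j)%N -> tI (edge i j) u = 0) -> tP u = 0.
Proof.
move=> u1 h; apply: tP_zero => -[|[|k]] f fi; try exact: (tI_deg (p := 1)).
by rewrite (funE2 f) h // fi.
Qed.

Lemma tP_zero_top n (u : T n) : tC n u = u -> tI (fun i : 'I_n.+1 => i) u = 0 -> tP u = 0.
Proof.
move=> un h; apply: tP_zero => k f fi; have [e|] := eqVneq n k; last exact: tI_deg.
by move: f fi; rewrite -e => f /increasing_id ->.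
Qed.

Lemma tI_vtx_t n (i j : 'I_n.+1) (x : L) :
  tI (vtx i) (tens x (Om_t K j)) = (i == j)%:R *: x.
Proof. by rewrite (tIE charK0) (integral_pullback_t charK0). Qed.

Lemma tI_edge_edge n (i j k l : 'I_n.+1) (x : L) : (i < j)%N -> (k < l)%N ->
  tI (edge i j) (tens x (Om_edge K k l)) = ((i == k) && (j == l))%:R *: x.
Proof.
move=> ij kl; rewrite (tIE charK0); congr (_ *: x).
exact: (@integral_pullback_edge K charK0 n (edge i j) (edge k l) ij kl).
Qed.

Lemma tC_t n (j : 'I_n.+1) (x : L) : tC 0 (tens x (Om_t K j)) = tens x (Om_t K j).
Proof. by rewrite (tCE charK0) Om_comp_t. Qed.

Lemma tC_edge n (i j : 'I_n.+1) (x : L) : tC 1 (tens x (Om_edge K i j)) = tens x (Om_edge K i j).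
Proof. by rewrite (tCE charK0) (Om_comp_edge charK0). Qed.

Lemma tP_t n (j : 'I_n.+1) (x : L) : tP (tens x (Om_t K j)) = tens x (Om_t K j).
Proof. by rewrite (tPE charK0) whitney_t. Qed.

Lemma tP_edge n (i j : 'I_n.+1) (x : L) : (i < j)%N ->
  tP (tens x (Om_edge K i j)) = tens x (Om_edge K i j).
Proof. by move=> ij; rewrite (tPE charK0) whitney_edge. Qed.

Lemma tS_edge n (i j : 'I_n.+1) (x : L) : (i < j)%N -> tS (tens x (Om_edge K i j)) = 0.
Proof. by move=> ij; rewrite -(tP_edge x ij) (tS_tP charK0 gs hL). Qed.

Lemma tC_bound' n p (u : T n) : (n < p)%N -> tC p u = u -> u = 0.
Proof. by move=> np <-; exact: (tC_bound charK0). Qed.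

Section Nilpotent.
Hypothesis nL : nilpotent_dgLie L.
Local Notation Fl := (@Fil K L (Omega K _)).

Let FilA n (u : T n) : Fl 0 u := Fil_all u.

Lemma Fil_nilT n : exists k, forall u : T n, Fl k u -> u = 0.
Proof. by case: nL => k hk; exists k; apply: Fil_nil. Qed.

Lemma FilN n k (u : T n) : Fl k u -> Fl k (- u).
Proof. exact: lin_spanN. Qed.

(* If u is in the step k of the filtration then y, read off as la (P d u) / la (d tau) up
   to sign, is in the step k + 1, and hence so is u = P u + s d u. *)
Lemma rigid n (tau : Omega K n) (la : Omega K n -> K) (u : T n) (y : L) :
  linear (la : _ -> K^o) -> la (dga_diff tau) != 0 -> tS u = 0 ->
  (forall k, Fl k u -> Fl k.+1 (tdA u)) -> tP u = tens y tau -> u = 0.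
Proof.
move=> ll lt su du pu; apply: (fil_zero (@FilA n) (@Fil_nilT n)) => k hk.
have e : u = tP u + tS (tdA u).
  have := t_homotopy charK0 gs hL u; rewrite su (lin0 (@tdAl n)) add0r => <-.
  by rewrite addrC subrK.
have hd := du _ hk.
have yk : @lower_central K L k.+1 y.
  have := Fil_tint ll (Fil_tP charK0 hd).
  rewrite (tP_tdA charK0 gs hL) pu (tdAE hL (cO n)) (tintE _ _ ll) => h.
  rewrite -[y](twistK hL 1); apply: (LC_twist hL (k := k.+1)).
  by rewrite -[twist 1 y]scale1r -(mulVf lt) -scalerA; apply: (@LCZ _ _ k.+1).
rewrite e pu; apply: lin_spanD; first exact: Fil_pure.
exact: (Fil_tS gs hL hd).
Qed.

Definition contr n (Phi : T n -> T n) :=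
  forall k u v, Fl k (u - v) -> Fl k.+1 (Phi u - Phi v).

Lemma contr_br n (w : T n) : contr (fun u => br w u).
Proof. by move=> k u v h; rewrite -(linB (@brr n w)); apply: (Fil_brr hL (cO n)). Qed.

Lemma contr_sq n : contr (fun u : T n => br u u).
Proof.
move=> k u v h; have -> : br u u - br v v = br u (u - v) + br (u - v) v.
  by rewrite (linB (@brr n u)) (linB (@brl n v)) addrA subrK.
by apply: lin_spanD; [apply: (Fil_brr hL (cO n)) | apply: (Fil_brl hL (cO n))].
Qed.

Lemma contr_affine n (F G Phi : T n -> T n) (nu : T n) : linear F -> linear G ->
  (forall k u, Fl k u -> Fl k (F u)) -> (forall k u, Fl k u -> Fl k (G u)) ->
  contr Phi -> contr (fun u => nu + F (Phi u) - G (Phi u)).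
Proof.
move=> lF lG hF hG hP k u v h; rewrite subr_affine -(linB lF) -(linB lG).
by apply: lin_spanB; [apply/hF/hP | apply/hG/hP].
Qed.

End Nilpotent.
End Lie.
End Deformation.

(** * The gauge equation on an edge *)

Section Interval.
Variable K : fieldType.
Hypothesis charK0 : [pchar K] =i pred0.

Let two_neq0 : 2 != 0 :> K. Proof. exact: char0_natr. Qed.
Let cO n := Omega_isCdga two_neq0 n.
Local Notation Om1 := (Omega K 1).

Definition Oz : Om1 := Om_t K ord_max.
Definition Oom : Om1 := Om_edge K ord0 ord_max.
Definition zpow m : Om1 := iter m (dga_mul Oz) (Om_one K 1).

Lemma OomE : Oom = dga_diff Oz.
Proof. exact: (Om1_edge charK0). Qed.

Lemma zpow_deg m : dga_comp 0 (zpow m) = zpow m.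
Proof.
elim: m => [|m IH]; first exact: Om_comp_one.
by apply: (cdga_mul_homog (cO 1) (i := 0) (j := 0)); [exact: Om_comp_t | exact: IH].
Qed.

Lemma Oom_deg : dga_comp 1 Oom = Oom.
Proof. exact: (Om_comp_edge charK0). Qed.

Lemma Oom_zpow m : dga_mul Oom (zpow m) = dga_mul (zpow m) Oom.
Proof.
by rewrite (cdga_mulC_homog (cO 1) Oom_deg (zpow_deg m)) muln0 expr0 scale1r.
Qed.

Lemma zpow_diff m : dga_diff (zpow m.+1) = m.+1%:R *: dga_mul (zpow m) Oom.
Proof.
elim: m => [|m IH].
  rewrite -[zpow 1]/(dga_mul Oz (Om_one K 1)) Om_mulr1 -OomE.
  by rewrite -[zpow 0]/(Om_one K 1) Om_mul1 scale1r.
rewrite -[zpow m.+2]/(dga_mul Oz (zpow m.+1)).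
have dz : dga_comp 0 Oz = Oz by exact: Om_comp_t.
rewrite (cdga_leibniz_homog (cO 1) _ dz) expr0 scale1r IH -OomE Oom_zpow.
rewrite (linZ (cdga_mul_linr (cO 1) _)) (cdga_mulA (cO 1)).
by rewrite -[dga_mul Oz (zpow m)]/(zpow m.+1) [m.+2%:R]mulrS scalerDl scale1r.
Qed.

Lemma integral_zpow i m : integral (pullback (vtx i) (zpow m)) = (i == ord_max)%:R ^+ m.
Proof.
elim: m => [|m IH].
  rewrite -[zpow 0]/(Om_one K 1) (pullback_one two_neq0) expr0; exact: integral_one.
rewrite -[zpow m.+1]/(dga_mul Oz (zpow m)) (pullback_mul two_neq0) (integral0_mul charK0).
rewrite exprS; congr (_ * _); [exact: (integral_pullback_t charK0) | exact: IH].
Qed.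

Lemma integral_edge01_Oom : integral (pullback (edge ord0 ord_max) Oom) = 1.
Proof.
have := @integral_pullback_edge K charK0 1 (edge ord0 ord_max) (edge ord0 ord_max) isT isT.
by rewrite !eqxx.
Qed.

Variable s : forall n, Omega K n -> Omega K n.
Hypothesis gs : gauge s.
Variable L : dgLieData K.
Hypothesis hL : isDgLie L.
Hypothesis nL : nilpotent_dgLie L.

Local Notation T n := (tensor L (Omega K n)).
Local Notation br := (@tens_br K L _).
Local Notation tS := (@tS K s L _).
Local Notation LC := (@lower_central K L).

Let tIl k n f := @tI_lin _ charK0 L k n f.
Let tCl n p := @tC_lin _ charK0 L n p.
Let tdAl n := tdA_lin hL (cO n).
Let brr n := tens_br_linr hL (cO n).
Let lbl := lie_br_linl hL.
Let lbr := lie_br_linr hL.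

Section FlowCoefficients.
Variables (x a : L).
Hypotheses (x0 : lie_comp 0 x = x) (a1 : lie_comp 1 a = a).

(** The derivative of order m + 1 at t = 0 of the curve e^(-tx) . a. *)
Definition flow_coef m : L := iter m (fun y => - lie_br x y) (lie_diff x - lie_br x a).

Lemma flow_coef_homog m : lie_comp 1 (flow_coef m) = flow_coef m.
Proof.
elim: m => [|m IH] /=.
  have h1 : lie_comp 1 (lie_diff x) = lie_diff x by exact: (lie_diff_deg hL x0).
  have h2 : lie_comp 1 (lie_br x a) = lie_br x a by exact: (lie_br_deg hL x0 a1).
  by rewrite (linB (lie_comp_lin hL _)) h1 h2.
have h : lie_comp 1 (lie_br x (flow_coef m)) = lie_br x (flow_coef m).
  exact: (lie_br_deg hL x0 IH).
by rewrite (linN (lie_comp_lin hL _)) h.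
Qed.

Lemma iter_br_LC (f : L -> L) m y : (forall k y, LC k y -> LC k.+1 (f y)) -> LC m (iter m f y).
Proof. by move=> h; elim: m => [//|m IH] /=; apply: h. Qed.

Lemma flow_coef_LC m : LC m (flow_coef m).
Proof.
apply: iter_br_LC => k y hy; rewrite -scaleN1r; apply: (@LCZ _ _ k.+1); exact: LC_brr.
Qed.

Lemma exp_act_base : lie_diff (- x) + lie_br a (- x) = - (lie_diff x - lie_br x a).
Proof.
rewrite (linN (lie_diff_lin hL)) (linN (lbr _)) (lie_br_antisym hL a1 x0) mulr0 expr0z scale1r.
by rewrite opprK opprB addrC.
Qed.

Lemma exp_act_iter m :
  iter m (lie_br (- x)) (lie_diff (- x) + lie_br a (- x)) = - flow_coef m.
Proof.
elim: m => [|m IH] /=; first exact: exp_act_base.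
by rewrite IH (linN (lbl _)) (linN (lbr _)).
Qed.

Lemma exp_act_flow k : (forall y, LC k y -> y = 0) ->
  exp_act (- x) a = a + \sum_(m < k) (m.+1)`!%:R^-1 *: flow_coef m.
Proof.
move=> hk; rewrite /exp_act (fsum_nat (N := k)) => [|m km].
  rewrite -sumrN; congr (_ + _); apply: eq_bigr => m _.
  by rewrite exp_act_iter scalerN opprK.
rewrite exp_act_iter (hk (flow_coef m)) ?oppr0 ?scaler0 //.
rewrite -(subnKC km) /flow_coef iterD; apply: iter_br_LC => l y hy.
by rewrite -scaleN1r; apply: (@LCZ _ _ l.+1); exact: LC_brr.
Qed.

(* t |-> e^{-tx} . a *)
Definition flow k : T 1 := tens a (Om_one K 1) +
  \sum_(m < k) (m.+1)`!%:R^-1 *: tens (flow_coef m) (zpow m.+1).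

(** The part of form degree 1 of the curvature of v + x ⊗ dt, for v of form degree 0 and total
    degree 1. Its vanishing is the differential equation v' = δx - [x, v]. *)
Definition transport (v : T 1) : T 1 :=
  tdA v + tdL (tens x Oom) + br (tens x Oom) v.

Lemma flow_tC k : tC 0 (flow k) = flow k.
Proof.
rewrite /flow (linD (@tCl 1 0)) (lin_sum (@tCl 1 0)) (tCE charK0) Om_comp_one.
congr (_ + _); apply: eq_bigr => m _.
by rewrite (linZ (@tCl 1 0)) (tCE charK0) zpow_deg.
Qed.

Lemma flow_start k : tI (vtx ord0) (flow k) = a.
Proof.
have h m : integral (pullback (vtx (ord0 : 'I_2)) (zpow m)) = (m == 0%N)%:R.
  by rewrite integral_zpow expr0n.
rewrite /flow (linD (@tIl _ _ _)) (lin_sum (@tIl _ _ _)) (tIE charK0).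
rewrite -[Om_one K 1]/(zpow 0) h scale1r big1 ?addr0 // => m _.
by rewrite (linZ (@tIl _ _ _)) (tIE charK0) h scale0r scaler0.
Qed.

Lemma flow_end k : (forall y, LC k y -> y = 0) ->
  tI (vtx ord_max) (flow k) = exp_act (- x) a.
Proof.
move=> hk; have h m : integral (pullback (vtx (ord_max : 'I_2)) (zpow m)) = 1.
  by rewrite integral_zpow eqxx expr1n.
rewrite (exp_act_flow hk) /flow (linD (@tIl _ _ _)) (lin_sum (@tIl _ _ _)) (tIE charK0).
rewrite -[Om_one K 1]/(zpow 0) h scale1r; congr (_ + _); apply: eq_bigr => m _.
by rewrite (linZ (@tIl _ _ _)) (tIE charK0) h scale1r.
Qed.

(** With t_m = c_m ⊗ z^m dz / m!, where c_m is [flow_coef m], the terms δx and [x, a] make up t_0,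
    and the rest telescopes to t_k - t_0. What is left is t_k, which is 0 because c_k lies in step k
    of the lower central series. *)
Lemma transport_flow k : (forall y, LC k y -> y = 0) -> transport (flow k) = 0.
Proof.
move=> hk; pose t m : T 1 := m`!%:R^-1 *: tens (flow_coef m) (dga_mul (zpow m) Oom).
have one0 := Om_comp_one K 1.
have eA : tdA (flow k) = - \sum_(m < k) t m.
  rewrite /flow (linD (@tdAl 1)) (lin_sum (@tdAl 1)) (tdAE hL (cO 1)).
  rewrite (Om_diff_one two_neq0) (lin0 (tens_linr _)) add0r -sumrN; apply: eq_bigr => m _.
  rewrite (linZ (@tdAl 1)) (tdA_pure hL (cO 1) _ (flow_coef_homog m)) zpow_diff.
  rewrite (linZ (tens_linr _)) expr1z scaleN1r scalerN; congr (- _).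
  rewrite scalerA /t factS natrM invfM mulrAC mulVf ?mul1r //; exact: char0_natr.
have eB : br (tens x Oom) (flow k) = - tens (lie_br x a) Oom + \sum_(m < k) t m.+1.
  rewrite /flow (linD (@brr 1 _)) (lin_sum (@brr 1 _)).
  rewrite (tens_br_pure hL (cO 1) _ _ Oom_deg a1) mul1r expr1z scaleN1r Om_mulr1.
  congr (_ + _); apply: eq_bigr => m _; rewrite (linZ (@brr 1 _)).
  rewrite (tens_br_pure hL (cO 1) _ _ Oom_deg (flow_coef_homog m)) mul1r expr1z scaleN1r.
  by rewrite /t Oom_zpow /= (linN (tens_linl _)).
rewrite /transport eA eB (tdLE hL) [- _ + tens _ _]addrC addrACA [- _ + \sum_(_ < _) _]addrC.
have e0 : t 0%N = tens (lie_diff x) Oom - tens (lie_br x a) Oom.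
  rewrite /t fact0 invr1 scale1r -[zpow 0]/(Om_one K 1) Om_mul1 /=.
  by rewrite (linB (tens_linl _)).
have ek : t k = 0 by rewrite /t (hk _ (flow_coef_LC k)) (lin0 (tens_linl _)) scaler0.
rewrite -e0 -sumrB; have := telescope_sumr t (leq0n k); rewrite big_mkord => ->.
by rewrite ek sub0r subrr.
Qed.

End FlowCoefficients.
End Interval.

Lemma ord2_case (P : 'I_2 -> Prop) : P ord0 -> P ord_max -> forall i, P i.
Proof.
by move=> P0 P1 [[|[|k]] h] //; [have -> : Ordinal h = ord0 | have -> : Ordinal h = ord_max];
  try exact: val_inj.
Qed.

Definition mid3 : 'I_3 := @Ordinal 3 1 isT.

Lemma ord3_case (P : 'I_3 -> Prop) : P ord0 -> P mid3 -> P ord_max -> forall i, P i.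
Proof.
by move=> P0 P1 P2 [[|[|[|k]]] h] //; [have -> : Ordinal h = ord0
  | have -> : Ordinal h = mid3 | have -> : Ordinal h = ord_max]; try exact: val_inj.
Qed.

Lemma subr_add3 (V : zmodType) (a b c a' c' : V) :
  (a + b + c) - (a' + b + c') = (a - a') + (c - c').
Proof.
rewrite [a + b]addrC [a' + b]addrC -[b + a + c]addrA -[b + a' + c']addrA opprD addrACA subrr add0r.
by rewrite opprD addrACA.
Qed.

Lemma add3_eq0 (V : zmodType) (a b c : V) : a + b + c = 0 -> a = - b - c.
Proof. by move/eqP; rewrite -addrA addr_eq0 => /eqP ->; rewrite opprD. Qed.

(** * Transport along an edge: uniqueness, and its characterisation by the gauge *)

Section Transport.
Variable K : fieldType.
Hypothesis charK0 : [pchar K] =i pred0.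
Variable s : forall n, Omega K n -> Omega K n.
Hypothesis gs : gauge s.
Let two_neq0 : 2 != 0 :> K. Proof. exact: char0_natr. Qed.
Let cO n := Omega_isCdga two_neq0 n.

Variable L : dgLieData K.
Hypothesis hL : isDgLie L.

Local Notation T n := (tensor L (Omega K n)).
Local Notation br := (@tens_br K L _).
Local Notation tS := (@tS K s L _).
Local Notation Fl := (@Fil K L (Omega K _)).
Local Notation LC := (@lower_central K L).
Local Notation Oom := (Oom K).
Local Notation Oz := (Oz K).

Let tSl n := @tS_lin _ _ gs _ hL n.
Let tPl n := @tP_lin _ charK0 L n.
Let tIl k n f := @tI_lin _ charK0 L k n f.
Let tCl n p := @tC_lin _ charK0 L n p.
Let tpbl k n f := @tpb_lin _ charK0 L k n f.
Let tdAl n := tdA_lin hL (cO n).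
Let tdLl n := @tdL_lin K L (Omega K n) hL.
Let brr n := tens_br_linr hL (cO n).

Lemma tS_0form n (u : T n) : tC 0 u = u -> tS u = 0.
Proof. by move=> <-; exact: tS_tC0. Qed.

Section DegreeOne.
Variables (n : nat) (u : T n).
Hypothesis u1 : tens_comp 1 u = u.

Lemma tdL_sq : tdL (br u u) = - (2 *: br u (tdL u)).
Proof.
rewrite (tdL_leibniz hL (cO n) u u1) expr1z scaleN1r.
rewrite (tens_br_antisym hL (cO n) (tdL_deg hL (cO n) u1) u1).
rewrite scaler_signz -[oddz _]/false.
by rewrite -opprD scaler_nat mulr2n.
Qed.

Lemma tdA_sq : tdA (br u u) = - (2 *: br u (tdA u)).
Proof.
rewrite (tdA_leibniz hL (cO n) u u1) expr1z scaleN1r.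
rewrite (tens_br_antisym hL (cO n) (tdA_deg hL (cO n) u1) u1).
rewrite scaler_signz -[oddz _]/false.
by rewrite -opprD scaler_nat mulr2n.
Qed.

Lemma jacobi_sq v : br (br u u) v = 2 *: br u (br u v).
Proof.
have := tens_jacobi hL (cO n) v u1 u1; rewrite scaler_signz -[oddz _]/true.
by move=> /eqP; rewrite -subr_eq opprK -mulr2n -scaler_nat => /eqP.
Qed.

(** Jacobi gives [[u, u], u] = 2 [u, [u, u]] and antisymmetry gives [[u, u], u] = - [u, [u, u]]; so
    three times the bracket vanishes, and 3 is invertible. *)
Lemma jacobi_cube : br u (br u u) = 0.
Proof.
have uu : tens_comp 2 (br u u) = br u u by exact: (tens_br_deg hL (cO n) u1 u1).
have := jacobi_sq u; rewrite (tens_br_antisym hL (cO n) uu u1).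
rewrite scaler_signz -[oddz _]/false => /eqP.
rewrite eq_sym -subr_eq0 opprK scaler_nat -mulrSr -scaler_nat scaler_eq0.
by rewrite (negPf (char0_natr 2 charK0)) => /eqP.
Qed.

End DegreeOne.

Lemma half2 (V : lmodType K) (v : V) : 2^-1 *: (2 *: v) = v.
Proof. by rewrite scalerA mulVf // scale1r. Qed.

Section Nilpotent.
Hypothesis nL : nilpotent_dgLie L.

Let FilA n (u : T n) : Fl 0 u := Fil_all u.
Let FilN n := @Fil_nilT K L nL n.

Lemma fixT_unique n (Phi : T n -> T n) u v : contr Phi -> u = Phi u -> v = Phi v -> u = v.
Proof. by move=> h; apply: (fix_unique (@FilA n) (@FilN n)) => k a b; apply: h. Qed.

Lemma fixT_exists n (Phi : T n -> T n) (Q : T n -> Prop) : contr Phi ->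
  Q 0 -> (forall u, Q u -> Q (Phi u)) -> exists2 u, u = Phi u & Q u.
Proof. by move=> h; apply: (fix_exists (@FilA n) (@FilN n)) => k a b; apply: h. Qed.

Lemma contr_sub n (G Phi : T n -> T n) nu : linear G -> (forall k u, Fl k u -> Fl k (G u)) ->
  contr Phi -> contr (fun u => nu - G (Phi u)).
Proof.
move=> lG hG hP k u v h; rewrite opprB addrC addrA subrK -opprB -(linB lG).
by apply/lin_spanN/hG/hP.
Qed.

Lemma contr_tS_br n (nu w : T n) : contr (fun v => nu - tS (br w v)).
Proof.
apply: contr_sub; first exact: tSl; last exact: (contr_br charK0 hL).
by move=> k v; exact: Fil_tS.
Qed.

Lemma contr_tS_sq n (nu : T n) : contr (fun v => nu - 2^-1 *: tS (br v v)).
Proof.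
apply: (@contr_sub _ (fun u => 2^-1 *: tS u)); last exact: (contr_sq charK0 hL).
  by apply: lin_scale; exact: tSl.
by move=> k v h; apply: lin_spanZ; exact: Fil_tS.
Qed.

Lemma tP_eq0 n (u v : T n) : tC 0 u = u -> tC 0 v = v ->
  (forall i, tI (vtx i) u = tI (vtx i) v) -> tP u = tP v.
Proof.
move=> u0 v0 h; apply/eqP; rewrite -subr_eq0 -(linB (@tPl n)); apply/eqP.
apply: (tP_zero0 charK0); first by rewrite (linB (@tCl n 0)) u0 v0.
by move=> i; rewrite (linB (@tIl _ _ _)) h subrr.
Qed.

Lemma tP_eq1 n (u v : T n) : tC 1 u = u -> tC 1 v = v ->
  (forall i j : 'I_n.+1, (i < j)%N -> tI (edge i j) u = tI (edge i j) v) -> tP u = tP v.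
Proof.
move=> u0 v0 h; apply/eqP; rewrite -subr_eq0 -(linB (@tPl n)); apply/eqP.
apply: (tP_zero1 charK0); first by rewrite (linB (@tCl n 1)) u0 v0.
by move=> i j ij; rewrite (linB (@tIl _ _ _)) h ?subrr.
Qed.

Lemma tens_comp_pure_form n p i (x : L) (a : Omega K n) : lie_comp p x = x -> dga_comp i a = a ->
  tens_comp (p + i%:Z) (tens x a) = tens x a.
Proof. by move=> xp ai; rewrite (tens_comp_pure hL (cO n) _ xp ai) eqxx. Qed.

Section Interval.
Variable x : L.
Hypothesis x0 : lie_comp 0 x = x.

(** The difference U of two solutions satisfies d U = - [x dt, U], which lies deeper in the
    filtration, and P U is U(1) ⊗ t_1 as U vanishes at the start. Rigidity applies because the
    integral of dt_1 is 1. *)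
Lemma transport_unique v v' : tC 0 v = v -> tC 0 v' = v' ->
  transport x v = 0 -> transport x v' = 0 -> tI (vtx ord0) v = tI (vtx ord0) v' -> v = v'.
Proof.
move=> v0 v0' ev ev' h; apply/eqP; rewrite -subr_eq0; apply/eqP; set U := v - v'.
have U0 : tC 0 U = U by rewrite (linB (@tCl 1 0)) v0 v0'.
have UE : tdA U = - br (tens x Oom) U.
  have e : transport x v - transport x v' = tdA U + br (tens x Oom) U.
    rewrite /transport (linB (@tdAl 1)) (linB (@brr 1 _)).
    exact: subr_add3.
  by apply/eqP; rewrite -addr_eq0 -e ev ev' subrr.
apply: (rigid charK0 gs hL nL (tau := Oz) (y := tI (vtx ord_max) U)
  (la := fun a => integral (pullback (edge ord0 ord_max) a))).
- exact: integral_pullback_lin.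
- by rewrite -(OomE charK0) (integral_edge01_Oom charK0) oner_neq0.
- exact: tS_0form.
- by move=> k hk; rewrite UE; apply: lin_spanN; exact: (Fil_brr hL (cO 1)).
rewrite -(tP_t charK0 (n := 1)); apply: tP_eq0; [exact: U0 | exact: tC_t |].
apply: ord2_case; rewrite (tI_vtx_t charK0 (n := 1)).
  by rewrite scale0r (linB (@tIl _ _ _)) h subrr.
by rewrite eqxx scale1r.
Qed.

Lemma tI_vtx_homog n (i : 'I_n.+1) (v : T n) p : tens_comp p v = v ->
  lie_comp p (tI (vtx i) v) = tI (vtx i) v.
Proof. by move=> v1; rewrite -[in RHS](tI_comp charK0 hL (vtx i) v1) subr0. Qed.

Lemma transport_end v : tens_comp 1 v = v -> tC 0 v = v -> transport x v = 0 ->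
  tI (vtx ord_max) v = exp_act (- x) (tI (vtx ord0) v).
Proof.
move=> v1 v0 ev; have a1 := tI_vtx_homog ord0 v1.
have [k hk] := nL; have hk' y : LC k y -> y = 0 by exact: hk.
rewrite -(flow_end charK0 hL x0 a1 hk'); congr (tI _ _).
apply: transport_unique; [exact: v0 | exact: flow_tC | exact: ev | |].
  exact: (transport_flow charK0 hL x0 a1 hk').
exact/esym/(flow_start charK0).
Qed.

(** The flow also solves v = P v - s [x dt, v]: the homotopy formula turns its differential equation
    into this one, since s kills functions and the elementary form x dt. With equal endpoints P v
    and P of the flow agree, so the contraction makes v equal to the flow. *)
Lemma transport_fix v : tC 0 v = v -> lie_comp 1 (tI (vtx ord0) v) = tI (vtx ord0) v ->
  v = tP v - tS (br (tens x Oom) v) ->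
  tI (vtx ord_max) v = exp_act (- x) (tI (vtx ord0) v) -> transport x v = 0.
Proof.
move=> v0 a1 ev h; have [k hk] := nL; have hk' y : LC k y -> y = 0 by exact: hk.
set a := tI _ _ in a1 h; pose f := flow x a k.
have ef : transport x f = 0 by exact: (transport_flow charK0 hL x0 a1 hk').
have f0 : tC 0 f = f by exact: flow_tC.
suff -> : v = f by exact: ef.
apply: (fixT_unique (Phi := fun t => tP v - tS (br (tens x Oom) t)));
  [exact: contr_tS_br | exact: ev |].
have <- : tP f = tP v.
  apply: tP_eq0; [exact: f0 | exact: v0 |].
  apply: ord2_case; first exact: (flow_start charK0).
  rewrite h; exact: (flow_end charK0 hL x0 a1 hk').
have := t_homotopy charK0 gs hL f; rewrite (tS_0form f0) (lin0 (@tdAl 1)) add0r => /eqP.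
rewrite subr_eq => /eqP {1}->; rewrite addrC; congr (_ + _).
have -> : tdA f = - tdL (tens x Oom) - br (tens x Oom) f.
  by apply: add3_eq0; exact: ef.
rewrite (linB (@tSl 1)) (linN (@tSl 1)) (tS_tdL gs hL).
rewrite (tS_edge charK0 gs hL x (isT : (ord0 : 'I_2) < (ord_max : 'I_2))%N).
by rewrite (lin0 (@tdLl 1)) !oppr0 add0r.
Qed.

End Interval.

(** On an interval d u = 0 for degree reasons, so s u = 0 and the homotopy formula leave u = P u,
    which is determined by one integral. *)
Lemma edge_form (u : T 1) : tC 1 u = u -> tS u = 0 ->
  u = tens (tI (edge ord0 ord_max) u) Oom.
Proof.
move=> u1 su; set y := tI _ _; set U := tens y Oom.
have U1 : tC 1 U = U by exact: tC_edge.
have z : tdA u = 0.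
  apply: (@tC_bound' K charK0 L 1 2 _ isT).
  by rewrite (tC_tdA charK0 hL) u1.
have := t_homotopy charK0 gs hL u; rewrite su z (lin0 (@tdAl 1)) (lin0 (@tSl 1)) addr0.
move/eqP; rewrite subr_eq0 => /eqP ->.
rewrite -[RHS](tP_edge charK0 y (isT : (ord0 : 'I_2) < (ord_max : 'I_2))%N).
apply: tP_eq1; [exact: u1 | exact: U1 |].
apply: ord2_case; apply: ord2_case => // ij.
by rewrite (tI_edge_edge charK0 y ij ij) scale1r.
Qed.

Lemma tpb_edge_form n (i j : 'I_n.+1) (u : T n) : (i <= j)%N -> tC 1 u = u -> tS u = 0 ->
  tpb (edge i j) u = tens (tI (edge i j) u) Oom.
Proof.
move=> ij u1 su; have ec : edge i j \o edge ord0 ord_max = edge i j.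
  by apply: funext; apply: ord2_case.
have e : tI (edge ord0 ord_max) (tpb (edge i j) u) = tI (edge i j) u.
  by rewrite (tI_tpb charK0 (edge i j) (edge ord0 ord_max) u) ec.
have h1 : tC 1 (tpb (edge i j) u) = tpb (edge i j) u.
  by rewrite -(tpb_tC charK0) u1.
have h2 : tS (tpb (edge i j) u) = 0.
  have := tpb_tS charK0 gs hL (edge_mono ij) u; rewrite su => <-.
  exact: (lin0 (@tpbl _ _ _)).
exact: (etrans (edge_form h1 h2) (f_equal (fun y => tens y Oom) e)).
Qed.

End Nilpotent.
End Transport.

Opaque tens tlift tens_br tens_comp Om_edge Om_t.

Lemma lin_add2 (K : pzRingType) (U V : lmodType K) (f : U -> V) a b a' b' :
  linear f -> f a = a' -> f b = b' -> f (a + b) = a' + b'.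
Proof. by move=> lf <- <-; apply: (linD lf). Qed.

(** * Flat triangles *)

Section Triangle.
Variable K : fieldType.
Hypothesis charK0 : [pchar K] =i pred0.
Variable s : forall n, Omega K n -> Omega K n.
Hypothesis gs : gauge s.
Let two_neq0 : 2 != 0 :> K. Proof. exact: char0_natr. Qed.
Let cO n := Omega_isCdga two_neq0 n.

Variable L : dgLieData K.
Hypothesis hL : isDgLie L.
Hypothesis nL : nilpotent_dgLie L.

Local Notation T n := (tensor L (Omega K n)).
Local Notation br := (@tens_br K L _).
Local Notation tS := (@tS K s L _).
Local Notation Fl := (@Fil K L (Omega K _)).
Local Notation LC := (@lower_central K L).
Local Notation Oom := (Oom K).
Local Notation v0 := (ord0 : 'I_3).
Local Notation v1 := mid3.
Local Notation v2 := (ord_max : 'I_3).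

Let tSl n := @tS_lin _ _ gs _ hL n.
Let tPl n := @tP_lin _ charK0 L n.
Let tIl k n f := @tI_lin _ charK0 L k n f.
Let tCl n p := @tC_lin _ charK0 L n p.
Let tpbl k n f := @tpb_lin _ charK0 L k n f.
Let tdAl n := tdA_lin hL (cO n).
Let tdLl n := @tdL_lin K L (Omega K n) hL.
Let brl n := tens_br_linl hL (cO n).
Let brr n := tens_br_linr hL (cO n).
Let tcl n := tens_comp_lin hL (cO n).

Let l01 : (v0 <= v1)%N. Proof. by []. Qed.
Let l12 : (v1 <= v2)%N. Proof. by []. Qed.
Let l02 : (v0 <= v2)%N. Proof. by []. Qed.
Let s01 : (v0 < v1)%N. Proof. by []. Qed.
Let s12 : (v1 < v2)%N. Proof. by []. Qed.
Let s02 : (v0 < v2)%N. Proof. by []. Qed.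

(** The coefficient with which the edge ij enters the integral over the triangle of the differential
    of a combination of elementary 1-forms. *)
Definition kap (i j : 'I_3) : K :=
  integral (pullback (fun p : 'I_3 => p) (dga_diff (Om_edge K i j))).

Lemma kap02 : kap v0 v2 != 0.
Proof.
have k2 : integral (dga_diff (Om_edge K v0 v2)) = -1 by exact: (integral2_edge charK0).
rewrite /kap; suff -> : pullback (fun p : 'I_3 => p) (dga_diff (Om_edge K v0 v2)) =
    dga_diff (Om_edge K v0 v2) by rewrite k2 oppr_eq0 oner_neq0.
have pt i : pullback (fun p : 'I_3 => p) (Om_t K i) = Om_t K i.
  rewrite (pullback_t two_neq0) (big_pred1 i) // => j; by [].
by rewrite (pullback_diff two_neq0) (pullback_edge charK0) !pt.
Qed.

(** Connections on the triangle with values in degree 0 of L and in the gauge s. The equation is the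
    part of form degree 2 of the Maurer-Cartan equation, where only [tdA] occurs. *)
Definition flat2 (u : T 2) := [/\ tens_comp 1 u = u, tC 1 u = u, tS u = 0
  & tdA u + 2^-1 *: br u u = 0].

Lemma tI_tS k n (f : monotone_map k n) (w : T n) : tI f (tS w) = 0.
Proof.
have := tI_top charK0 (tpb f (tS w)) id k; rewrite eqxx (tI_tpb charK0) => <-.
rewrite (tpb_tS charK0 gs hL) (tC_tS charK0 gs hL).
have -> : tC k.+1 (tpb f w) = 0 by apply: (tC_bound charK0).
by rewrite (lin0 (@tSl k)) (lin0 (@tIl _ _ _)).
Qed.

Lemma tP_single1 (u : T 2) : tC 1 u = u -> tI (edge v0 v1) u = 0 -> tI (edge v1 v2) u = 0 ->
  tP u = tens (tI (edge v0 v2) u) (Om_edge K v0 v2).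
Proof.
move=> u1 e01 e12; rewrite -[RHS](tP_edge charK0 _ s02).
apply: (tP_eq1 charK0); [exact: u1 | exact: tC_edge |].
have E (i j : 'I_3) (ij : (i < j)%N) := tI_edge_edge charK0 (tI (edge v0 v2) u) ij s02.
apply: ord3_case; apply: ord3_case => // ij; rewrite E ?e01 ?e12 ?scale0r //.
by rewrite scale1r.
Qed.

Lemma rigid2 (u : T 2) : tC 1 u = u -> tS u = 0 -> tI (edge v0 v1) u = 0 ->
  tI (edge v1 v2) u = 0 -> (forall k, Fl k u -> Fl k.+1 (tdA u)) -> u = 0.
Proof.
move=> u1 su e01 e12 hu; apply: (rigid charK0 gs hL nL (tau := Om_edge K v0 v2)
  (la := fun a => integral (pullback (fun p : 'I_3 => p) a))
  (y := tI (edge v0 v2) u)).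
- exact: integral_pullback_lin.
- exact: kap02.
- exact: su.
- exact: hu.
- exact: tP_single1.
Qed.

(** The difference has only ω_02 in its projection, and its differential, - ([u, u] - [u', u']) / 2,
    lies deeper in the filtration. Since d ω_02 has a nonzero integral, rigidity applies. *)
Lemma flat2_unique u u' : flat2 u -> flat2 u' ->
  tI (edge v0 v1) u = tI (edge v0 v1) u' -> tI (edge v1 v2) u = tI (edge v1 v2) u' -> u = u'.
Proof.
move=> [_ c1 su fu] [_ c1' su' fu'] e01 e12; apply/eqP; rewrite -subr_eq0; apply/eqP.
apply: rigid2.
- by rewrite (linB (@tCl 2 1)) c1 c1'.
- by rewrite (linB (@tSl 2)) su su' subrr.
- by rewrite (linB (@tIl _ _ _)) e01 subrr.
- by rewrite (linB (@tIl _ _ _)) e12 subrr.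
move=> k hk; have -> : tdA (u - u') = - (2^-1 *: (br u u - br u' u')).
  rewrite (linB (@tdAl 2)); move/eqP: fu; rewrite addr_eq0 => /eqP ->.
  by move/eqP: fu'; rewrite addr_eq0 => /eqP ->; rewrite scalerBr opprD.
by apply/lin_spanN/lin_spanZ; exact: (contr_sq charK0 hL).
Qed.

Section Action.
Variable u : T 2.
Hypothesis fu : flat2 u.

Let u1 : tens_comp 1 u = u. Proof. by case: fu. Qed.
Let uC : tC 1 u = u. Proof. by case: fu. Qed.
Let uS : tS u = 0. Proof. by case: fu. Qed.
Let uF : tdA u = - (2^-1 *: br u u).
Proof. by case: fu => _ _ _ /eqP; rewrite addr_eq0 => /eqP. Qed.

Lemma flat2_edge_homog i j : lie_comp 0 (tI (edge i j) u) = tI (edge i j) u.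
Proof. exact: (tI_comp charK0 hL (edge i j) u1). Qed.

(** The part of form degree 1 of the curvature of u + v, for v of form degree 0. It vanishes when v
    is transported by the connection u over the whole triangle. *)
Definition defect (v : T 2) := tdA v + tdL u + br u v.

(** A Bianchi identity: flatness of u replaces d u by - [u, u] / 2, and Jacobi for an odd u does the
    rest. *)
Lemma tdA_defect v : tens_comp 1 v = v -> tdA (defect v) = - br u (defect v).
Proof.
move=> h1; rewrite /defect !(linD (@tdAl 2)) !(linD (@brr 2 u)).
rewrite (tdA2 hL (cO 2)) add0r (tdA_tdL hL (cO 2)) {1}uF (linN (@tdLl 2)) opprK.
rewrite (linZ (@tdLl 2)) (tdL_sq charK0 hL u1) scalerN (half2 charK0).
rewrite (tdA_leibniz hL (cO 2) v u1) expr1z scaleN1r uF (linN (@brl 2 v)) (linZ (@brl 2 v)).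
rewrite (jacobi_sq charK0 hL u1) (half2 charK0) !opprD.
by rewrite addrA addrC addrA.
Qed.

Lemma tpb_defect v (i j : 'I_3) (ij : (i <= j)%N) :
  tpb (edge i j) (defect v) = transport (tI (edge i j) u) (tpb (edge i j) v).
Proof.
rewrite /defect /transport !(linD (@tpbl _ _ _)) (tpb_tdA charK0 hL) (tpb_tdL charK0 hL).
by rewrite (tpb_br charK0 hL) (tpb_edge_form charK0 gs hL ij uC uS).
Qed.

Lemma tI_vtx_edge (i j : 'I_3) (v : T 2) (p : 'I_2) :
  tI (vtx p) (tpb (edge i j) v) = tI (vtx (edge i j p)) v.
Proof. by rewrite (tI_tpb charK0). Qed.

(** The gauge-projected transport equation has a solution for arbitrary values at the vertices;
    whether it solves the true equation depends on these values. *)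
Lemma act_exists (a : 'I_3 -> L) : (forall i, lie_comp 1 (a i) = a i) ->
  exists v : T 2, [/\ tens_comp 1 v = v, tC 0 v = v, forall i, tI (vtx i) v = a i &
    v = tP v - tS (br u v)].
Proof.
move=> a1; pose nu : T 2 := \sum_i tens (a i) (Om_t K i).
have [v ev [h1 h0]] : exists2 v, v = nu - tS (br u v) & tens_comp 1 v = v /\ tC 0 v = v.
  apply: (fixT_exists (L := L) nL (Phi := fun v => nu - tS (br u v))
    (Q := fun v => tens_comp 1 v = v /\ tC 0 v = v)).
  - exact: (contr_tS_br charK0 gs hL).
  - by rewrite (lin0 (@tcl 2 1)) (lin0 (@tCl 2 0)).
  move=> v [h1 h0]; rewrite (linB (@tcl 2 1)) (linB (@tCl 2 0)).
  have -> : tens_comp 1 nu = nu.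
    rewrite (lin_sum (@tcl 2 1)); apply: eq_bigr => i _.
    exact: (tens_comp_pure_form charK0 hL (a1 i) (Om_comp_t K i)).
  have -> : tC 0 nu = nu.
    by rewrite (lin_sum (@tCl 2 0)); apply: eq_bigr => i _; exact: (tC_t charK0).
  have uv2 : tens_comp (1 + 1) (br u v) = br u v by exact: (tens_br_deg hL (cO 2) u1 h1).
  have -> : tens_comp 1 (tS (br u v)) = tS (br u v) by exact: (tS_comp charK0 gs hL uv2).
  rewrite (tC_tS charK0 gs hL).
  by have -> : tC 1 (br u v) = br u v by exact: (tC_br charK0 hL uC h0).
have nuI i : tI (vtx i) nu = a i.
  rewrite (lin_sum (@tIl _ _ _)) (bigD1 i) //= (tI_vtx_t charK0) eqxx scale1r.
  rewrite big1 ?addr0 // => j ji; rewrite (tI_vtx_t charK0) eq_sym (negPf ji).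
  exact: scale0r.
have Pnu : tP nu = nu.
  by rewrite (lin_sum (@tPl 2)); apply: eq_bigr => i _; rewrite (tP_t charK0).
have Pv : tP v = nu.
  by rewrite ev (linB (@tPl 2)) Pnu (tP_tS charK0 gs hL) subr0.
exists v; split => //; last by rewrite Pv.
move=> i; rewrite ev (linB (@tIl _ _ _)) nuI.
by rewrite (tI_tS (vtx_mono i)) subr0.
Qed.

Lemma exp_act_homog (x a : L) : lie_comp 0 x = x -> lie_comp 1 a = a ->
  lie_comp 1 (exp_act (- x) a) = exp_act (- x) a.
Proof.
move=> x0 a1; have [k hk] := nL; have hk' y : LC k y -> y = 0 by exact: hk.
rewrite (exp_act_flow hL x0 a1 hk') (linD (lie_comp_lin hL _)) a1; congr (_ + _).
rewrite (lin_sum (lie_comp_lin hL _)); apply: eq_bigr => m _.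
by rewrite (linZ (lie_comp_lin hL _)) (flow_coef_homog hL x0 a1).
Qed.

(** A flat connection transports along 02 as along 01 followed by 12. A projected solution v with
    vertex values transported along 01 and 12 has a defect with zero integral on these two edges;
    the defect is also killed by s, and its differential lies deeper in the filtration, so rigidity
    makes it vanish. Hence v is transported along 02 as well. *)
Lemma flat2_act a0 : lie_comp 1 a0 = a0 -> exp_act (- tI (edge v0 v2) u) a0 =
  exp_act (- tI (edge v1 v2) u) (exp_act (- tI (edge v0 v1) u) a0).
Proof.
move=> h0; pose x01 := tI (edge v0 v1) u; pose x12 := tI (edge v1 v2) u.
pose a1 := exp_act (- x01) a0; pose a2 := exp_act (- x12) a1.
have h1 : lie_comp 1 a1 = a1 by exact: (exp_act_homog (flat2_edge_homog _ _) h0).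
have h2 : lie_comp 1 a2 = a2 by exact: (exp_act_homog (flat2_edge_homog _ _) h1).
pose a (i : 'I_3) := if i == v0 then a0 else if i == v1 then a1 else a2.
have ha i : lie_comp 1 (a i) = a i by rewrite /a; case: ifP => _ //; case: ifP.
have [v [hv1 hv0 hva ev]] := act_exists ha.
have tC0e i j : tC 0 (tpb (edge i j) v) = tpb (edge i j) v.
  by rewrite -(tpb_tC charK0) hv0.
have tc1e i j : tens_comp 1 (tpb (edge i j) v) = tpb (edge i j) v.
  by rewrite -(tpb_comp charK0 hL) hv1.
have E (i j : 'I_3) (ij : (i <= j)%N) : a j = exp_act (- tI (edge i j) u) (a i) ->
    tI (edge i j) (defect v) = 0.
  move=> aij; have hI p := tI_vtx_edge i j v p.
  have e : transport (tI (edge i j) u) (tpb (edge i j) v) = 0.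
    apply: (transport_fix charK0 gs hL nL (flat2_edge_homog i j) (tC0e i j)).
    - by rewrite (hI ord0) hva; exact: ha.
    - rewrite {1}ev (linB (@tpbl _ _ _)).
      have -> := tpb_tP charK0 gs (edge_mono ij) v.
      have -> := tpb_tS charK0 gs hL (edge_mono ij) (br u v).
      by rewrite (tpb_br charK0 hL) (tpb_edge_form charK0 gs hL ij uC uS).
    - by rewrite (hI ord0) (hI ord_max) !hva.
  have ec : edge i j \o edge ord0 ord_max = edge i j.
    by apply: funext; apply: ord2_case.
  by rewrite -ec -(tI_tpb charK0) (tpb_defect _ ij) e (lin0 (@tIl _ _ _)).
have D0 : defect v = 0.
  apply: rigid2.
  - rewrite /defect !(linD (@tCl 2 1)) (tC_tdA charK0 hL) (tC_tdL charK0 hL) hv0 uC.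
    by have -> : tC 1 (br u v) = br u v by exact: (tC_br charK0 hL uC hv0).
  - rewrite /defect !(linD (@tSl 2)) (tS_tdL gs hL) uS (lin0 (@tdLl 2)) oppr0 addr0.
    have := t_homotopy charK0 gs hL v; rewrite (tS_0form charK0 gs hL hv0).
    by rewrite (lin0 (@tdAl 2)) add0r {1}ev addrAC subrr sub0r => <-; rewrite addNr.
  - exact: (E v0 v1 l01 (erefl a1)).
  - exact: (E v1 v2 l12 (erefl a2)).
  by move=> k hk; rewrite (tdA_defect hv1); apply: lin_spanN; exact: (Fil_brr hL (cO 2)).
have e02 : transport (tI (edge v0 v2) u) (tpb (edge v0 v2) v) = 0.
  by rewrite -(tpb_defect _ l02) D0 (lin0 (@tpbl _ _ _)).
have := transport_end charK0 gs hL nL (flat2_edge_homog v0 v2) (tc1e v0 v2) (tC0e v0 v2) e02.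
rewrite (tI_vtx_edge v0 v2 v ord0) (tI_vtx_edge v0 v2 v ord_max) !hva => e.
exact: (esym e).
Qed.

End Action.

Lemma tP_comp p n (u : T n) : tens_comp p u = u -> tens_comp p (tP u) = tP u.
Proof.
move=> up; have := t_homotopy charK0 gs hL u => /eqP; rewrite subr_eq addrC -subr_eq => /eqP <-.
rewrite (linB (@tcl n p)) up (linD (@tcl n p)).
have h1 := tdA_deg hL (cO n) (tS_comp charK0 gs hL up); rewrite subrK in h1.
have h2 := tS_comp charK0 gs hL (tdA_deg hL (cO n) up); rewrite addrK in h2.
by rewrite h1 h2.
Qed.

Section Horn.
Variables (x y : L).
Hypotheses (x0 : lie_comp 0 x = x) (y0 : lie_comp 0 y = y).
Local Notation top := (fun p : 'I_3 => p).

(* The value z0 + J [u, u] of u on the edge 02 makes the curvature of u have integral 0. *)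
Variables (J : T 2 -> L) (z0 : L).
Hypotheses (JL : linear J) (Jfil : forall k w, Fl k w -> LC k (J w))
  (Jh : forall w, tens_comp 2 w = w -> lie_comp 0 (J w) = J w)
  (z0h : lie_comp 0 z0 = z0)
  (JE : forall w, kap v0 v2 *: J w = - (2^-1 *: tI top (tP w)))
  (z0E : kap v0 v2 *: z0 = - (kap v0 v1 *: x + kap v1 v2 *: y)).
Let F (w : T 2) : T 2 := tens (J w) (Om_edge K v0 v2).
Let G (w : T 2) : T 2 := 2^-1 *: tS w.
Let nu : T 2 := tens x (Om_edge K v0 v1) + tens y (Om_edge K v1 v2) +
  tens z0 (Om_edge K v0 v2).
Let Phi w := nu + F (br w w) - G (br w w).

Let FL : linear F. Proof. exact: (lin_comp (tens_linl _) JL). Qed.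
Let GL : linear G. Proof. by apply: lin_scale; exact: tSl. Qed.

Let horn_contr : contr Phi.
Proof.
apply: (contr_affine nu FL GL); last exact: (contr_sq charK0 hL).
  by move=> k w hw; apply/Fil_pure/Jfil.
by move=> k w hw; apply: lin_spanZ; exact: (Fil_tS gs hL).
Qed.

Let edge_comp (i j : 'I_3) (a : L) : lie_comp 0 a = a ->
  tens_comp 1 (tens a (Om_edge K i j) : T 2) = tens a (Om_edge K i j).
Proof. by move=> a0; exact: (tens_comp_pure_form charK0 hL a0 (Om_comp_edge charK0 i j)). Qed.

Let tdA_edge (i j : 'I_3) (a : L) : lie_comp 0 a = a ->
  tI top (tdA (tens a (Om_edge K i j))) = kap i j *: a.
Proof.
move=> a0.
rewrite (tdA_pure hL (cO 2) _ a0).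
rewrite expr0z scale1r.
rewrite (tIE charK0).
reflexivity.
Qed.

(** At a solution u of the fixed point equation the curvature C satisfies s C = 0, and d C = 0
    because there are no 3-forms. So C = P C is determined by one integral, the one that the choice
    of the edge 02 cancels. *)
Lemma horn_aux : exists u, [/\ flat2 u, tI (edge v0 v1) u = x & tI (edge v1 v2) u = y].
Proof.
have [u eu [u1 uC]] : exists2 u, u = Phi u & tens_comp 1 u = u /\ tC 1 u = u.
  apply: (fixT_exists (L := L) nL (Q := fun u => tens_comp 1 u = u /\ tC 1 u = u) horn_contr).
    by rewrite (lin0 (@tcl 2 1)) (lin0 (@tCl 2 1)).
  move=> u [u1 uC].
  have B1 : tens_comp 2 (br u u) = br u u by exact: (tens_br_deg hL (cO 2) u1 u1).
  have BC : tC 2 (br u u) = br u u by exact: (tC_br charK0 hL uC uC).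
  have S1 : tens_comp 1 (tS (br u u)) = tS (br u u) by exact: (tS_comp charK0 gs hL B1).
  rewrite /Phi /nu /F /G; split.
    apply: (lin_add2 (@tcl 2 1)).
      have h3 := lin_add2 (@tcl 2 1) (edge_comp v0 v1 x0) (edge_comp v1 v2 y0).
      have h4 := lin_add2 (@tcl 2 1) h3 (edge_comp v0 v2 z0h).
      exact: (lin_add2 (@tcl 2 1) h4 (edge_comp v0 v2 (Jh B1))).
    by rewrite (linN (@tcl 2 1)) (linZ (@tcl 2 1)) S1.
  apply: (lin_add2 (@tCl 2 1)).
    have h3 := lin_add2 (@tCl 2 1) (tC_edge charK0 v0 v1 x) (tC_edge charK0 v1 v2 y).
    have h4 := lin_add2 (@tCl 2 1) h3 (tC_edge charK0 v0 v2 z0).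
    exact: (lin_add2 (@tCl 2 1) h4 (tC_edge charK0 v0 v2 _)).
  by rewrite (linN (@tCl 2 1)) (linZ (@tCl 2 1)) (tC_tS charK0 gs hL) BC.
set B := br u u in eu *.
have B1 : tens_comp 2 B = B by exact: (tens_br_deg hL (cO 2) u1 u1).
have BC : tC 2 B = B by exact: (tC_br charK0 hL uC uC).
have form3 (w : T 2) : tC 2 w = w -> tdA w = 0.
  move=> wC; apply: (@tC_bound' K charK0 L 2 3 _ isT).
  by rewrite (tC_tdA charK0 hL) wC.
have euB : u = nu + F B - G B by exact: eu.
have PnuF : tP (nu + F B) = nu + F B.
  have h3 := lin_add2 (@tPl 2) (tP_edge charK0 x s01) (tP_edge charK0 y s12).
  have h4 := lin_add2 (@tPl 2) h3 (tP_edge charK0 z0 s02).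
  exact: (lin_add2 (@tPl 2) h4 (tP_edge charK0 _ s02)).
have Pu : tP u = nu + F B.
  by rewrite euB (linB (@tPl 2)) PnuF /G (linZ (@tPl 2)) (tP_tS charK0 gs hL) scaler0 subr0.
have uS : tS u = 0.
  rewrite euB (linB (@tSl 2)) -PnuF (tS_tP charK0 gs hL) /G (linZ (@tSl 2)).
  by rewrite (tS2 gs hL) scaler0 subr0.
have uI (i j : 'I_3) (ij : (i <= j)%N) : tI (edge i j) u = tI (edge i j) (nu + F B).
  rewrite {1}euB (linB (@tIl _ _ _)) /G (linZ (@tIl _ _ _)).
  by rewrite (tI_tS (edge_mono ij)) scaler0 subr0.
exists u; split; last 2 first.
- rewrite (uI _ _ l01); have lI := @tIl 1 2 (edge v0 v1).
  have h3 := lin_add2 lI (tI_edge_edge charK0 x s01 s01) (tI_edge_edge charK0 y s01 s12).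
  have h4 := lin_add2 lI h3 (tI_edge_edge charK0 z0 s01 s02).
  apply: (etrans (lin_add2 lI h4 (tI_edge_edge charK0 _ s01 s02))).
  by rewrite !scale0r !addr0 scale1r.
- rewrite (uI _ _ l12); have lI := @tIl 1 2 (edge v1 v2).
  have h3 := lin_add2 lI (tI_edge_edge charK0 x s12 s01) (tI_edge_edge charK0 y s12 s12).
  have h4 := lin_add2 lI h3 (tI_edge_edge charK0 z0 s12 s02).
  apply: (etrans (lin_add2 lI h4 (tI_edge_edge charK0 _ s12 s02))).
  by rewrite !scale0r !addr0 add0r scale1r.
split => //; set C := tdA u + _.
have CC : tC 2 C = C.
  by rewrite (linD (@tCl 2 2)) (linZ (@tCl 2 2)) BC (tC_tdA charK0 hL) uC.
have SC : tS C = 0.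
  rewrite (linD (@tSl 2)) (linZ (@tSl 2)).
  have e : u - tP u = - G B by rewrite Pu {1}euB addrAC subrr sub0r.
  have := t_homotopy charK0 gs hL u; rewrite uS (lin0 (@tdAl 2)) add0r e => <-.
  exact: addNr.
have := t_homotopy charK0 gs hL C; rewrite SC (form3 C CC) (lin0 (@tdAl 2)) (lin0 (@tSl 2)).
rewrite addr0 => /eqP; rewrite subr_eq0 => /eqP ->.
apply: (tP_zero_top charK0 CC).
(* As d B = 0, the homotopy formula reads B - P B = d s B; this replaces B / 2 - d s B / 2 by P B /
   2. *)
have -> : C = tdA (nu + F B) + 2^-1 *: tP B.
  rewrite /C {1}euB (linB (@tdAl 2)) /G (linZ (@tdAl 2)).
  have := t_homotopy charK0 gs hL B; rewrite (form3 B BC) (lin0 (@tSl 2)) addr0 => <-.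
  by rewrite scalerBr opprB -addrA subrK.
have lI : linear (fun w : T 2 => tI top (tdA w)).
  exact: (lin_comp (@tIl _ _ top) (@tdAl 2)).
have h3 := lin_add2 lI (tdA_edge v0 v1 x0) (tdA_edge v1 v2 y0).
have h4 := lin_add2 lI h3 (tdA_edge v0 v2 z0h).
have h5 := lin_add2 lI h4 (tdA_edge v0 v2 (Jh B1)).
have h6 : tI top (2^-1 *: tP B) = 2^-1 *: tI top (tP B) by exact: (linZ (@tIl _ _ top)).
apply: (etrans (lin_add2 (@tIl _ _ top) h5 h6)).
have fin (a b c d e : L) : c = - (a + b) -> d = - e -> a + b + c + d + e = 0.
  by move=> -> ->; rewrite subrr sub0r addNr.
exact: (fin _ _ _ _ _ z0E (JE B)).
Qed.

End Horn.

Lemma horn x y : lie_comp 0 x = x -> lie_comp 0 y = y ->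
  exists u, [/\ flat2 u, tI (edge v0 v1) u = x & tI (edge v1 v2) u = y].
Proof.
move=> x0 y0; pose top (p : 'I_3) := p.
have kz (v : L) : kap v0 v2 *: (- (kap v0 v2)^-1 *: v) = - v.
  by rewrite scalerA mulrN mulfV ?kap02 // scaleN1r.
pose J (w : T 2) : L := - (kap v0 v2)^-1 *: (2^-1 *: tI top (tP w)).
apply: (horn_aux x0 y0 (J := J)
  (z0 := - (kap v0 v2)^-1 *: (kap v0 v1 *: x + kap v1 v2 *: y))).
- by apply: lin_scale; apply: lin_scale; apply: (lin_comp (@tIl _ _ _)); exact: tPl.
- move=> k w hw; apply/LCZ/LCZ; apply: (Fil_tI charK0); exact: (Fil_tP charK0).
- move=> w w2; rewrite /J !(linZ (lie_comp_lin hL _)); congr (_ *: (_ *: _)).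
  exact: (tI_comp charK0 hL top (tP_comp w2)).
- rewrite (linZ (lie_comp_lin hL _)) (linD (lie_comp_lin hL _)).
  by rewrite !(linZ (lie_comp_lin hL _)) x0 y0.
- by move=> w; rewrite /J kz.
- exact: kz.
Qed.
End Triangle.

(** * The logarithm of the gauge action *)

Section LogExp.
Variable K : fieldType.
Hypothesis charK0 : [pchar K] =i pred0.
Variable B : nat.

Definition texp : {poly K} := \poly_(i < B.+1) (i`!%:R^-1).
Definition tlog_exp : {poly K} :=
  \sum_(k < B.+1) ((-1) ^+ k / k.+1%:R) *: (texp - 1) ^+ k.+1.

Lemma poly_X_dvd (p : {poly K}) n : (forall i, (i < n)%N -> p`_i = 0) ->
  exists q, p = q * 'X^n.
Proof.
move=> h; exists (drop_poly n p); rewrite -[LHS](poly_take_drop n) [take_poly n p](_ : _ = 0) ?add0r //.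
by apply/polyP => i; rewrite coef_take_poly coef0; case: ifP => // /h.
Qed.

Lemma texp_sub1 : exists q, texp - 1 = q * 'X.
Proof.
have h i : (i < 1)%N -> (texp - 1)`_i = 0.
  case: i => // _; rewrite coefB coef_poly coef1 /= fact0 invr1; exact: subrr.
by have [q ->] := poly_X_dvd h; exists q; rewrite expr1.
Qed.

Lemma deriv_texp : texp^`() = texp - (B`!%:R^-1) *: 'X^B.
Proof.
apply/polyP => i; rewrite coef_deriv coefB coefZ coefXn !coef_poly !ltnS.
case: (ltngtP i B) => [iB|Bi|->].
- rewrite mulr0 subr0 -[LHS]mulr_natl factS natrM invfM mulrA mulfV ?mul1r //.
  exact: char0_natr.
- by rewrite mulr0 mul0rn subr0.
- by rewrite mulr1 mul0rn subrr.
Qed.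

Lemma deriv_tlog_exp : tlog_exp^`() = (\sum_(k < B.+1) (1 - texp) ^+ k) * texp^`().
Proof.
rewrite /tlog_exp raddf_sum /= mulr_suml; apply: eq_bigr => k _.
have d1 : (1 : {poly K})^`() = 0 by rewrite -[1]/(1%:P) derivC.
rewrite derivZ deriv_exp derivB d1 subr0 /= -[_ * _ *+ _]scaler_nat scalerA -mulrA mulVf; last first.
  exact: char0_natr.
rewrite mulr1 -[1 - texp]opprB [(- (_ - _)) ^+ _]exprNn scaler_signn mulr_signn.
by case: odd; rewrite ?mulNr [_ * texp^`()]mulrC.
Qed.

Lemma tlog_expE : exists q, tlog_exp = 'X + q * 'X^(B.+1).
Proof.
have [r er] := texp_sub1.
suff h i : (i < B.+1)%N -> (tlog_exp - 'X)`_i = 0.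
  by have [q e] := poly_X_dvd h; exists q; rewrite -e addrC subrK.
pose S := \sum_(k < B.+1) (1 - texp) ^+ k.
have ES : S * texp = 1 - (1 - texp) ^+ B.+1.
  have := subrX1 (1 - texp) B.+1; rewrite -/S => h.
  by rewrite -[LHS]opprK -mulrN (_ : - texp = 1 - texp - 1) ?[S * _]mulrC -?h ?opprB // addrAC subrr sub0r.
have [r' dE] : exists r', tlog_exp^`() - 1 = r' * 'X^B.
  exists (- ((- r) ^+ B.+1 * 'X) - (B`!%:R^-1) *: S).
  have e1 : 1 - texp = (- r) * 'X by rewrite mulNr -er opprB.
  rewrite deriv_tlog_exp deriv_texp -/S mulrBr ES e1 exprMn ['X^(B.+1)]exprS.
  move: (_ ^+ B.+1) => a; rewrite -scalerAr mulrBl mulNr -[(_ *: S) * _]scalerAl.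
  by move: (_ *: _) => x; ring.
case: i => [|i] iB.
  rewrite coefB coefX subr0 /tlog_exp coef_sum big1 // => k _.
  by rewrite er exprMn coefZ coefMXn mulr0.
have := congr1 (fun p : {poly K} => p`_i) dE.
rewrite coefMXn (iB : (i < B)%N) coefB coef_deriv coef1 coefB coefX => /eqP.
rewrite subr_eq0 eqSS => /eqP h; apply/eqP; rewrite subr_eq0; apply/eqP.
have ni := char0_natr i charK0.
apply: (mulfI ni); rewrite mulr_natl h; case: i {h dE iB} ni => [|i] ni; first by rewrite mulr1.
by rewrite mulr0.
Qed.

End LogExp.

(** * The algebra of endomorphisms of V × K *)

Section Endomorphisms.
Variables (K : fieldType) (V : lmodType K).
Local Notation M := (V * K^o)%type.

(** The factor K makes affine maps of V linear, and keeps the identity different from 0 even when V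
    = 0, as the ring structure requires. Bundling yields an algebra, into which polynomials can be
    evaluated. *)
Record lend := Lend { lend_fun :> M -> M; lend_lin : linear lend_fun }.

Lemma lend_ext (f g : lend) : f =1 g -> f = g.
Proof.
case: f g => [f lf] [g lg] /= /funext e; move: lf; rewrite e => lf.
by congr Lend; apply: Prop_irrelevance.
Qed.

HB.instance Definition _ := gen_eqMixin lend.
HB.instance Definition _ := gen_choiceMixin lend.

Definition lend0 : lend. Proof. by exists (fun=> 0) => c x y; rewrite scaler0 addr0. Defined.
Definition lend1 : lend. Proof. by exists (fun x => x). Defined.
Definition lend_opp (f : lend) : lend.
Proof. by exists (fun x => - f x) => c x y; rewrite (lend_lin f) opprD scalerN. Defined.
Definition lend_add (f g : lend) : lend.
Proof. exists (fun x => f x + g x); exact: lin_add (lend_lin f) (lend_lin g). Defined.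
Definition lend_mul (f g : lend) : lend.
Proof. exists (fun x => f (g x)); exact: lin_comp (lend_lin f) (lend_lin g). Defined.
Definition lend_scale (k : K) (f : lend) : lend.
Proof. exists (fun x => k *: f x); exact: lin_scale (lend_lin f). Defined.

Lemma lend_addA : associative lend_add.
Proof. by move=> f g h; apply: lend_ext => x /=; rewrite addrA. Qed.
Lemma lend_addC : commutative lend_add.
Proof. by move=> f g; apply: lend_ext => x /=; rewrite addrC. Qed.
Lemma lend_add0 : left_id lend0 lend_add.
Proof. by move=> f; apply: lend_ext => x /=; rewrite add0r. Qed.
Lemma lend_addN : left_inverse lend0 lend_opp lend_add.
Proof. by move=> f; apply: lend_ext => x /=; rewrite addNr. Qed.

HB.instance Definition _ := GRing.isZmodule.Build lend lend_addA lend_addC lend_add0 lend_addN.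

Lemma lend_mulA : associative lend_mul.
Proof. by move=> f g h; apply: lend_ext. Qed.
Lemma lend_mul1 : left_id lend1 lend_mul.
Proof. by move=> f; apply: lend_ext. Qed.
Lemma lend_mulr1 : right_id lend1 lend_mul.
Proof. by move=> f; apply: lend_ext. Qed.
Lemma lend_mulDl : left_distributive lend_mul lend_add.
Proof. by move=> f g h; apply: lend_ext. Qed.
Lemma lend_mulDr : right_distributive lend_mul lend_add.
Proof. by move=> f g h; apply: lend_ext => x /=; rewrite (linD (lend_lin f)). Qed.
Lemma lend_1_neq0 : lend1 != lend0.
Proof.
apply/eqP => /(congr1 (fun f : lend => (f (0, 1)).2)) /= /eqP.
by rewrite oner_eq0.
Qed.

HB.instance Definition _ := GRing.Zmodule_isNzRing.Build lend lend_mulA lend_mul1 lend_mulr1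
  lend_mulDl lend_mulDr lend_1_neq0.

Lemma lend_scaleA a b f : lend_scale a (lend_scale b f) = lend_scale (a * b) f.
Proof. by apply: lend_ext => x /=; rewrite scalerA. Qed.
Lemma lend_scale1 : left_id 1 lend_scale.
Proof. by move=> f; apply: lend_ext => x /=; rewrite scale1r. Qed.
Lemma lend_scaleDr : right_distributive lend_scale +%R.
Proof. by move=> a f g; apply: lend_ext => x /=; rewrite scalerDr. Qed.
Lemma lend_scaleDl f : {morph lend_scale^~ f : a b / a + b}.
Proof. by move=> a b; apply: lend_ext => x /=; rewrite scalerDl. Qed.

HB.instance Definition _ := GRing.Zmodule_isLmodule.Build K lend
  lend_scaleA lend_scale1 lend_scaleDr lend_scaleDl.

Lemma lend_scaleAl (k : K) (f g : lend) : k *: (f * g) = (k *: f) * g.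
Proof. by apply: lend_ext. Qed.
HB.instance Definition _ := GRing.Lmodule_isLalgebra.Build K lend lend_scaleAl.

Lemma lend_scaleAr (k : K) (f g : lend) : k *: (f * g) = f * (k *: g).
Proof. by apply: lend_ext => x /=; rewrite (linZ (lend_lin f)). Qed.
HB.instance Definition _ := GRing.Lalgebra_isAlgebra.Build K lend lend_scaleAr.

Lemma lendME (f g : lend) x : (f * g) x = f (g x). Proof. by []. Qed.
Lemma lendDE (f g : lend) x : (f + g) x = f x + g x. Proof. by []. Qed.
Lemma lendZE k (f : lend) x : (k *: f) x = k *: f x. Proof. by []. Qed.
Lemma lend1E x : (1 : lend) x = x. Proof. by []. Qed.
Lemma lendNE (f : lend) x : (- f) x = - f x. Proof. by []. Qed.
Lemma lend_sumE I (r : seq I) (P : pred I) (F : I -> lend) x :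
  (\sum_(i <- r | P i) F i) x = \sum_(i <- r | P i) F i x.
Proof. by apply: (big_morph (fun f : lend => f x)). Qed.

Definition lexp B (f : lend) : lend := \sum_(i < B.+1) (i`!%:R^-1) *: f ^+ i.

Hypothesis charK0 : [pchar K] =i pred0.

(** Evaluation at f of the polynomial identity for the truncated logarithm; the error term is a
    multiple of f^(B+1) = 0. *)
Lemma lend_log_exp B (f : lend) : f ^+ B.+1 = 0 ->
  \sum_(k < B.+1) ((-1) ^+ k / k.+1%:R) *: (lexp B f - 1) ^+ k.+1 = f.
Proof.
move=> fB; have [q e] := tlog_expE charK0 B.
have eE : horner_alg f (texp K B) = lexp B f.
  rewrite /texp poly_def raddf_sum /=; apply: eq_bigr => i _.
  by rewrite -mul_polyC rmorphM rmorphXn /= horner_algC horner_algX mulr_algl.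
transitivity (horner_alg f (tlog_exp K B)).
  rewrite /tlog_exp raddf_sum /=; apply: eq_bigr => k _.
  by rewrite -mul_polyC rmorphM rmorphXn rmorphB rmorph1 /= horner_algC mulr_algl eE.
by rewrite e rmorphD rmorphM rmorphXn /= horner_algX fB mulr0 addr0.
Qed.

(** Needed because two gauge actions are compared only on vectors whose first component has degree
    1; this set is preserved by f. *)
Lemma lend_agree (P : M -> Prop) (f g : lend) k x : (forall x, P x -> f x = g x) ->
  (forall x, P x -> P (f x)) -> P x -> (f ^+ k) x = (g ^+ k) x.
Proof.
move=> fg Pf; elim: k x => [//|k IH] x Px.
by rewrite !exprSr !lendME -(fg x Px); apply/IH/Pf.
Qed.

End Endomorphisms.

(** * Words in the infinitesimal gauge action *)

Section Words.
Variables (K : fieldType) (L : dgLieData K).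
Hypothesis hL : isDgLie L.
Local Notation M := (L * K^o)%type.
Local Notation LC := (@lower_central K L).
Let lbl := lie_br_linl hL.
Let lbr := lie_br_linr hL.

(* The affine vector field a |-> [X, a] - dX generating the gauge action of X,
   homogenised to a linear map. *)
Definition gauge_op (X : L) : lend L.
Proof.
exists (fun p : M => (lie_br X p.1 - p.2 *: lie_diff X, 0)).
move=> c [a u] [b v]; apply: injective_projections => /=; last by rewrite scaler0 addr0.
by rewrite lbr scalerDl -[(c *: u) *: _]scalerA scalerBr opprD addrACA.
Defined.

Definition unit_vec : M := (0, 1).

Fixpoint nested_diff (w : seq L) : L :=
  match w with
  | [::] => 0
  | [:: x] => lie_diff x
  | x :: w' => lie_br x (nested_diff w')
  end.

(** The last letter acts first: it alone meets the coordinate 1 and yields minus its differential,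
    after which that coordinate is 0 and the remaining letters act by brackets. *)
Lemma gauge_op_word x w :
  (\prod_(y <- x :: w) gauge_op y) unit_vec = (- nested_diff (x :: w), 0).
Proof.
elim: w x => [|y w IH] x.
  rewrite big_seq1 /= (lin0 (lbr _)) scale1r sub0r; by [].
rewrite big_cons lendME IH /= scale0r subr0 (linN (lbr _)); by [].
Qed.

Lemma gauge_op_pow X n (a : L) (c : K^o) :
  (gauge_op X ^+ n.+1) (a, c) = (iter n (lie_br X) (lie_br X a - c *: lie_diff X), 0).
Proof.
elim: n => [|n IH]; first by rewrite expr1.
by rewrite exprS lendME IH /= scale0r subr0.
Qed.

Variable B : nat.
Hypothesis hB : forall y, LC B y -> y = 0.

Lemma gauge_op_nilp X : gauge_op X ^+ B.+1 = 0.
Proof.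
apply: lend_ext => -[a c]; rewrite gauge_op_pow.
rewrite (hB (y := iter _ _ _)) //; apply: iter_br_LC => k y; exact: LC_brr.
Qed.

(** For n > 0 the n-th power of the operator sends (a, 1) to - ad(X)^(n-1) (δX + [a, X]), so its
    exponential reproduces the formula of the action. The shift of n by 1 is the origin of the
    factorials (n + 1)! there. *)
Lemma lexp_gauge_op X a : lie_comp 0 X = X -> lie_comp 1 a = a ->
  lexp B (gauge_op X) (a, 1) = (exp_act X a, 1).
Proof.
move=> X0 a1; have X0' : lie_comp 0 (- X) = - X by rewrite (linN (lie_comp_lin hL _)) X0.
rewrite /lexp lend_sumE big_ord_recl -[nat_of_ord ord0]/0%N lendZE fact0 invr1 scale1r expr0 lend1E.
have := exp_act_flow hL X0' a1 hB; rewrite opprK => ->.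
rewrite (eq_bigr (fun i : 'I_B =>
  ((i.+1)`!%:R^-1 *: flow_coef (- X) a i, 0) : M)) => [|i _]; last first.
  rewrite lendZE lift0 gauge_op_pow scale1r.
  apply/eqP; rewrite xpair_eqE /= scaler0 eqxx andbT; apply/eqP; congr (_ *: _).
  rewrite /flow_coef (linN (lie_diff_lin hL)) (linN (lbl _)) addrC.
  elim: (i : nat) => [|m IH] /=; first by rewrite opprK.
  by rewrite -IH (linN (lbl _)) opprK.
have -> : \sum_(i < B) (((i.+1)`!%:R^-1 *: flow_coef (- X) a i, 0) : M) =
    (\sum_(i < B) (i.+1)`!%:R^-1 *: flow_coef (- X) a i, 0).
  by elim/big_rec2: _ => // i p q _ ->; congr pair; rewrite /= addr0.
by congr pair; rewrite /= addr0.
Qed.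

Hypothesis charK0 : [pchar K] =i pred0.

Definition pos_exp k (e : {ffun 'I_k.+1 -> 'I_B.+1 * 'I_B.+1}) :=
  [forall i, (0 < (e i).1 + (e i).2)%N].
Definition exp_weight k (e : {ffun 'I_k.+1 -> 'I_B.+1 * 'I_B.+1}) : nat :=
  (\prod_i ((e i).1`! * (e i).2`!))%N.
Definition exp_word (T : Type) k (e : {ffun 'I_k.+1 -> 'I_B.+1 * 'I_B.+1}) (Y X : T) : seq T :=
  flatten [seq nseq (e i).1 Y ++ nseq (e i).2 X | i <- enum 'I_k.+1].

Lemma prodr_zero (R : pzSemiRingType) (I : eqType) (r : seq I) (F : I -> R) i :
  i \in r -> F i = 0 -> \prod_(j <- r) F j = 0.
Proof.
elim: r => // a r IH; rewrite inE big_cons => /predU1P[<-|ir] Fi; first by rewrite Fi mul0r.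
by rewrite IH // mulr0.
Qed.

Lemma prod_nseq (R : pzRingType) (T : Type) (f : T -> R) n x :
  \prod_(y <- nseq n x) f y = f x ^+ n.
Proof. by elim: n => [|n IH]; rewrite ?big_nil ?expr0 //= big_cons IH exprS. Qed.

Lemma scaler_prodl (R : algType K) n (c : 'I_n -> K) (f : 'I_n -> R) :
  \prod_i (c i *: f i) = (\prod_i c i) *: \prod_i f i.
Proof.
elim: n c f => [|n IH] c f; first by rewrite !big_ord0 scale1r.
by rewrite !big_ord_recl IH -scalerAl -scalerAr scalerA.
Qed.

(** The blocks Y^r X^s of Dynkin's formula come from distributing the k + 1 factors of the power. *)
Lemma lexp_power (X Y : L) k : (lexp B (gauge_op Y) * lexp B (gauge_op X) - 1) ^+ k.+1 =
  \sum_(e : {ffun 'I_k.+1 -> 'I_B.+1 * 'I_B.+1} | pos_exp e)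
    (exp_weight e)%:R^-1 *: \prod_(y <- exp_word e Y X) gauge_op y.
Proof.
pose c (p : 'I_B.+1 * 'I_B.+1) : K := (p.1`! * p.2`!)%N%:R^-1.
pose t (p : 'I_B.+1 * 'I_B.+1) : lend L := gauge_op Y ^+ p.1 * gauge_op X ^+ p.2.
(* Subtracting 1 removes the pair (0, 0), which leaves the blocks with r + s > 0. *)
have -> : lexp B (gauge_op Y) * lexp B (gauge_op X) - 1 =
    \sum_(p : 'I_B.+1 * 'I_B.+1) (if (0 < p.1 + p.2)%N then c p *: t p else 0).
  rewrite /lexp big_distrlr /= pair_bigA /= (bigD1 (ord0, ord0)) //=.
  rewrite [RHS](bigD1 (ord0, ord0)) //= add0r !expr0 fact0 invr1 !scale1r mulr1 addrAC.
  rewrite subrr add0r; apply: eq_bigr => -[i j] /= ij.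
  have -> : (0 < i + j)%N.
    by rewrite lt0n addn_eq0; apply: contraNN ij => /andP[i0 j0]; rewrite xpair_eqE -!val_eqE /= i0 j0.
  by rewrite -scalerAl -scalerAr scalerA /c natrM invfM.
have pE (x : lend L) : x ^+ k.+1 = \prod_(i < k.+1) x by rewrite prodr_const card_ord.
rewrite pE bigA_distr_bigA /= [RHS]big_mkcond.
apply: eq_bigr => e _; case: ifP => [/forallP pe|/negbT /forallPn [i ne]]; last first.
  by apply: (prodr_zero (i := i)); rewrite ?mem_index_enum // (negPf ne).
rewrite (eq_bigr (fun i => c (e i) *: t (e i))) => [|i _]; last by rewrite pe.
rewrite scaler_prodl; congr (_ *: _).
  by rewrite /c prodfV /exp_weight natr_prod.
rewrite /exp_word big_flatten big_map enumT [index_enum _]unlock; apply: eq_bigr => i _.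
by rewrite big_cat !prod_nseq.
Qed.

Lemma exp_word_nil (T : Type) k (e : {ffun 'I_k.+1 -> 'I_B.+1 * 'I_B.+1}) (Y X : T) :
  pos_exp e -> exists y w, exp_word e Y X = y :: w.
Proof.
move=> /forallP pe; rewrite /exp_word enum_ordSl /=.
have := pe ord0; case: (e ord0) => -[[|i] hi] [[|j] hj] //= _; by do 2!eexists.
Qed.

(** By hypothesis e^Z and e^Y e^X agree as operators on vectors whose first component has degree 1,
    hence so do the powers that occur in their logarithms. The logarithm of the first is
    [gauge_op Z], which sends (0, 1) to (- δZ, 0); expanding that of the second gives the words. *)
Lemma log_act X Y Z : lie_comp 0 X = X -> lie_comp 0 Y = Y -> lie_comp 0 Z = Z ->
  (forall a, lie_comp 1 a = a -> exp_act Z a = exp_act Y (exp_act X a)) ->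
  lie_diff Z = \sum_(k < B.+1) ((-1) ^+ k / k.+1%:R) *:
    \sum_(e : {ffun 'I_k.+1 -> 'I_B.+1 * 'I_B.+1} | pos_exp e)
      (exp_weight e)%:R^-1 *: nested_diff (exp_word e Y X).
Proof.
move=> X0 Y0 Z0 hact.
have nL : nilpotent_dgLie L by exists B => y; exact: hB.
have act1 (W a : L) : lie_comp 0 W = W -> lie_comp 1 a = a -> lie_comp 1 (exp_act W a) = exp_act W a.
  move=> W0 a1; have W0' : lie_comp 0 (- W) = - W by rewrite (linN (lie_comp_lin hL _)) W0.
  by have := exp_act_homog hL nL W0' a1; rewrite opprK.
pose f := lexp B (gauge_op Z); pose g := lexp B (gauge_op Y) * lexp B (gauge_op X).
have f1 a : lie_comp 1 a = a -> f (a, 1) = (exp_act Z a, 1) by exact: lexp_gauge_op.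
have g1 a : lie_comp 1 a = a -> g (a, 1) = (exp_act Y (exp_act X a), 1).
  by move=> a1; rewrite lendME !lexp_gauge_op // act1.
pose P (p : M) := lie_comp 1 p.1 = p.1.
(* The action describes the operators only on vectors (a, 1); every vector is one of these plus a
   multiple of (0, 1), which is another. *)
have split_pair (p : M) : p = (p.1, 1) + (p.2 - 1) *: (0, 1).
  case: p => a c; apply: injective_projections => /=; first by rewrite scaler0 addr0.
  by rewrite -[_ *: _]/((c - 1) * 1) mulr1 addrC subrK.
have c0 : lie_comp 1 0 = 0 :> L by exact: (lin0 (lie_comp_lin hL _)).
have fg p : P p -> (f - 1) p = (g - 1) p.
  move=> Pp; rewrite !lendDE; congr (_ + _); rewrite (split_pair p).
  rewrite !(linD (lend_lin _)) !(linZ (lend_lin _)) !f1 // !g1 // !hact //.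
have Pf p : P p -> P ((f - 1) p).
  move=> Pp; rewrite /P lendDE lendNE lend1E {1 3}(split_pair p).
  rewrite (linD (lend_lin _)) (linZ (lend_lin _)) !f1 //=.
  move: (exp_act Z p.1) (exp_act Z 0) (act1 Z p.1 Z0 Pp) (act1 Z 0 Z0 c0) => b c eb ec.
  by rewrite !(linD (lie_comp_lin hL _)) (linN (lie_comp_lin hL _)) (linZ (lie_comp_lin hL _)) eb ec Pp.
have := congr1 (fun h : lend L => (h unit_vec).1) (lend_log_exp charK0 (gauge_op_nilp Z)).
rewrite /= lend_sumE (lin0 (lbr _)) sub0r scale1r => /(congr1 -%R); rewrite opprK => <-.
have fstS (I : Type) (r : seq I) (Q : pred I) (F : I -> M) :
    (\sum_(i <- r | Q i) F i).1 = \sum_(i <- r | Q i) (F i).1.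
  by apply: (big_morph (fun p : M => p.1)).
rewrite fstS -sumrN; apply: eq_bigr => k _; rewrite lendZE -scalerN; congr (_ *: _).
rewrite -/f (lend_agree k.+1 fg Pf) // lexp_power lend_sumE fstS -sumrN.
apply: eq_bigr => e pe; rewrite lendZE; have [y [w ->]] := exp_word_nil Y X pe.
by rewrite gauge_op_word /= scalerN opprK.
Qed.

End Words.

(** * Dynkin's form of the Campbell-Hausdorff series *)

Definition exp_total b k (e : {ffun 'I_k.+1 -> 'I_b.+1 * 'I_b.+1}) : nat :=
  (\sum_i ((e i).1 + (e i).2))%N.

Lemma size_exp_word (T : Type) b k (e : {ffun 'I_k.+1 -> 'I_b.+1 * 'I_b.+1}) (Y X : T) :
  size (exp_word e Y X) = exp_total e.
Proof.
rewrite /exp_word size_flatten /shape -map_comp sumnE big_map big_enum /=.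
by apply: eq_bigr => i _; rewrite size_cat !size_nseq.
Qed.

Lemma map_exp_word (T U : Type) (h : T -> U) b k (e : {ffun 'I_k.+1 -> 'I_b.+1 * 'I_b.+1})
  (Y X : T) : exp_word e (h Y) (h X) = [seq h y | y <- exp_word e Y X].
Proof.
rewrite /exp_word map_flatten -map_comp; congr flatten; apply: eq_map => i /=.
by rewrite map_cat !map_nseq.
Qed.

Lemma pos_exp_total b k (e : {ffun 'I_k.+1 -> 'I_b.+1 * 'I_b.+1}) : pos_exp e ->
  (k < exp_total e)%N.
Proof.
move=> /forallP pe; rewrite -{1}[k.+1]card_ord -sum1_card /exp_total.
by apply: leq_sum => i _; apply: pe.
Qed.

Section Dynkin.
Variables (K : fieldType) (L : dgLieData K).
Hypothesis hL : isDgLie L.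
Local Notation LC := (@lower_central K L).

Lemma nested_br_cons x y w : nested_br [:: x, y & w] = lie_br x (nested_br (y :: w)) :> L.
Proof. by []. Qed.

Lemma nested_br_LC x (w : seq L) : LC (size w) (nested_br (x :: w)).
Proof. by elim: w x => [//|y w IH] x; rewrite nested_br_cons; apply: LC_brr. Qed.

Lemma LC_S k y : LC k.+1 y -> LC k y.
Proof.
elim: k y => [//|k IH] y; elim=> [|c z t [a [b [ha ->]]] _ h]; first exact: LC0.
by apply: (@LC_lin _ _ k.+1); [apply: LC_brr; exact: IH | exact: h].
Qed.

Lemma LC_le k l y : (k <= l)%N -> LC l y -> LC k y.
Proof. by move/subnKC <-; elim: (l - k)%N => [|d IH]; rewrite ?addn0 // addnS => /LC_S. Qed.

Variables Y X : L.

(** The bound b on single exponents is kept apart from the total degree N: in [CH_part] both are N,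
    whereas the logarithm uses one bound for all degrees. *)
Definition dynkin b k N : L :=
  \sum_(e : {ffun 'I_k.+1 -> 'I_b.+1 * 'I_b.+1} | pos_exp e && (exp_total e == N))
    (exp_weight e)%:R^-1 *: nested_br (exp_word e Y X).

Lemma CH_partE N : CH_part Y X N =
  N%:R^-1 *: \sum_(k < N) ((-1) ^+ k / k.+1%:R) *: dynkin N k N.
Proof.
rewrite /CH_part scaler_sumr; apply: eq_bigr => k _.
rewrite [RHS]scalerA [X in _ = X *: _]mulrC -[RHS]scalerA.
congr (_ *: _); rewrite /dynkin scaler_sumr; apply: eq_bigr => e _.
by rewrite scalerA -invfM -natrM.
Qed.

(** No single exponent can exceed the total N, so raising the bound adds no terms. *)
Lemma dynkin_widen b k N : (N <= b)%N -> dynkin b k N = dynkin N k N.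
Proof.
move=> Nb; have Nb' : (N < b.+1)%N by [].
pose h (e : {ffun 'I_k.+1 -> 'I_N.+1 * 'I_N.+1}) : {ffun 'I_k.+1 -> 'I_b.+1 * 'I_b.+1} :=
  [ffun i => (widen_ord Nb' (e i).1, widen_ord Nb' (e i).2)].
pose h' (e : {ffun 'I_k.+1 -> 'I_b.+1 * 'I_b.+1}) : {ffun 'I_k.+1 -> 'I_N.+1 * 'I_N.+1} :=
  [ffun i => (inord (e i).1, inord (e i).2)].
have hh' e : pos_exp e && (exp_total e == N) -> h (h' e) = e.
  move=> /andP[_ /eqP tot]; apply/ffunP => i; rewrite !ffunE /=.
  have : ((e i).1 + (e i).2 <= N)%N by rewrite -tot /exp_total (bigD1 i) //= leq_addr.
  case: (e i) => p q /= pq; congr pair; apply: val_inj => /=; rewrite inordK // ltnS.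
    exact: leq_trans (leq_addr _ _) pq.
  exact: leq_trans (leq_addl _ _) pq.
rewrite /dynkin (reindex_onto h h' hh'); apply: eq_big => [e|e _].
  have -> : h' (h e) = e.
    apply/ffunP => i; rewrite !ffunE /=; case: (e i) => p q /=.
    by congr pair; apply: val_inj => /=; rewrite inordK.
  have -> : pos_exp (h e) = pos_exp e by apply: eq_forallb => i; rewrite ffunE.
  have -> : exp_total (h e) = exp_total e by apply: eq_bigr => i _; rewrite ffunE.
  by rewrite eqxx andbT.
congr (_%:R^-1 *: nested_br (flatten _)); first by apply: eq_bigr => i _; rewrite ffunE.
by apply: eq_map => i; rewrite ffunE.
Qed.

Lemma dynkin_short b k N : (N <= k)%N -> dynkin b k N = 0.
Proof.
move=> Nk; apply: big1_seq => e /andP[/andP[pe /eqP tot] _].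
by have := pos_exp_total pe; rewrite tot ltnNge Nk.
Qed.

Hypothesis charK0 : [pchar K] =i pred0.
Variable B : nat.
Hypothesis hB : forall y, LC B y -> y = 0.

Lemma nested_br_long (w : seq L) : (B < size w)%N -> nested_br w = 0.
Proof. by case: w => // x w; rewrite ltnS => Bw; apply/hB/(LC_le Bw)/nested_br_LC. Qed.

Lemma CH_part_large N : (B < N)%N -> CH_part Y X N = 0.
Proof.
move=> BN; rewrite CH_partE big1 ?scaler0 // => k _.
rewrite [dynkin _ _ _]big1 ?scaler0 // => e /andP[_ /eqP tot].
by rewrite nested_br_long ?scaler0 // size_exp_word tot.
Qed.

Lemma CH_sum : CH Y X = \sum_(N < B.+1) CH_part Y X N.
Proof. by rewrite /CH (fsum_nat (N := B.+1)) // => N; apply: CH_part_large. Qed.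

(* With F N v = v (x) z^N dz the right hand side is d CH (z Y, z X). *)
Lemma dynkin_collect (U : lmodType K) (F : nat -> L -> U) : (forall N, linear (F N)) ->
  \sum_(k < B.+1) ((-1) ^+ k / k.+1%:R) *:
    (\sum_(e : {ffun 'I_k.+1 -> 'I_B.+1 * 'I_B.+1} | pos_exp e)
      (exp_weight e)%:R^-1 *: F (size (exp_word e Y X)).-1 (nested_br (exp_word e Y X))) =
  \sum_(N < B.+1) N%:R *: F N.-1 (CH_part Y X N).
Proof.
move=> FL.
have inner k : \sum_(e : {ffun 'I_k.+1 -> 'I_B.+1 * 'I_B.+1} | pos_exp e)
      (exp_weight e)%:R^-1 *: F (size (exp_word e Y X)).-1 (nested_br (exp_word e Y X)) =
    \sum_(N < B.+1) F N.-1 (dynkin B k N).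
  rewrite (bigID (fun e => exp_total e < B.+1)%N) /= addrC big1 => [|e /andP[_ le]]; last first.
    rewrite nested_br_long ?(lin0 (FL _)) ?scaler0 // size_exp_word.
    by rewrite -leqNgt in le.
  rewrite add0r (partition_big (fun e => inord (exp_total e) : 'I_B.+1) xpredT) //=.
  apply: eq_bigr => N _; rewrite /dynkin (lin_sum (FL _)); apply: eq_big => [e|e].
    case: (pos_exp e) => //=; apply/andP/eqP => [[le /eqP <-]|->]; first by rewrite inordK.
    by rewrite ltn_ord inord_val eqxx.
  move=> /andP[/andP[_ le] /eqP <-]; rewrite (linZ (FL _)) size_exp_word inordK //.
under eq_bigr do rewrite inner scaler_sumr.
rewrite exchange_big /=; apply: eq_bigr => N _.
rewrite CH_partE (linZ (FL _)) scalerA (lin_sum (FL _)).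
(* For N = 0 the factor N does not cancel against the 1/N of [CH_part], but both sides vanish. *)
case: (posnP N) => [->|N0].
  rewrite mul0r scale0r big1 // => k _; rewrite dynkin_short ?(lin0 (FL _)) ?scaler0 //.
rewrite mulfV; last by case: (nat_of_ord N) N0 => // m _; exact: char0_natr.
rewrite scale1r (big_ord_widen B.+1 (fun k => F N.-1 (((-1) ^+ k / k.+1%:R) *: dynkin N k N))); last by apply: ltnW.
rewrite [RHS]big_mkcond /=; apply: eq_bigr => k _; case: ltnP => kN.
  by rewrite (linZ (FL _)) dynkin_widen // -ltnS.
by rewrite dynkin_short // (lin0 (FL _)) scaler0.
Qed.

End Dynkin.

(** * The third edge of a flat triangle *)

Section Evaluation.
Variable K : fieldType.
Hypothesis charK0 : [pchar K] =i pred0.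
Let two_neq0 : 2 != 0 :> K. Proof. exact: char0_natr. Qed.
Let cO n := Omega_isCdga two_neq0 n.
Variable L : dgLieData K.
Hypothesis hL : isDgLie L.
Local Notation T n := (tensor L (Omega K n)).
Let tIl k n f := @tI_lin _ charK0 L k n f.

Lemma tI_vtx_tdA n (i : 'I_n.+1) (u : T n) : tI (vtx i) (tdA u) = 0.
Proof.
have := tI_tpb charK0 (vtx i) id (tdA u) => /esym -> .
rewrite (tpb_tdA charK0 hL).
have e0 : tC 0 (tdA (tpb (vtx i) u)) = 0.
  have z : linear (fun w : T 0 => tC 0 (tdA w)).
    exact: (lin_comp (@tC_lin _ charK0 L 0 0) (tdA_lin hL (cO 0))).
  elim/tens_ind: (tpb _ u) => [a b ea eb|x a]; first by apply: (etrans (lin_add2 z ea eb)); rewrite addr0.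
  rewrite (tdAE hL (cO 0)) (tCE charK0) (cdga_diff_comp0 (cO 0)).
  exact: (lin0 (tens_linr _)).
by have := tI_top charK0 (tdA (tpb (vtx i) u)) id 0; rewrite e0 eqxx => <-; exact: (lin0 (@tIl _ _ _)).
Qed.

Lemma tI_vtx_tdL n (i : 'I_n.+1) (u : T n) : tI (vtx i) (tdL u) = lie_diff (tI (vtx i) u).
Proof.
have l1 : linear (fun u : T n => tI (vtx i) (tdL u)).
  exact: (lin_comp (@tIl _ _ _) (@tdL_lin K L (Omega K n) hL)).
have l2 : linear (fun u : T n => lie_diff (tI (vtx i) u)).
  exact: (lin_comp (lie_diff_lin hL) (@tIl _ _ _)).
apply: (lin_tens_ext l1 l2) => x a.
by rewrite (tdLE hL) !(tIE charK0) (linZ (lie_diff_lin hL)).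
Qed.

Let brl n := tens_br_linl hL (cO n).
Let brr n := tens_br_linr hL (cO n).

Lemma integral_vtx_deg n (i : 'I_n.+1) j (a : Omega K n) : dga_comp j a = a -> j != 0%N ->
  integral (pullback (vtx i) a) = 0.
Proof. by move=> aj j0; rewrite (integral_pullback_deg charK0 _ aj). Qed.

Lemma tI_vtx_br n (i : 'I_n.+1) (u v : T n) :
  tI (vtx i) (tens_br u v) = lie_br (tI (vtx i) u) (tI (vtx i) v).
Proof.
elim/(tens_hom_ind hL (cO n)): u => [a b ea eb|p j x a xp aj].
  rewrite (linD (@brl n v)) !(linD (@tIl _ _ _)) (linD (lie_br_linl hL _)).
  exact: (f_equal2 +%R ea eb).
elim/(tens_hom_ind hL (cO n)): v => [c d ec ed|q l y b yq bl].
  rewrite (linD (@brr n _)) !(linD (@tIl _ _ _)) (linD (lie_br_linr hL _)).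
  exact: (f_equal2 +%R ec ed).
rewrite (tens_br_pure hL (cO n) _ _ aj yq) (linZ (@tIl _ _ _)) !(tIE charK0).
rewrite (pullback_mul two_neq0) (integral0_mul charK0).
rewrite (linZ (lie_br_linl hL _)) (linZ (lie_br_linr hL _)) !scalerA.
(* Only a form factor of degree 0 survives evaluation at a vertex, and for it the Koszul sign is
   1. *)
have fin (c d : K) (z : L) : (j != 0%N -> c = 0) ->
    ((-1) ^ (j%:Z * q) * (c * d)) *: z = (c * d) *: z.
  by case: (j) => [|m] h; [rewrite mul0r expr0z mul1r | rewrite h // mul0r mulr0].
exact: (fin _ _ _ (integral_vtx_deg i aj)).
Qed.

Lemma tI_vtx_comp n (i : 'I_n.+1) p (u : T n) :
  tI (vtx i) (tens_comp p u) = lie_comp p (tI (vtx i) u).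
Proof.
elim/(tens_hom_ind hL (cO n)): u => [a b ea eb|q j x a xq aj].
  rewrite (linD (tens_comp_lin hL (cO n) p)) !(linD (@tIl _ _ _)) (linD (lie_comp_lin hL _)).
  exact: (f_equal2 +%R ea eb).
rewrite (tens_comp_pure hL (cO n) _ xq aj) (tIE charK0) (linZ (lie_comp_lin hL _)).
rewrite (lie_comp_homog hL _ xq); have [j0|j0] := eqVneq j 0%N.
  rewrite j0 addr0; case: ifP => _; first by rewrite (tIE charK0).
  by rewrite scaler0; exact: (lin0 (@tIl _ _ _)).
have z := integral_vtx_deg i aj j0; rewrite z scale0r.
by case: ifP => _; [rewrite (tIE charK0) z scale0r | exact: (lin0 (@tIl _ _ _))].
Qed.

(** Evaluation at a vertex is a morphism of dg Lie algebras; it serves to set z = 0 or z = 1 in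
    coefficients over K[z, dz]. *)
Lemma tI_vtx_mor n (i : 'I_n.+1) :
  @isLieMor K (tensLie L (Omega K n)) L (tI (vtx i)).
Proof.
split.
- exact: tIl.
- by move=> p u; exact: tI_vtx_comp.
- by move=> u v; exact: tI_vtx_br.
move=> u; apply: (etrans (f_equal (tI (vtx i)) (tens_diffE hL (cO n) u))).
rewrite (linD (@tIl _ _ _)) tI_vtx_tdL tI_vtx_tdA; exact: addr0.
Qed.

End Evaluation.

(** * Change of coefficients along a morphism of dg Lie algebras *)

Section MorphismOnForms.
Variable K : fieldType.
Hypothesis charK0 : [pchar K] =i pred0.
Variable s : forall n, Omega K n -> Omega K n.
Hypothesis gs : gauge s.
Let two_neq0 : 2 != 0 :> K. Proof. exact: char0_natr. Qed.
Let cO n := Omega_isCdga two_neq0 n.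
Variables (L L' : dgLieData K) (g : L -> L').
Hypotheses (hL : isDgLie L) (hL' : isDgLie L') (mg : isLieMor g).
Let lg := lmor_lin mg.
Let id1 n := @cdga_mor_id K (Omega K n).
Local Notation Phi n := (tmap g (fun a : Omega K n => a)).

Lemma tmap_tI k n (f : 'I_k.+1 -> 'I_n.+1) u : tI f (Phi n u) = g (tI f u).
Proof. apply: (tint_tmap _ lg); [exact: lin_id | exact: integral_pullback_lin]. Qed.

Lemma tmap_tC n p u : tC p (Phi n u) = Phi n (tC p u).
Proof.
have lc : linear (dga_comp p : Omega K n -> Omega K n) by exact: (cdga_comp_lin (cO n)).
apply: (etrans (tmap_tmap u lg (@lin_id _ _) (@lin_id _ _) lc)).
exact: (esym (tmap_tmap u (@lin_id _ _) lg lc (@lin_id _ _))).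
Qed.

Lemma tmap_tS n u : tS s (Phi n u) = Phi n (tS s u).
Proof.
have ls := gauge_lin gs (n := n).
apply: (etrans (tmap_tmap u lg (twist_lin hL' 1) (@lin_id _ _) ls)).
apply: (etrans _ (esym (tmap_tmap u (twist_lin hL 1) lg ls (@lin_id _ _)))).
by congr (tmap _ _ u); apply: funext => x; rewrite (twist_mor hL hL' mg).
Qed.

Lemma tmap_flat2 (u : tensor L (Omega K 2)) : flat2 s u -> flat2 s (Phi 2 u).
Proof.
case=> u1 uC uS uF; have Pl : linear (Phi 2) by apply: tmap_lin => //; exact: lin_id.
split.
- by rewrite -(tmap_comp_mor hL hL' (cO 2) (cO 2) mg (id1 2)) u1.
- by rewrite tmap_tC uC.
- by rewrite tmap_tS uS; exact: (lin0 Pl).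
have e1 := tmap_tdA hL hL' (cO 2) (cO 2) mg (id1 2) u.
have e2 := tmap_br hL hL' (cO 2) (cO 2) mg (id1 2) u u.
rewrite -e1 -e2 -(linZ Pl) -(linD Pl) uF; exact: (lin0 Pl).
Qed.

End MorphismOnForms.

(** * The third edge as a Campbell-Hausdorff product *)

Section Composition.
Variable K : fieldType.
Hypothesis charK0 : [pchar K] =i pred0.
Variable s : forall n, Omega K n -> Omega K n.
Hypothesis gs : gauge s.
Let two_neq0 : 2 != 0 :> K. Proof. exact: char0_natr. Qed.
Let cO n := Omega_isCdga two_neq0 n.
Variable L : dgLieData K.
Hypothesis hL : isDgLie L.
Hypothesis nL : nilpotent_dgLie L.
Hypothesis nn : nonneg_graded L.
Local Notation T n := (tensor L (Omega K n)).
Local Notation br := (@tens_br K L _).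
Local Notation LC := (@lower_central K L).
Local Notation Oom := (Oom K).
Local Notation Oz := (Oz K).
Local Notation v0 := (ord0 : 'I_3).
Local Notation v1 := mid3.
Local Notation v2 := (ord_max : 'I_3).
Local Notation L1 := (tensLie L (Omega K 1)).

Let tIl k n f := @tI_lin _ charK0 L k n f.
Let tCl n p := @tC_lin _ charK0 L n p.
Let tdAl n := tdA_lin hL (cO n).
Let tdLl n := @tdL_lin K L (Omega K n) hL.
Let brr n := tens_br_linr hL (cO n).
Let h1 : isDgLie L1 := tensLie_isDgLie hL (cO 1).
Let n1 : nilpotent_dgLie L1 := nilpotent_tensLie hL (cO 1) nL.

Definition scaled (x : L) : L1 := tens x Oz.

(** For a word of N letters, the differentiated last letter is z δx + x dz and every other letter
    contributes a factor z. So the dz part is the nested bracket of the word times z^(N-1) dz. *)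
Lemma nested_diff_scaled x (w : seq L) : (forall y, y \in x :: w -> lie_comp 0 y = y) ->
  lie_comp 0 (nested_br (x :: w)) = nested_br (x :: w) /\
  exists2 A, lie_comp 1 A = A & nested_diff [seq scaled y | y <- x :: w] =
    tens A (zpow K (size w).+1) + tens (nested_br (x :: w)) (dga_mul (zpow K (size w)) Oom) :> T 1.
Proof.
elim: w x => [|y w IH] x hw.
  have x0 : lie_comp 0 x = x by apply: hw; rewrite inE.
  split; first exact: x0.
  exists (lie_diff x); first exact: (lie_diff_deg hL x0).
  apply: (etrans (tens_diffE hL (cO 1) (scaled x))).
  rewrite (tdLE hL) (tdA_pure hL (cO 1) _ x0) expr0z scale1r -(OomE charK0).
  rewrite -[zpow K 1]/(dga_mul Oz (Om_one K 1)) -[zpow K 0]/(Om_one K 1).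
  have -> := Om_mulr1 Oz; have -> := Om_mul1 Oom; reflexivity.
have [|N0 [A A1 eA]] := IH y; first by move=> z hz; apply: hw; rewrite inE hz orbT.
have x0 : lie_comp 0 x = x by apply: hw; rewrite inE eqxx.
have z0 : dga_comp 0 Oz = Oz by exact: Om_comp_t.
rewrite nested_br_cons; split; first exact: (lie_br_deg hL x0 N0).
exists (lie_br x A); first exact: (lie_br_deg hL x0 A1).
apply: (etrans (f_equal (br (tens x Oz)) eA)).
rewrite (linD (@brr 1 _)) (tens_br_pure hL (cO 1) _ _ z0 A1) (tens_br_pure hL (cO 1) _ _ z0 N0).
by rewrite !mul0r !expr0z !scale1r (cdga_mulA (cO 1)).
Qed.

Lemma exp_word_homog (x y : L) B k (e : {ffun 'I_k.+1 -> 'I_B.+1 * 'I_B.+1}) :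
  lie_comp 0 x = x -> lie_comp 0 y = y -> forall z, z \in exp_word e y x -> lie_comp 0 z = z.
Proof.
move=> x0 y0 z /flattenP[w /mapP[i _ ->]]; rewrite mem_cat.
by case/orP => /nseqP[-> _].
Qed.

Lemma tC1_nested_diff_scaled (x y : L) B k (e : {ffun 'I_k.+1 -> 'I_B.+1 * 'I_B.+1}) :
  lie_comp 0 x = x -> lie_comp 0 y = y -> pos_exp e ->
  tC 1 (nested_diff (exp_word e (scaled y) (scaled x)) : T 1) =
  tens (nested_br (exp_word e y x)) (dga_mul (zpow K (size (exp_word e y x)).-1) Oom).
Proof.
move=> x0 y0 pe; rewrite map_exp_word; have := exp_word_homog (e := e) x0 y0.
have [z [w ->]] := exp_word_nil y x pe => hw.
have [_ [A _ e1]] := nested_diff_scaled hw.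
apply: (etrans (f_equal (tC 1) e1)); rewrite (linD (@tCl 1 1)) !(tCE charK0).
have -> : dga_comp 1 (zpow K (size w).+1) = 0.
  by rewrite (cdga_comp_homog (cO 1) 1 (zpow_deg charK0 (size w).+1)).
have -> : dga_comp 1 (dga_mul (zpow K (size w)) Oom) = dga_mul (zpow K (size w)) Oom.
  exact: (cdga_mul_homog (cO 1) (i := 0) (j := 1) (zpow_deg charK0 _) (Oom_deg charK0)).
rewrite (lin0 (tens_linr _)); exact: add0r.
Qed.

Lemma CH_part_homog (x y : L) N : lie_comp 0 x = x -> lie_comp 0 y = y ->
  lie_comp 0 (CH_part y x N) = CH_part y x N.
Proof.
move=> x0 y0; have cl := lie_comp_lin hL 0.
rewrite CH_partE (linZ cl) (lin_sum cl); congr (_ *: _); apply: eq_bigr => k _.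
rewrite (linZ cl) (lin_sum cl); congr (_ *: _); apply: eq_bigr => e /andP[pe _].
rewrite (linZ cl); congr (_ *: _); have := exp_word_homog (e := e) x0 y0.
by have [z [w ->]] := exp_word_nil y x pe => hw; have [] := nested_diff_scaled hw.
Qed.

(* Z is the third edge of a flat triangle over L[z, dz] with edges z x and z y. *)
Lemma scaled_CH (x y : L) (Z : T 1) : lie_comp 0 x = x -> lie_comp 0 y = y ->
  tens_comp 0 Z = Z -> tI (vtx ord0) Z = 0 ->
  (forall a : L1, lie_comp 1 a = a ->
     exp_act (Z : L1) a = exp_act (scaled y) (exp_act (scaled x) a)) ->
  tI (vtx ord_max) Z = CH y x.
Proof.
move=> x0 y0 Z0 Zv act.
have [B hB1 hB] : exists2 B, (forall v : L1, lower_central (L := L1) B v -> v = 0) &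
    forall v, LC B v -> v = 0.
  have [k1 hk1] := n1; have [k2 hk2] := nL; exists (maxn k1 k2) => v hv.
    by apply: hk1; apply: (LC_le _ hv); exact: leq_maxl.
  by apply: hk2; apply: (LC_le _ hv); exact: leq_maxr.
have sc v : lie_comp 0 v = v -> lie_comp 0 (scaled v) = scaled v.
  by move=> v0; exact: (tens_comp_pure_form charK0 hL v0 (Om_comp_t K ord_max)).
(* A dz part of Z would have coefficients in degree -1. *)
have ZC : tC 0 Z = Z.
  have := tC_sum charK0 Z; rewrite big_ord_recl big_ord1 => e.
  have z : tC 1 Z = 0 by exact: (tC_nonneg charK0 hL nn Z0).
  by rewrite [RHS]e [X in _ + X]z addr0.
have := log_act h1 hB1 charK0 (sc _ x0) (sc _ y0) Z0 act.
move/(f_equal (tC 1 : T 1 -> T 1)).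
have -> : tC 1 (lie_diff (Z : L1) : T 1) = tdA Z.
  apply: (etrans (f_equal (tC 1) (tens_diffE hL (cO 1) Z))).
  rewrite (linD (@tCl 1 1)) (tC_tdL charK0 hL) (tC_tdA charK0 hL) ZC -{1}ZC (tC_tC charK0).
  rewrite (lin0 (@tdLl 1)); exact: add0r.
pose F N (v : L) : T 1 := tens v (dga_mul (zpow K N) Oom).
have FL N : linear (F N) by exact: tens_linl.
rewrite (lin_sum (@tCl 1 1)) (eq_bigr (fun k : 'I_B.+1 => ((-1) ^+ k / k.+1%:R) *:
  (\sum_(e : {ffun 'I_k.+1 -> 'I_B.+1 * 'I_B.+1} | pos_exp e)
      (exp_weight e)%:R^-1 *: F (size (exp_word e y x)).-1 (nested_br (exp_word e y x))))); last first.
  move=> k _; rewrite (linZ (@tCl 1 1)) (lin_sum (@tCl 1 1)); congr (_ *: _).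
  apply: eq_bigr => e pe; rewrite (linZ (@tCl 1 1)); congr (_ *: _).
  exact: tC1_nested_diff_scaled.
rewrite (dynkin_collect y x charK0 hB FL) => dZ.
pose S : T 1 := \sum_(N < B.+1) tens (CH_part y x N) (zpow K N).
have S0 : tC 0 S = S.
  by rewrite (lin_sum (@tCl 1 0)); apply: eq_bigr => N _; rewrite (tCE charK0) (zpow_deg charK0).
have dS : tdA S = tdA Z.
  rewrite dZ (lin_sum (@tdAl 1)); apply: eq_bigr => -[N hN] _.
  rewrite (tdA_pure hL (cO 1) _ (CH_part_homog N x0 y0)) expr0z scale1r.
  rewrite -[nat_of_ord _]/N; case: N hN => [|N] hN.
    rewrite -[zpow K 0]/(Om_one K 1) (Om_diff_one two_neq0) scale0r; exact: (lin0 (tens_linr _)).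
  rewrite (zpow_diff charK0); exact: (linZ (tens_linr _)).
have IS i : tI (vtx i) S = \sum_(N < B.+1) (i == ord_max)%:R ^+ N *: CH_part y x N.
  rewrite (lin_sum (@tIl _ _ _)); apply: eq_bigr => N _.
  by rewrite (tIE charK0) (integral_zpow charK0).
have CH0 : CH_part y x 0 = 0 by rewrite /CH_part big_ord0.
have S_start : tI (vtx ord0) S = 0.
  rewrite IS big1 // => -[[|N] hN] _ /=; first by rewrite CH0 scaler0.
  by rewrite expr0n scale0r.
have -> : Z = S.
  apply/eqP; rewrite -subr_eq0; apply/eqP.
  (* For the zero connection the transport equation says that the derivative vanishes, so its
     uniqueness statement identifies two functions with the same derivative and the same value at z
     = 0. *)
  have tr v : transport (0 : L) v = tdA v.
    rewrite /transport (lin0 (tens_linl _)) (lin0 (@tdLl 1)) (lin0 (tens_br_linl hL (cO 1) _)).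
    by rewrite !addr0.
  apply: (transport_unique charK0 gs hL nL (x := 0)).
  - by rewrite (linB (@tCl 1 0)) ZC S0.
  - exact: (lin0 (@tCl 1 0)).
  - by rewrite tr (linB (@tdAl 1)) dS subrr.
  - by rewrite tr; exact: (lin0 (@tdAl 1)).
  by rewrite (linB (@tIl _ _ _)) Zv S_start subr0; apply/esym; exact: (lin0 (@tIl _ _ _)).
rewrite IS (CH_sum y x hB); apply: eq_bigr => N _.
by rewrite eqxx expr1n scale1r.
Qed.

(** The triangle is deformed to one over g ⊗ Ω_1 whose edges 01 and 12 are z x and z y. By
    uniqueness of flat triangles its value at z = 1 is the given one and at z = 0 it is trivial, so
    that minus its third edge starts at 0 and ends at the element to be computed. *)
Lemma flat2_CH (u : T 2) : flat2 s u ->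
  - tI (edge v0 v2) u = CH (- tI (edge v1 v2) u) (- tI (edge v0 v1) u).
Proof.
move=> fu; set x := tI (edge v0 v1) u; set y := tI (edge v1 v2) u.
have x0 : lie_comp 0 x = x by exact: (flat2_edge_homog charK0 hL fu).
have y0 : lie_comp 0 y = y by exact: (flat2_edge_homog charK0 hL fu).
have sc v : lie_comp 0 v = v -> lie_comp 0 (scaled v) = scaled v.
  by move=> v0; exact: (tens_comp_pure_form charK0 hL v0 (Om_comp_t K ord_max)).
have [u' [fu' e01 e12]] := horn charK0 gs h1 n1 (sc _ x0) (sc _ y0).
have scN v : scaled (- v) = - scaled v by exact: (linN (tens_linl _)).
pose ev i := tmap (tI (vtx i) : L1 -> L) (fun a : Omega K 2 => a).
have mev i : @isLieMor K L1 L (tI (vtx i)) by exact: (tI_vtx_mor charK0 hL).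
have fev i : flat2 s (ev i u') by exact: (tmap_flat2 charK0 gs h1 hL (mev i) fu').
have Iev i (a b : 'I_3) : tI (edge a b) (ev i u') = tI (vtx i) (tI (edge a b) u' : T 1).
  exact: (tmap_tI charK0 (mev i)).
have evs (i : 'I_2) v : tI (vtx i) (scaled v : T 1) = (i == ord_max)%:R *: v.
  by rewrite (tIE charK0) (integral_pullback_t charK0).
have edge_ev (i : 'I_2) (a b : 'I_3) v : tI (edge a b) u' = scaled v ->
    tI (edge a b) (ev i u') = (i == ord_max)%:R *: v.
  by move=> e; apply: (etrans (Iev i a b)); apply: (etrans (f_equal _ e)); exact: evs.
pose Z : T 1 := - (tI (edge v0 v2) u' : T 1).
have Zv i : tI (vtx i) Z = - tI (edge v0 v2) (ev i u').
  by rewrite Iev; exact: (linN (@tIl _ _ _)).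
have e1 : ev ord_max u' = u.
  apply: (flat2_unique charK0 gs hL nL); [exact: fev | exact: fu | |].
    exact: (etrans (edge_ev ord_max _ _ _ e01) (scale1r _)).
  exact: (etrans (edge_ev ord_max _ _ _ e12) (scale1r _)).
have := Zv ord_max; rewrite e1 => /esym e; apply: (etrans e) => {e}; apply: scaled_CH.
- by rewrite (linN (lie_comp_lin hL _)) x0.
- by rewrite (linN (lie_comp_lin hL _)) y0.
- have e := flat2_edge_homog charK0 h1 fu' v0 v2.
  by apply: (etrans (linN (tens_comp_lin hL (cO 1) 0) _)); exact: (f_equal -%R e).
- rewrite Zv; have -> : ev ord0 u' = 0.
    have z2 : flat2 s (0 : T 2).
      split; [exact: (lin0 (tens_comp_lin hL (cO 2) 1)) | exact: (lin0 (@tCl 2 1))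
        | exact: (lin0 (@tS_lin _ _ gs _ hL 2)) |].
      by rewrite (lin0 (@tdAl 2)) (lin0 (@brr 2 _)) scaler0 addr0.
    apply: (flat2_unique charK0 gs hL nL (fev ord0) z2).
      apply: (etrans (edge_ev ord0 _ _ _ e01)); rewrite scale0r; exact: (esym (lin0 (@tIl _ _ _))).
    apply: (etrans (edge_ev ord0 _ _ _ e12)); rewrite scale0r; exact: (esym (lin0 (@tIl _ _ _))).
  by rewrite (lin0 (@tIl _ _ _)) oppr0.
move=> a a1; have eN (i j : 'I_3) v : tI (edge i j) u' = scaled v ->
    - tI (edge i j) u' = scaled (- v).
  by move=> e; rewrite scN; exact: (f_equal -%R e).
apply: (etrans (flat2_act charK0 gs h1 n1 fu' a1)).
exact: (f_equal2 (fun X W : L1 => exp_act X (exp_act W a)) (eN _ _ _ e12) (eN _ _ _ e01)).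
Qed.

End Composition.

(** * Curvature and the nerve *)

Section Curvature.
Variable K : fieldType.
Hypothesis charK0 : [pchar K] =i pred0.
Variable s : forall n, Omega K n -> Omega K n.
Hypothesis gs : gauge s.
Let two_neq0 : 2 != 0 :> K. Proof. exact: char0_natr. Qed.
Let cO n := Omega_isCdga two_neq0 n.
Variable L : dgLieData K.
Hypothesis hL : isDgLie L.
Hypothesis nL : nilpotent_dgLie L.
Local Notation T n := (tensor L (Omega K n)).
Local Notation br := (@tens_br K L _).
Local Notation tS := (@tS K s L _).

Let tSl n := @tS_lin _ _ gs _ hL n.
Let tPl n := @tP_lin _ charK0 L n.
Let tIl k n f := @tI_lin _ charK0 L k n f.
Let tpbl k n f := @tpb_lin _ charK0 L k n f.
Let tdAl n := tdA_lin hL (cO n).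
Let tdLl n := @tdL_lin K L (Omega K n) hL.
Let brr n := tens_br_linr hL (cO n).
Let tcl n := tens_comp_lin hL (cO n).

Definition curv n (u : T n) := tdL u + tdA u + 2^-1 *: br u u.

Lemma tpb_curv k n (f : 'I_k.+1 -> 'I_n.+1) (u : T n) : tpb f (curv u) = curv (tpb f u).
Proof.
rewrite /curv !(linD (@tpbl _ _ _)) (linZ (@tpbl _ _ _)).
by rewrite (tpb_tdA charK0 hL) (tpb_tdL charK0 hL) (tpb_br charK0 hL).
Qed.

Lemma tI_vtx_curv n (i : 'I_n.+1) (u : T n) :
  tI (vtx i) (curv u) = lie_diff (tI (vtx i) u) + 2^-1 *: lie_br (tI (vtx i) u) (tI (vtx i) u).
Proof.
rewrite /curv !(linD (@tIl _ _ _)) (linZ (@tIl _ _ _)) (tI_vtx_tdL charK0 hL).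
by rewrite (tI_vtx_tdA charK0 hL) (tI_vtx_br charK0 hL) addr0.
Qed.

Lemma curv_deg n (u : T n) : tens_comp 1 u = u -> tens_comp 2 (curv u) = curv u.
Proof.
move=> u1; have eL : tens_comp 2 (tdL u) = tdL u by exact: (tdL_deg hL (cO n) u1).
have eA : tens_comp 2 (tdA u) = tdA u by exact: (tdA_deg hL (cO n) u1).
have eB : tens_comp 2 (br u u) = br u u by exact: (tens_br_deg hL (cO n) u1 u1).
by rewrite /curv !(linD (@tcl n 2)) (linZ (@tcl n 2)) eL eA eB.
Qed.

Lemma bianchi n (u : T n) : tens_comp 1 u = u ->
  tdL (curv u) + tdA (curv u) = - br u (curv u).
Proof.
move=> u1; rewrite /curv !(linD (@tdLl n)) !(linD (@tdAl n)) (linZ (@tdLl n)) (linZ (@tdAl n)).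
rewrite (tdL2 hL) (tdA2 hL (cO n)) (tdA_tdL hL (cO n)) (tdL_sq charK0 hL u1).
rewrite (tdA_sq charK0 hL u1) !(linD (@brr n u)) (linZ (@brr n u)) (jacobi_cube charK0 hL u1).
rewrite !scalerN !(half2 charK0) scaler0 addr0 add0r addr0.
by rewrite addrACA addrN add0r opprD.
Qed.

(** Equivalently, in total degree 1, s kills both u and its curvature. The part of the curvature
    seen by P is left free, and this makes the equation solvable for every value of P u. *)
Definition reduced n (u : T n) := tens_comp 1 u = u /\ u = tP u - 2^-1 *: tS (br u u).

Lemma gauge_reduced n (u : T n) : tens_comp 1 u = u -> curv u = 0 -> tS u = 0 -> reduced u.
Proof.
move=> u1 c0 su; split => //; have := t_homotopy charK0 gs hL u.
rewrite su (lin0 (@tdAl n)) add0r => /eqP; rewrite subr_eq addrC => /eqP {1}->; congr (_ + _).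
move: c0; rewrite /curv -addrA addrC => /add3_eq0 ->.
rewrite (linB (@tSl n)) (linN (@tSl n)) (tS_tdL gs hL) su (lin0 (@tdLl n)) !oppr0 addr0.
by rewrite (linZ (@tSl n)).
Qed.

Lemma reduced_tS n (u : T n) : reduced u -> tS u = 0.
Proof.
case=> _ ->; rewrite (linB (@tSl n)) (linZ (@tSl n)) (tS_tP charK0 gs hL) (tS2 gs hL).
by rewrite scaler0 subr0.
Qed.

Lemma reduced_curv n (u : T n) : reduced u -> tP (curv u) = 0 -> curv u = 0.
Proof.
move=> ru PF; have su := reduced_tS ru; have [u1 eu] := ru.
(* Since s u = 0, the homotopy formula gives s d u = u - P u, which the equation for u equates with
   - s [u, u] / 2. *)
have sF : tS (curv u) = 0.
  rewrite /curv !(linD (@tSl n)) (linZ (@tSl n)) (tS_tdL gs hL) su (lin0 (@tdLl n)) oppr0 add0r.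
  have := t_homotopy charK0 gs hL u; rewrite su (lin0 (@tdAl n)) add0r => <-.
  by rewrite {1}eu [_ - _ - _]addrAC subrr sub0r addNr.
apply: (fixT_unique nL (Phi := fun v => 0 - tS (br u v))).
- exact: (contr_tS_br charK0 gs hL).
- have := t_homotopy charK0 gs hL (curv u); rewrite PF sF subr0 (lin0 (@tdAl n)) add0r => {1}->.
  have := bianchi u1 => /(f_equal tS); rewrite (linD (@tSl n)) (tS_tdL gs hL) sF.
  by rewrite (lin0 (@tdLl n)) oppr0 add0r => ->; rewrite (linN (@tSl n)) sub0r.
by rewrite (lin0 (@brr n u)) (lin0 (@tSl n)) subr0.
Qed.

Lemma reduced_tpb k n (f : monotone_map k n) (u : T n) : reduced u -> reduced (tpb f u).
Proof.
case=> u1 eu; split; first by rewrite -(tpb_comp charK0 hL) u1.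
rewrite {1}eu (linB (@tpbl _ _ _)) (linZ (@tpbl _ _ _)) (tpb_tP charK0 gs f).
by rewrite (tpb_tS charK0 gs hL f) (tpb_br charK0 hL).
Qed.

Lemma reduced_unique n (u v : T n) : reduced u -> reduced v -> tP u = tP v -> u = v.
Proof.
move=> [_ eu] [_ ev] e; apply: (fixT_unique nL (Phi := fun w => tP v - 2^-1 *: tS (br w w))).
- exact: (contr_tS_sq charK0 gs hL).
- by rewrite -e.
exact: ev.
Qed.

Lemma reduced_exists n (nu : T n) : tens_comp 1 nu = nu -> tP nu = nu ->
  exists2 u, reduced u & tP u = nu.
Proof.
move=> nu1 Pnu; have [u eu u1] : exists2 u, u = nu - 2^-1 *: tS (br u u) & tens_comp 1 u = u.
  apply: (fixT_exists nL (Phi := fun w => nu - 2^-1 *: tS (br w w)) (Q := fun u => tens_comp 1 u = u)).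
  - exact: (contr_tS_sq charK0 gs hL).
  - exact: (lin0 (@tcl n 1)).
  move=> u u1; rewrite (linB (@tcl n 1)) (linZ (@tcl n 1)) nu1.
  have uu : tens_comp (1 + 1) (br u u) = br u u by exact: (tens_br_deg hL (cO n) u1 u1).
  by have -> : tens_comp 1 (tS (br u u)) = tS (br u u) by exact: (tS_comp charK0 gs hL uu).
have Pu : tP u = nu.
  by rewrite eu (linB (@tPl n)) (linZ (@tPl n)) Pnu (tP_tS charK0 gs hL) scaler0 subr0.
by exists u => //; split => //; rewrite Pu.
Qed.

End Curvature.

(** * Decomposition by form degree for a Lie algebra in nonnegative degrees *)

Section Nonnegative.
Variable K : fieldType.
Hypothesis charK0 : [pchar K] =i pred0.
Variable s : forall n, Omega K n -> Omega K n.
Hypothesis gs : gauge s.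
Let two_neq0 : 2 != 0 :> K. Proof. exact: char0_natr. Qed.
Let cO n := Omega_isCdga two_neq0 n.
Variable L : dgLieData K.
Hypothesis hL : isDgLie L.
Hypothesis nL : nilpotent_dgLie L.
Hypothesis nn : nonneg_graded L.
Local Notation T n := (tensor L (Omega K n)).
Local Notation br := (@tens_br K L _).
Local Notation tS := (@tS K s L _).
Local Notation v0 := (ord0 : 'I_3).
Local Notation v1 := mid3.
Local Notation v2 := (ord_max : 'I_3).
Local Notation reduced := (@reduced K s L _).

Let tSl n := @tS_lin _ _ gs _ hL n.
Let tIl k n f := @tI_lin _ charK0 L k n f.
Let tCl n p := @tC_lin _ charK0 L n p.
Let tdAl n := tdA_lin hL (cO n).
Let tdLl n := @tdL_lin K L (Omega K n) hL.
Let brl n := tens_br_linl hL (cO n).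
Let brr n := tens_br_linr hL (cO n).

Section DegreeOne.
Variables (n : nat) (u : T n).
Hypothesis u1 : tens_comp 1 u = u.
Let u0' := tC 0 u.
Let u1' := tC 1 u.

Lemma tC_split : u = tC 0 u + tC 1 u.
Proof.
have z p : tC p.+2 u = 0 by exact: (tC_nonneg charK0 hL nn u1).
have := tC_sum charK0 u; case: n u z => [|m] w z e.
  have w1 : tC 1 w = 0 by exact: (tC_bound charK0).
  by rewrite w1 addr0 {1}e big_ord1.
rewrite {1}e !big_ord_recl big1 ?addr0 // => i _.
exact: (z i).
Qed.

Let c0 : tC 0 u0' = u0'. Proof. by rewrite /u0' (tC_tC charK0). Qed.
Let c1 : tC 1 u1' = u1'. Proof. by rewrite /u1' (tC_tC charK0). Qed.
Let d0 : tens_comp 1 u0' = u0'. Proof. by rewrite /u0' -(tC_comp charK0 hL) u1. Qed.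
Let d1 : tens_comp 1 u1' = u1'. Proof. by rewrite /u1' -(tC_comp charK0 hL) u1. Qed.

Let br01 : br u0' u1' = br u1' u0'.
Proof.
by rewrite (tens_br_antisym hL (cO n) d0 d1) mulr1 expr1z scaleN1r opprK.
Qed.

Lemma br_split : br u u = br u0' u0' + (br u1' u0' *+ 2) + br u1' u1'.
Proof.
rewrite {1 2}tC_split (linD (@brl n _)) !(linD (@brr n _)) -/u0' -/u1' br01 mulr2n.
by rewrite !addrA.
Qed.

Let b00 : tC 0 (br u0' u0') = br u0' u0'. Proof. exact: (tC_br charK0 hL c0 c0). Qed.
Let b10 : tC 1 (br u1' u0') = br u1' u0'. Proof. exact: (tC_br charK0 hL c1 c0). Qed.
Let b11 : tC 2 (br u1' u1') = br u1' u1'. Proof. exact: (tC_br charK0 hL c1 c1). Qed.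

Lemma tC1_sq : tC 1 (br u u) = br u1' u0' *+ 2.
Proof.
rewrite br_split !(linD (@tCl n 1)) -b00 -b11 !(tC_tC charK0) add0r addr0.
by rewrite !b10 mulr2n.
Qed.

Lemma tC2_sq : tC 2 (br u u) = br u1' u1'.
Proof.
rewrite br_split !(linD (@tCl n 2)) -b00 -b10 b11.
by rewrite !(tC_tC charK0) !add0r.
Qed.

Lemma half_double (V : lmodType K) (v : V) : 2^-1 *: (v *+ 2) = v.
Proof. by rewrite -scaler_nat (half2 charK0). Qed.

Lemma tC1_curv : tC 1 (curv u) = tdA u0' + tdL u1' + br u1' u0'.
Proof.
rewrite /curv !(linD (@tCl n 1)) (linZ (@tCl n 1)) tC1_sq half_double.
by rewrite (tC_tdL charK0 hL) (tC_tdA charK0 hL) -/u0' -/u1' [tdL _ + _]addrC.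
Qed.

Lemma tC2_curv : tC 2 (curv u) = tdA u1' + 2^-1 *: br u1' u1'.
Proof.
rewrite /curv !(linD (@tCl n 2)) (linZ (@tCl n 2)) tC2_sq.
have z : tC 2 u = 0 by exact: (tC_nonneg charK0 hL nn u1).
by rewrite (tC_tdL charK0 hL) (tC_tdA charK0 hL) z (lin0 (@tdLl n)) add0r.
Qed.

Hypothesis eu : u = tP u - 2^-1 *: tS (br u u).

(** As s lowers the form degree by 1, only the mixed terms of [u, u] contribute. They are equal,
    both entries having odd degree, so the equation is linear in the function part. *)
Lemma tC0_reduced : u0' = tP u0' - tS (br u1' u0').
Proof.
have := f_equal (tC 0) eu; rewrite (linB (@tCl n 0)) (linZ (@tCl n 0)) (tC_tP charK0 gs).
by rewrite (tC_tS charK0 gs hL) tC1_sq mulr2n (linD (@tSl n)) -mulr2n half_double.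
Qed.

(** The part of form degree 1 obeys a closed equation of the same shape as u. It can therefore be
    treated on its own, as a connection with values in degree 0. *)
Lemma tC1_reduced : u1' = tP u1' - 2^-1 *: tS (br u1' u1').
Proof.
have := f_equal (tC 1) eu; rewrite (linB (@tCl n 1)) (linZ (@tCl n 1)) (tC_tP charK0 gs).
by rewrite (tC_tS charK0 gs hL) tC2_sq.
Qed.

End DegreeOne.

Lemma tC_reduced n (u : T n) : reduced u -> reduced (tC 1 u).
Proof.
by case=> h1 eu; split; [rewrite -(tC_comp charK0 hL) h1 | exact: tC1_reduced].
Qed.

Lemma tI_tC k n (f : 'I_k.+1 -> 'I_n.+1) (u : T n) : tI f (tC k u) = tI f u.
Proof.
have := tI_top charK0 (tpb f u) id k; rewrite eqxx -(tpb_tC charK0) !(tI_tpb charK0).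
exact.
Qed.

(** A degenerate edge factors through a point, where there are no 1-forms. This matches the
    identities of the groupoid. *)
Lemma tI_constant n (i : 'I_n.+1) (u : T n) : tI (edge i i) u = 0.
Proof.
pose c (p : 'I_2) : 'I_1 := ord0.
have e : vtx i \o c = edge i i by apply: funext => p; rewrite /edge /=; case: ifP.
rewrite -e -(tI_tpb charK0) -tI_tC.
have -> : tC 1 (tpb (vtx i) u) = 0 by exact: (tC_bound charK0).
exact: (lin0 (@tIl _ _ _)).
Qed.

Section Interval.
Variable u : T 1.
Hypothesis ru : reduced u.
Let x := tI (edge ord0 ord_max) u.

Let u1 : tens_comp 1 u = u. Proof. by case: ru. Qed.

Lemma reduced_edge_form : tC 1 u = tens x (Oom K).
Proof.
have sC := reduced_tS charK0 gs hL (tC_reduced ru).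
have cC : tC 1 (tC 1 u) = tC 1 u by rewrite (tC_tC charK0).
by rewrite (edge_form charK0 gs hL cC sC) tI_tC.
Qed.

Lemma reduced_edge_homog : lie_comp 0 x = x.
Proof. exact: (tI_comp charK0 hL (edge ord0 ord_max) u1). Qed.

Lemma tC1_curv_transport : tC 1 (curv u) = transport x (tC 0 u).
Proof. by rewrite (tC1_curv u1) reduced_edge_form. Qed.

Let c0 : tC 0 (tC 0 u) = tC 0 u. Proof. by rewrite (tC_tC charK0). Qed.
Let d0 : tens_comp 1 (tC 0 u) = tC 0 u. Proof. by rewrite -(tC_comp charK0 hL) u1. Qed.

Lemma reduced_act : curv u = 0 ->
  exp_act (- x) (tI (vtx ord0) u) = tI (vtx ord_max) u.
Proof.
move=> F0; have t0 : transport x (tC 0 u) = 0.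
  by rewrite -tC1_curv_transport F0; exact: (lin0 (@tCl 1 1)).
have := transport_end charK0 gs hL nL reduced_edge_homog d0 c0 t0.
by rewrite !tI_tC => ->.
Qed.

(** The function part satisfies the gauge-projected transport equation along x dt, and the
    hypothesis gives it the endpoint of the flow; so it is the flow, and the curvature has no part
    of form degree 1. *)
Lemma act_reduced : exp_act (- x) (tI (vtx ord0) u) = tI (vtx ord_max) u ->
  tI (edge ord0 ord_max) (curv u) = 0.
Proof.
move=> h; rewrite -tI_tC tC1_curv_transport.
suff -> : transport x (tC 0 u) = 0 by exact: (lin0 (@tIl _ _ _)).
apply: (transport_fix charK0 gs hL nL reduced_edge_homog c0).
- exact: (tI_vtx_homog charK0 hL ord0 d0).
- by have := tC0_reduced u1 ru.2; rewrite reduced_edge_form.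
by rewrite !tI_tC.
Qed.

End Interval.

Section Triangle.
Variable u : T 2.
Hypothesis ru : reduced u.
Let u1 : tens_comp 1 u = u. Proof. by case: ru. Qed.

Lemma reduced_CH : curv u = 0 ->
  - tI (edge v0 v2) u = CH (- tI (edge v1 v2) u) (- tI (edge v0 v1) u).
Proof.
move=> F0; rewrite -[tI (edge v0 v2) u]tI_tC -[tI (edge v1 v2) u]tI_tC -[tI (edge v0 v1) u]tI_tC.
apply: (flat2_CH charK0 gs hL nL nn); have rC := tC_reduced ru.
split; [by case: rC | by rewrite (tC_tC charK0) | exact: (reduced_tS charK0 gs hL rC) |].
by rewrite -(tC2_curv u1) F0; exact: (lin0 (@tCl 2 2)).
Qed.

(** The horn formed by the edges 01 and 12 of u is filled by a flat triangle w. Its third edge is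
    the Campbell-Hausdorff product, hence that of u, so w and the part of form degree 1 of u solve
    the same equation with the same projection and coincide; the curvature of u then has no part of
    form degree 2. *)
Lemma CH_reduced :
  - tI (edge v0 v2) u = CH (- tI (edge v1 v2) u) (- tI (edge v0 v1) u) ->
  tI (fun i : 'I_3 => i) (curv u) = 0.
Proof.
move=> h; have edge0 (i j : 'I_3) : lie_comp 0 (tI (edge i j) u) = tI (edge i j) u.
  exact: (tI_comp charK0 hL (edge i j) u1).
have [w [fw e01 e12]] := horn charK0 gs hL nL (edge0 v0 v1) (edge0 v1 v2).
have e02 : tI (edge v0 v2) w = tI (edge v0 v2) u.
  have := flat2_CH charK0 gs hL nL nn fw; rewrite e01 e12 -h => /(f_equal -%R).
  by rewrite !opprK.
have [w1 wC wS wF] := fw.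
have rw : reduced w.
  split => //; have := t_homotopy charK0 gs hL w; rewrite wS (lin0 (@tdAl 2)) add0r.
  move/eqP: wF; rewrite addr_eq0 => /eqP ->; rewrite (linN (@tSl 2)) (linZ (@tSl 2)).
  by move/eqP; rewrite subr_eq addrC => /eqP.
have uw : tC 1 u = w.
  apply: (reduced_unique charK0 gs hL nL (tC_reduced ru) rw).
  apply: (tP_eq1 charK0); [by rewrite (tC_tC charK0) | exact: wC |].
  by apply: ord3_case; apply: ord3_case => // ij; rewrite tI_tC.
rewrite -tI_tC (tC2_curv u1) uw wF; exact: (lin0 (@tIl _ _ _)).
Qed.

End Triangle.
End Nonnegative.

(** * Coordinates on the simplices and the isomorphism with the nerve *)

Lemma sval_inj (A : Type) (P : A -> Prop) (x y : {a | P a}) : sval x = sval y -> x = y.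
Proof. by case: x y => x px [y py] /= e; apply: eq_exist. Qed.

Lemma nerve_cell_ext (K : fieldType) (L : dgLieData K) n (F G : nerve_cell (Deligne L) n) :
  (forall i, sval (nerve_ob F i) = sval (nerve_ob G i)) ->
  (forall i j ij, sval (nerve_mor F (i := i) (j := j) ij) = sval (nerve_mor G ij)) -> F = G.
Proof.
case: F G => [oF mF iF cF] [oG mG iG cG] /= eo em.
have e : oF = oG by apply: funext => i; apply: sval_inj; exact: eo.
case: oG / e mG iG cG em {eo} => mG iG cG em.
have e : mF = mG.
  apply: functional_extensionality_dep => i; apply: functional_extensionality_dep => j.
  by apply: functional_extensionality_dep => ij; apply: sval_inj; exact: em.
case: mG / e iG cG {em} => iG cG.
by congr NerveCell; apply: Prop_irrelevance.
Qed.

Lemma inj_surj_bijective (A B : Type) (f : A -> B) : (forall x y, f x = f y -> x = y) ->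
  (forall y, exists x, f x = y) -> bijective f.
Proof.
move=> fi fs; exists (fun y => projT1 (cid (fs y))) => [x|y].
  by apply: fi; case: cid.
by case: cid.
Qed.

Section Triangles.
Variables (n : nat) (i j k : 'I_n.+1).

Definition triangle (p : 'I_3) : 'I_n.+1 :=
  if p == ord0 then i else if p == mid3 then j else k.

Lemma triangle_monoP : (i <= j)%N -> (j <= k)%N ->
  forall p q : 'I_3, (p <= q)%N -> (triangle p <= triangle q)%N.
Proof.
move=> ij jk; apply: ord3_case; apply: ord3_case => //= _; exact: leq_trans jk.
Qed.

Definition triangle_mono (ij : (i <= j)%N) (jk : (j <= k)%N) :=
  MonotoneMap (triangle_monoP ij jk).

End Triangles.

Lemma comp_edge k n (f : 'I_k.+1 -> 'I_n.+1) (i j : 'I_k.+1) : f \o edge i j = edge (f i) (f j).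
Proof. by apply: funext => p; rewrite /edge /=; case: ifP. Qed.

Section Nerve.
Variable K : fieldType.
Hypothesis charK0 : [pchar K] =i pred0.
Variable s : forall n, Omega K n -> Omega K n.
Hypothesis gs : gauge s.
Let two_neq0 : 2 != 0 :> K. Proof. exact: char0_natr. Qed.
Let cO n := Omega_isCdga two_neq0 n.
Variable L : dgLieData K.
Hypothesis hL : isDgLie L.
Hypothesis nL : nilpotent_dgLie L.
Hypothesis nn : nonneg_graded L.
Local Notation T n := (tensor L (Omega K n)).
Local Notation br := (@tens_br K L _).
Local Notation tS := (@tS K s L _).
Local Notation v0 := (ord0 : 'I_3).
Local Notation v1 := mid3.
Local Notation v2 := (ord_max : 'I_3).
Local Notation reduced := (@reduced K s L _).
Local Notation flat u := (reduced u /\ curv u = 0).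

Let tPl n := @tP_lin _ charK0 L n.
Let tIl k n f := @tI_lin _ charK0 L k n f.
Let tpbl k n f := @tpb_lin _ charK0 L k n f.
Let tcl n := tens_comp_lin hL (cO n).

Lemma gammaP n (u : T n) : gamma s L n u <-> flat u.
Proof.
have cE : curv u = (lie_diff (u : tensLie L (Omega K n)) : T n) + 2^-1 *: br u u.
  by rewrite /curv; congr (_ + _); exact: (esym (tens_diffE hL (cO n) u)).
split=> [[[u1 F0] /(tS_zero gs hL) su]|[ru F0]].
  have F0' : curv u = 0 by apply: (etrans cE); exact: F0.
  by split => //; exact: (gauge_reduced charK0 gs hL u1 F0' su).
split; last by apply/(tS_zero gs hL); exact: (reduced_tS charK0 gs hL ru).
by split; [case: ru | apply: (etrans (esym cE)); exact: F0].
Qed.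

Lemma flat_tpb k n (f : monotone_map k n) (u : T n) : flat u -> flat (tpb f u).
Proof.
move=> [ru F0]; split; first exact: (reduced_tpb charK0 gs hL f ru).
by rewrite -(tpb_curv charK0 hL) F0; exact: (lin0 (@tpbl _ _ _)).
Qed.

Lemma gamma_stable : simplicial_subset (gamma s L).
Proof. by move=> k n f u /gammaP fu; apply/gammaP; exact: flat_tpb. Qed.

Section Coordinates.
Variables (n : nat) (u : T n).
Hypothesis fu : flat u.

Lemma vertex_MC i : MC (tI (vtx i) u : L).
Proof.
case: fu => -[u1 _] F0; split; first exact: (tI_vtx_homog charK0 hL i u1).
by rewrite -(tI_vtx_curv charK0 hL) F0; exact: (lin0 (@tIl _ _ _)).
Qed.

Lemma edge_hom (i j : 'I_n.+1) (ij : (i <= j)%N) : lie_homog 0 (- tI (edge i j) u : L) /\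
  exp_act (- tI (edge i j) u) (tI (vtx i) u) = tI (vtx j) u.
Proof.
have [re F0] := flat_tpb (edge_mono ij) fu; have [[u1 _] _] := fu.
split.
  apply: (etrans (linN (lie_comp_lin hL 0) _)).
  exact: (f_equal -%R (tI_comp charK0 hL (edge i j) u1)).
have := reduced_act charK0 gs hL nL nn re F0.
by rewrite !(tI_tpb charK0) comp_edge.
Qed.

Lemma edge_CH (i j k : 'I_n.+1) : (i <= j)%N -> (j <= k)%N ->
  - tI (edge i k) u = CH (- tI (edge j k) u) (- tI (edge i j) u).
Proof.
move=> ij jk; have [re F0] := flat_tpb (triangle_mono ij jk) fu.
have := reduced_CH charK0 gs hL nL nn re F0.
by rewrite !(tI_tpb charK0) !comp_edge.
Qed.

Definition simplex_functor : nerve_cell (Deligne L) n :=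
  @NerveCell (Deligne L) n (fun i => exist _ (tI (vtx i) u) (vertex_MC i))
    (fun i j ij => exist _ (- tI (edge i j) u) (edge_hom ij))
    (fun i ii => etrans (f_equal -%R (tI_constant charK0 i u)) (oppr0 L))
    (fun i j k ij jk ik => edge_CH ij jk).

End Coordinates.

Lemma tI_higher k n (f : 'I_k.+1 -> 'I_n.+1) (u : T n) r : tens_comp r u = u -> r < k%:Z ->
  tI f u = 0.
Proof.
by move=> ur rk; rewrite -(tI_tC charK0) (tC_nonneg charK0 hL nn ur rk); exact: (lin0 (@tIl _ _ _)).
Qed.

Lemma flat_injective n (u v : T n) : reduced u -> reduced v ->
  (forall i, tI (vtx i) u = tI (vtx i) v) ->
  (forall i j : 'I_n.+1, (i <= j)%N -> tI (edge i j) u = tI (edge i j) v) -> u = v.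
Proof.
move=> ru rv hv he; apply: (reduced_unique charK0 gs hL nL ru rv).
apply/eqP; rewrite -subr_eq0 -(linB (@tPl n)); apply/eqP.
apply: (tP_zero charK0) => k f fi; rewrite (linB (@tIl _ _ _)).
case: k f fi => [|[|k]] f fi.
- by rewrite (funE1 f) hv subrr.
- by rewrite (funE2 f) he ?subrr //; apply: ltnW; apply: fi.
by rewrite (tI_higher f ru.1) // (tI_higher f rv.1) // subrr.
Qed.

Section Surjective.
Variables (n : nat) (a : 'I_n.+1 -> L) (X : 'I_n.+1 -> 'I_n.+1 -> L).
Hypothesis aMC : forall i, MC (a i).
Hypothesis X0 : forall i j, lie_comp 0 (X i j) = X i j.
Hypothesis Xact : forall i j : 'I_n.+1, (i < j)%N -> exp_act (X i j) (a i) = a j.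
Hypothesis XCH : forall i j k : 'I_n.+1, (i < j)%N -> (j < k)%N -> X i k = CH (X j k) (X i j).

(** The combination of elementary forms with value a_i at the vertex i and integral - X_ij over the
    edge ij; it is the prescribed projection of the simplex. *)
Let nu : T n := \sum_i tens (a i) (Om_t K i) -
  \sum_(p : 'I_n.+1 * 'I_n.+1 | (p.1 < p.2)%N) tens (X p.1 p.2) (Om_edge K p.1 p.2).

Let nu_comp : tens_comp 1 nu = nu.
Proof.
rewrite (linB (@tcl n 1)) !(lin_sum (@tcl n 1)); congr (_ - _); apply: eq_bigr => i _.
  exact: (tens_comp_pure_form charK0 hL (aMC i).1 (Om_comp_t K i)).
exact: (tens_comp_pure_form charK0 hL (X0 _ _) (Om_comp_edge charK0 _ _)).
Qed.

Let nu_tP : tP nu = nu.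
Proof.
rewrite (linB (@tPl n)) !(lin_sum (@tPl n)); congr (_ - _); apply: eq_bigr => i h.
  exact: (tP_t charK0).
exact: (tP_edge charK0 _ h).
Qed.

Let nu_vtx i : tI (vtx i) nu = a i.
Proof.
rewrite (linB (@tIl _ _ _)) !(lin_sum (@tIl _ _ _)) [X in _ - X]big1 => [|p _]; last first.
  exact: (tI_deg charK0 (vtx i) (tC_edge charK0 _ _ _) (isT : 1%N != 0%N)).
rewrite subr0 (bigD1 i) //= (tI_vtx_t charK0) eqxx scale1r big1 ?addr0 // => j ji.
rewrite (tI_vtx_t charK0) eq_sym (negPf ji); exact: scale0r.
Qed.

Let nu_edge (i j : 'I_n.+1) : (i < j)%N -> tI (edge i j) nu = - X i j.
Proof.
move=> ij; rewrite (linB (@tIl _ _ _)) !(lin_sum (@tIl _ _ _)) [X in X - _]big1 => [|p _]; last first.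
  exact: (tI_deg charK0 (edge i j) (tC_t charK0 _ _) (isT : 0%N != 1%N)).
rewrite sub0r (bigD1 (i, j)) //= (tI_edge_edge charK0 _ ij ij) !eqxx scale1r big1 ?addr0 //.
move=> [k l] /= /andP[kl ne]; rewrite (tI_edge_edge charK0 _ ij kl).
have -> : (i == k) && (j == l) = false.
  by apply: contraNF ne => /andP[/eqP -> /eqP ->].
exact: scale0r.
Qed.

Lemma flat_surjective : exists u : T n, [/\ flat u, forall i, tI (vtx i) u = a i &
  forall i j : 'I_n.+1, (i < j)%N -> tI (edge i j) u = - X i j].
Proof.
have [u ru Pu] := reduced_exists charK0 gs hL nL nu_comp nu_tP; have [u1 eu] := ru.
have Iu k (f : monotone_map k n) : tI f u = tI f nu.
  rewrite {1}eu (linB (@tIl _ _ _)) (linZ (@tIl _ _ _)) Pu (tI_tS charK0 gs hL f).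
  by rewrite scaler0 subr0.
have uv i : tI (vtx i) u = a i by rewrite (Iu _ (vtx_mono i)) nu_vtx.
have ue (i j : 'I_n.+1) (ij : (i < j)%N) : tI (edge i j) u = - X i j.
  by rewrite (Iu _ (edge_mono (ltnW ij))) nu_edge.
exists u; split => //; split => //; apply: (reduced_curv charK0 gs hL nL ru).
have F2 := curv_deg charK0 hL u1.
apply: (tP_zero charK0) => k f fi; case: k f fi => [|[|[|k]]] f fi.
- by rewrite (funE1 f) (tI_vtx_curv charK0 hL) uv; case: (aMC (f ord0)).
- rewrite (funE2 f); have ij : (f ord0 < f ord_max)%N by exact: fi.
  set i := f ord0 in ij *; set j := f ord_max in ij *.
  have re := reduced_tpb charK0 gs hL (edge_mono (ltnW ij)) ru.
  have := act_reduced charK0 gs hL nL nn re.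
  rewrite -(tpb_curv charK0 hL) !(tI_tpb charK0) comp_edge; apply.
  have e : exp_act (- tI (edge i j) u) (tI (vtx i) u) = tI (vtx j) u.
    by rewrite (ue _ _ ij) opprK !uv; exact: Xact.
  exact: e.
- have fm (p q : 'I_3) : (p <= q)%N -> (f p <= f q)%N.
    by rewrite leq_eqVlt => /predU1P[/val_inj ->|/fi /ltnW].
  pose fM := MonotoneMap fm.
  have re := reduced_tpb charK0 gs hL fM ru.
  have := CH_reduced charK0 gs hL nL nn re.
  rewrite -(tpb_curv charK0 hL) !(tI_tpb charK0) !comp_edge; apply.
  have l01 : (f v0 < f v1)%N by exact: fi.
  have l12 : (f v1 < f v2)%N by exact: fi.
  have l02 : (f v0 < f v2)%N by exact: fi.
  have e : - tI (edge (f v0) (f v2)) u =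
      CH (- tI (edge (f v1) (f v2)) u) (- tI (edge (f v0) (f v1)) u).
    by rewrite (ue _ _ l01) (ue _ _ l12) (ue _ _ l02) !opprK; exact: XCH.
  exact: e.
exact: (tI_higher f F2).
Qed.

End Surjective.

Definition gamma_nerve n (x : subsimplicial gamma_stable n) : nerve (Deligne L) n :=
  simplex_functor ((gammaP (sval x)).1 (proj2_sig x)).

Lemma gamma_nerve_bij n : bijective (@gamma_nerve n).
Proof.
apply: inj_surj_bijective => [x y e|c].
  apply: sval_inj.
  have [rx _] := (gammaP (sval x)).1 (proj2_sig x).
  have [ry _] := (gammaP (sval y)).1 (proj2_sig y).
  have ev i : tI (vtx i) (sval x) = tI (vtx i) (sval y).
    exact: (f_equal (fun F : nerve_cell (Deligne L) n => sval (nerve_ob F i)) e).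
  apply: (flat_injective rx ry ev) => i j ij.
  apply: oppr_inj.
  exact: (f_equal (fun F : nerve_cell (Deligne L) n => sval (nerve_mor F ij)) e).
(* For i > j there is no morphism; 0 is a filler that keeps X in degree 0. *)
pose X (i j : 'I_n.+1) : L :=
  if pselect (i <= j)%N is left h then sval (nerve_mor c h) else 0.
have XE (i j : 'I_n.+1) (ij : (i <= j)%N) : X i j = sval (nerve_mor c ij).
  by rewrite /X; case: pselect => // h; congr (sval (nerve_mor c _)); exact: Prop_irrelevance.
have X0 i j : lie_comp 0 (X i j) = X i j.
  rewrite /X; case: pselect => [h|_]; last exact: (lin0 (lie_comp_lin hL 0)).
  exact: (proj2_sig (nerve_mor c h)).1.
have aMC i : MC (sval (nerve_ob c i)) by exact: (proj2_sig (nerve_ob c i)).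
have Xact (i j : 'I_n.+1) : (i < j)%N ->
    exp_act (X i j) (sval (nerve_ob c i)) = sval (nerve_ob c j).
  by move=> ij; rewrite (XE _ _ (ltnW ij)); exact: (proj2_sig (nerve_mor c (ltnW ij))).2.
have XCH (i j k : 'I_n.+1) : (i < j)%N -> (j < k)%N -> X i k = CH (X j k) (X i j).
  move=> /ltnW ij /ltnW jk; have ik := leq_trans ij jk; rewrite (XE _ _ ij) (XE _ _ jk) (XE _ _ ik).
  exact: (nerve_comp c ij jk ik).
have [u [fu uv ue]] := flat_surjective aMC X0 Xact XCH.
exists (exist _ u ((gammaP u).2 fu)); apply: nerve_cell_ext => [i|i j ij]; first exact: uv.
change (- tI (edge i j) u = sval (nerve_mor c ij)).
(* On a degenerate edge the integral vanishes and the functor has an identity, whose representative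
   is 0. *)
have := ij; rewrite leq_eqVlt => /predU1P[/val_inj e|lt].
  case: j / e ij => ii; rewrite (tI_constant charK0) oppr0.
  exact: (esym (nerve_id c ii)).
by rewrite (ue _ _ lt) opprK; exact: XE.
Qed.

Lemma gamma_nerve_face k n (f : monotone_map k n) (x : subsimplicial gamma_stable n) :
  gamma_nerve (face f x) = face f (gamma_nerve x).
Proof.
apply: nerve_cell_ext => [i|i j ij].
  exact: (tI_tpb charK0 f (vtx i) (sval x)).
apply: (f_equal -%R); apply: (etrans (tI_tpb charK0 f (edge i j) (sval x))).
by rewrite comp_edge.
Qed.

End Nerve.

Theorem mainTheorem5 (K : fieldType) (charK0 : [pchar K] =i pred0)
    (s : forall n : nat, Omega K n -> Omega K n) (gauge_s : gauge s)
    (g : dgLie K) (nilpotent_g : nilpotent_dgLie g)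
    (nonneg_g : nonneg_graded g) :
  exists stable : simplicial_subset (gamma s g),
    simplicial_iso (subsimplicial stable) (nerve (Deligne g)).
Proof.
have hg := dgLieP g; exists (gamma_stable charK0 gauge_s hg).
exists (fun n x => gamma_nerve nilpotent_g nonneg_g x); split.
  exact: gamma_nerve_bij.
exact: gamma_nerve_face.
Qed.
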